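(* Let $M=\mathbb{R}^4\times S^3$ be equipped with the $\mathrm{SU}(2)^3$-invariant coclosed $G_2$-structure determined by a function $A_1$ (with $A_1=A_2=A_3$) and a parameter $b_0>0$, as described in the context. Then there exist two 1-parameter families of smooth $\mathrm{SU}(2)^3$-invariant $G_2$-instantons on $M$ with gauge group $\mathrm{SU}(2)$: a family $\theta^{x_1}$, $x_1\in[0,\infty)$, extending smoothly over the singular orbit on the bundle $P_1$; and a family $\theta_{y_0}$, $y_0\in[-1/b_0,1/b_0]$, extending smoothly over the singular orbit on the bundle $P_{\mathrm{id}}$.
   Context: Manifold. View $M=\mathbb{R}^4\times S^3\subset\mathbb{H}\times\mathbb{H}$ with $\mathrm{SU}(2)^2$ (pairs of unit quaternions) acting by $(a_1,a_2)\cdot(p,q)=(a_1p,a_1q\bar a_2)$. The singular orbit is $S^3=\{0\}\times S^3\cong \mathrm{SU}(2)^2/\Delta\mathrm{SU}(2)$, and its complement is identified with $(0,\infty)\times\mathrm{SU}(2)^2$ by $(t,(a_1,a_2))\mapsto(a_1t,a_1\bar a_2)$. Let $\{T_i\}_{i=1}^3$ be a basis of $\mathfrak{su}(2)$ with $[T_i,T_j]=2\epsilon_{ijk}T_k$ (a ''standard basis''), $T_i^{+}=(T_i,T_i)$, $T_i^-=(T_i,-T_i)$, and let $\eta_i^\pm$ be the dual left-invariant 1-forms on $\mathrm{SU}(2)^2$. A dot denotes $d/dt$. A function on $[0,\infty)$ is called odd (even) if its Taylor expansion at $0$ has only odd (even) powers. $G_2$-structure. Let $A_1:[0,\infty)\to\mathbb{R}$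 be smooth, positive on $(0,\infty)$, odd at $0$, with $\dot A_1(0)=1/2$, and let $b_0>0$. Let $B_1$ be the positive smooth function on $[0,\infty)$, even at $0$, with $B_1(0)=b_0$ and $\frac{d}{dt}(A_1^2B_1^2)=A_1^3+A_1B_1^2$. Put $A_i=A_1$, $B_i=B_1$ for $i=1,2,3$. On $(0,\infty)\times \mathrm{SU}(2)^2$ set $\omega=4\sum_iA_iB_i\,\eta_i^-\wedge\eta_i^+$, $\Omega_1=8B_1B_2B_3\,\eta_1^-\wedge\eta_2^-\wedge\eta_3^- -8\sum_{cyc}A_iA_jB_k\,\eta_i^+\wedge\eta_j^+\wedge\eta_k^-$, $\Omega_2=-8A_1A_2A_3\,\eta_1^+\wedge\eta_2^+\wedge\eta_3^+ +8\sum_{cyc}B_iB_jA_k\,\eta_i^-\wedge\eta_j^-\wedge\eta_k^+$ (sums over cyclic permutations $(i,j,k)$ of $(1,2,3)$). The $G_2$-structure is $\varphi=dt\wedge\omega+\Omega_1$, with $\psi={*_\varphi}\varphi=\frac12\omega^2-dt\wedge\Omega_2$ and metric $dt^2+\sum_i(2A_i)^2\eta_i^+\otimes\eta_i^++\sum_i(2B_i)^2\eta_i^-\otimes\eta_i^-$; it extends smoothly to $M$ and $d\psi=0$. It is invariant under $\mathrm{SU}(2)^3$, where the third factor acts by $c\cdot(p,q)=(pc^{-1},q)$, i.e. $(t,(a_1,a_2))\mapsto(t,(a_1c^{-1},a_2c^{-1}))$. Instantons and bundles. A connection $A$ is a $G_2$-instanton if $F_A\wedge\psi=0$. For a homomorphism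 $\lambda:\Delta\mathrm{SU}(2)\to\mathrm{SU}(2)$, trivial ($\lambda=1$) or the identity ($\lambda=\mathrm{id}$), let $P_\lambda=\mathrm{SU}(2)^2\times_{(\Delta\mathrm{SU}(2),\lambda)}\mathrm{SU}(2)$, pulled back to $M$ via the projection to the singular orbit. Away from the singular orbit both $P_1$ and $P_{\mathrm{id}}$ are equivariantly identified (via $(h,g)\mapsto[h,g]$) with the trivial bundle $(0,\infty)\times\mathrm{SU}(2)^2\times\mathrm{SU}(2)$, so invariant connections there are $\mathfrak{su}(2)$-valued 1-forms; ''extends smoothly on $P_\lambda$'' means that the connection extends to a smooth connection on $P_\lambda\to M$. $\mathrm{SU}(2)^3$-invariant means invariant under a lift of the $\mathrm{SU}(2)^3$-action extending the given $\mathrm{SU}(2)^2$-action on the bundle. The families. With $F=-\frac{\dot A_1}{A_1}+\frac1{A_1}-\frac{A_1}{B_1^2}$ on $(0,\infty)$, $$\theta^{x_1}=\frac{x_1A_1(t)e^{\int_{1/2}^tF(\xi)d\xi}}{1+x_1\int_0^te^{\int_{1/2}^\eta F(\xi)d\xi}d\eta}\sum_{i=1}^3T_i\otimes\eta_i^+ .$$ $\theta_{y_0}$ denotes a connection of the form $\theta_{y_0}=A_1x\sum_iT_i\otimes\eta_i^++B_1y\sum_iT_i\otimes\eta_i^-$, with $x,y$ functions of $t>0$ and $\lim_{t\to0}y(t)=y_0$, extending smoothly over the singular orbit on $P_{\mathrm{id}}$. *)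

(* Defs.v *)
(* Stdlib reals with Coquelicot. *)
From Stdlib Require Import Reals Lra List.
From Coquelicot Require Import Coquelicot.
Import ListNotations.
Open Scope R_scope.

(** * Smooth maps *)

(* [Ck n U f]: [f] has, on [U], all iterated directional derivatives up to
   order [n], and they are continuous.  It is used on open subsets [U] of
   finite-dimensional [V], where this is the usual class C^n. *)
Fixpoint Ck {V W : NormedModule R_AbsRing} (n : nat) (U : V -> Prop) (f : V -> W)
  : Prop :=
  (forall x, U x -> continuous f x) /\
  match n with
  | O => True
  | S k => forall v : V, exists g : V -> W,
      Ck k U g /\
      forall x, U x -> is_derive (fun s : R => f (plus x (scal s v))) 0 (g x)
  end.

(* Smoothness of [f] on a subset [S] of a vector space (in practice a
   submanifold): [f] extends locally to a smooth map of the ambient space.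
   The values of [f] off [S] are irrelevant. *)
Definition smooth_on {V W : NormedModule R_AbsRing} (S : V -> Prop) (f : V -> W)
  : Prop :=
  forall x, S x ->
  exists (U : V -> Prop) (g : V -> W),
    open U /\ U x /\ (forall n, Ck n U g) /\
    forall y, U y -> S y -> g y = f y.

(* Functions on the closed half-line are functions [R -> R] whose values at
   negative arguments are irrelevant. *)
Definition smooth_extension (f g : R -> R) : Prop :=
  (forall n t, ex_derive_n g n t) /\ forall t, 0 <= t -> g t = f t.

Definition smooth_halfline (f : R -> R) : Prop := exists g, smooth_extension f g.

(* The Taylor coefficients at 0 do not depend on the extension. *)
Definition odd_at_0 (f : R -> R) : Prop :=
  forall g k, smooth_extension f g -> Derive_n g (2 * k) 0 = 0.

Definition even_at_0 (f : R -> R) : Prop :=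
  forall g k, smooth_extension f g -> Derive_n g (2 * k + 1) 0 = 0.

Definition is_right_derive (f : R -> R) (x l : R) : Prop :=
  filterlim (fun t => (f t - f x) / (t - x)) (at_right x) (locally l).

(** * Quaternions, SU(2) and su(2) *)

Notation quat := (R * R * R * R)%type.

Definition qmul (x y : quat) : quat :=
  let '(a, b, c, d) := x in
  let '(e, f, g, h) := y in
  (a * e - b * f - c * g - d * h,
   a * f + b * e + c * h - d * g,
   a * g - b * h + c * e + d * f,
   a * h + b * g - c * f + d * e).

Infix "**" := qmul (at level 40, left associativity).

Definition qone : quat := (1, 0, 0, 0).

Definition qconj (x : quat) : quat :=
  let '(a, b, c, d) := x in (a, - b, - c, - d).

Definition qdot (x y : quat) : R :=
  let '(a, b, c, d) := x in
  let '(e, f, g, h) := y in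
  a * e + b * f + c * g + d * h.

Definition qabs (x : quat) : R := sqrt (qdot x x).

Definition qdir (x : quat) : quat := scal (/ qabs x) x.

Definition SU2 (x : quat) : Prop := qdot x x = 1.

Definition su2 (x : quat) : Prop := qdot x qone = 0.

Definition bracket (x y : quat) : quat := minus (x ** y) (y ** x).

Inductive idx := I1 | I2 | I3.

Definition nxt (i : idx) : idx :=
  match i with I1 => I2 | I2 => I3 | I3 => I1 end.

Definition T (i : idx) : quat :=
  match i with I1 => (0, 1, 0, 0) | I2 => (0, 0, 1, 0) | I3 => (0, 0, 0, 1) end.

Definition qcomp (i : idx) (x : quat) : R := qdot x (T i).

Definition sum3 {G : AbelianMonoid} (f : idx -> G) : G :=
  plus (plus (f I1) (f I2)) (f I3).

Ltac qsplit := repeat match goal with |- (_, _) = (_, _) => apply f_equal2 end.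

Lemma T_standard (i : idx) : bracket (T i) (T (nxt i)) = scal 2 (T (nxt (nxt i))).
Proof.
destruct i; cbv -[Rplus Rmult Ropp Rminus IZR]; qsplit; ring.
Qed.

Lemma qmulA x y z : x ** (y ** z) = x ** y ** z.
Proof.
destruct x as [[[? ?] ?] ?], y as [[[? ?] ?] ?], z as [[[? ?] ?] ?].
cbn; qsplit; ring.
Qed.

Lemma qmul1l x : qone ** x = x.
Proof. destruct x as [[[? ?] ?] ?]; cbn; qsplit; ring. Qed.

Lemma qmul1r x : x ** qone = x.
Proof. destruct x as [[[? ?] ?] ?]; cbn; qsplit; ring. Qed.

Lemma qconj_mul x y : qconj (x ** y) = qconj y ** qconj x.
Proof.
destruct x as [[[? ?] ?] ?], y as [[[? ?] ?] ?].
cbn; qsplit; ring.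
Qed.

Lemma qconjK x : qconj (qconj x) = x.
Proof. destruct x as [[[? ?] ?] ?]; cbn; qsplit; ring. Qed.

Lemma mul_qconj x : SU2 x -> x ** qconj x = qone.
Proof.
destruct x as [[[a b] c] d]; unfold SU2, qone; cbn; intros Hx.
qsplit; try ring; rewrite <- Hx; ring.
Qed.

Lemma qconj_mul_self x : SU2 x -> qconj x ** x = qone.
Proof.
destruct x as [[[a b] c] d]; unfold SU2, qone; cbn; intros Hx.
qsplit; try ring; rewrite <- Hx; ring.
Qed.

Lemma SU2_qconj x : SU2 x -> SU2 (qconj x).
Proof.
destruct x as [[[a b] c] d]; unfold SU2; cbn; intros Hx; rewrite <- Hx; ring.
Qed.

Lemma qdot_mul x y : qdot (x ** y) (x ** y) = qdot x x * qdot y y.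
Proof. destruct x as [[[? ?] ?] ?], y as [[[? ?] ?] ?]; cbn; ring. Qed.

Lemma SU2_mul x y : SU2 x -> SU2 y -> SU2 (x ** y).
Proof. unfold SU2; intros Hx Hy; rewrite qdot_mul, Hx, Hy; ring. Qed.

(** * The manifold M = R^4 x S^3 *)

Notation HH := (quat * quat)%type.

Definition M (m : HH) : Prop := SU2 (snd m).

Definition TM (m v : HH) : Prop := qdot (snd m) (snd v) = 0.

(* the complement of the singular orbit *)
Definition M0 (m : HH) : Prop := M m /\ fst m <> (0, 0, 0, 0).

(* SU(2)^3, and its action on M *)
Notation SU2cube_carrier := (quat * quat * quat)%type.

Definition SU2cube (g : SU2cube_carrier) : Prop :=
  let '(h1, h2, c) := g in SU2 h1 /\ SU2 h2 /\ SU2 c.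

Definition mul3 (g g' : SU2cube_carrier) : SU2cube_carrier :=
  let '(h1, h2, c) := g in
  let '(h1', h2', c') := g' in (h1 ** h1', h2 ** h2', c ** c').

Definition one3 : SU2cube_carrier := (qone, qone, qone).

Definition actM (g : SU2cube_carrier) (m : HH) : HH :=
  let '(h1, h2, c) := g in (h1 ** fst m ** qconj c, h1 ** snd m ** qconj h2).

(* The identification of (0,oo) x SU(2)^2 with M0, and its inverse
   [m |-> (radius m, (a1 m, a2 m))]. *)
Definition chart (t : R) (h1 h2 : quat) : HH := (scal t h1, h1 ** qconj h2).

Definition radius (m : HH) : R := qabs (fst m).
Definition a1 (m : HH) : quat := qdir (fst m).
Definition a2 (m : HH) : quat := qconj (snd m) ** a1 m.

Lemma qabs_scal t h : 0 < t -> SU2 h -> qabs (scal t h) = t.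
Proof.
intros Ht Hh; unfold qabs.
replace (qdot (scal t h) (scal t h)) with (t * t).
  apply sqrt_square; lra.
transitivity (t * t * qdot h h); [rewrite Hh; ring|].
destruct h as [[[? ?] ?] ?]; cbv -[Rplus Rmult]; ring.
Qed.

Lemma chart_in_M0 t h1 h2 : 0 < t -> SU2 h1 -> SU2 h2 -> M0 (chart t h1 h2).
Proof.
intros Ht H1 H2; split.
  apply SU2_mul; [|apply SU2_qconj]; assumption.
intros E; assert (E' : qabs (scal t h1) = 0).
  cbn [chart fst] in E; rewrite E; unfold qabs; cbn.
  transitivity (sqrt 0); [apply f_equal; ring | apply sqrt_0].
rewrite qabs_scal in E'; [lra | assumption..].
Qed.

Lemma chart_radius t h1 h2 : 0 < t -> SU2 h1 -> radius (chart t h1 h2) = t.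
Proof. exact (qabs_scal t h1). Qed.

Lemma chart_a1 t h1 h2 : 0 < t -> SU2 h1 -> a1 (chart t h1 h2) = h1.
Proof.
intros Ht H1; unfold a1, qdir; cbn [chart fst].
rewrite qabs_scal by assumption; rewrite scal_assoc.
replace (mult (/ t) t) with (@one R_AbsRing); [apply scal_one|].
change (1 = / t * t); field; lra.
Qed.

Lemma chart_a2 t h1 h2 : 0 < t -> SU2 h1 -> a2 (chart t h1 h2) = h2.
Proof.
intros Ht H1; unfold a2; rewrite chart_a1 by assumption; cbn [chart snd].
rewrite qconj_mul, qconjK, <- qmulA, qconj_mul_self by assumption.
apply qmul1r.
Qed.

Lemma qdot_pos x : x <> (0, 0, 0, 0) -> 0 < qdot x x.
Proof.
destruct x as [[[a b] c] d]; intros Hx.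
change (0 < a * a + b * b + c * c + d * d).
destruct (Req_dec a 0) as [->|Ha]; [|nra].
destruct (Req_dec b 0) as [->|Hb]; [|nra].
destruct (Req_dec c 0) as [->|Hc]; [|nra].
destruct (Req_dec d 0) as [->|Hd]; [congruence|nra].
Qed.

Lemma radius_pos m : M0 m -> 0 < radius m.
Proof. intros [_ Hp]; apply sqrt_lt_R0, qdot_pos, Hp. Qed.

Lemma SU2_a1 m : M0 m -> SU2 (a1 m).
Proof.
intros Hm; assert (Hr := radius_pos m Hm).
assert (Hs : radius m * radius m = qdot (fst m) (fst m)).
  apply sqrt_sqrt, Rlt_le, qdot_pos, Hm.
unfold SU2, a1, qdir; fold (radius m).
transitivity (/ radius m * / radius m * qdot (fst m) (fst m)).
  destruct (fst m) as [[[? ?] ?] ?]; cbv -[Rplus Rmult Rinv radius]; ring.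
rewrite <- Hs; field; lra.
Qed.

Lemma chart_surj m :
  M0 m -> SU2 (a1 m) /\ SU2 (a2 m) /\ chart (radius m) (a1 m) (a2 m) = m.
Proof.
intros Hm; assert (H1 := SU2_a1 m Hm); assert (Hr := radius_pos m Hm).
destruct (Hm) as [Hq _]; split; [assumption|split].
  apply SU2_mul; [apply SU2_qconj|]; assumption.
unfold chart, a2; rewrite qconj_mul, qconjK, qmulA, mul_qconj, qmul1l by assumption.
destruct m as [p q]; cbn [snd]; f_equal; unfold a1, qdir; fold (radius (p, q)).
cbn [fst]; rewrite scal_assoc.
replace (mult (radius (p, q)) (/ radius (p, q))) with (@one R_AbsRing); [apply scal_one|].
change (1 = radius (p, q) * / radius (p, q)); field; lra.
Qed.

(** * Differential calculus on M *)

(* a curve in M (if [M m]) through [m] with velocity [v] (if [TM m v]) *)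
Definition curve (m v : HH) (s : R) : HH :=
  (plus (fst m) (scal s (fst v)), qdir (plus (snd m) (scal s (snd v)))).

(* derivatives at [m] along [v] of real and quaternion valued functions on M *)
Definition dR (f : HH -> R) (m v : HH) : R := Derive (fun s => f (curve m v s)) 0.

Definition dQ (f : HH -> quat) (m v : HH) : quat :=
  (dR (fun m' => qdot (f m') qone) m v,
   dR (fun m' => qcomp I1 (f m')) m v,
   dR (fun m' => qcomp I2 (f m')) m v,
   dR (fun m' => qcomp I3 (f m')) m v).

(* A k-form on M with values in [W] sends a point of M and a list of k tangent
   vectors to [W]; its values on other arguments are irrelevant. *)
Definition form (W : Type) := HH -> list HH -> W.

Definition form1 {W : AbelianMonoid} (alpha : HH -> HH -> W) : form W :=
  fun m l => match l with [v] => alpha m v | _ => zero end.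

Definition form2 {W : AbelianMonoid} (beta : HH -> HH -> HH -> W) : form W :=
  fun m l => match l with [v; w] => beta m v w | _ => zero end.

(* all splittings of a list into a sublist of length [k] and its complement,
   with the sign of the corresponding shuffle *)
Fixpoint shuffles {X : Type} (k : nat) (l : list X) : list (R * list X * list X) :=
  match k, l with
  | O, _ => [(1, [], l)]
  | S _, [] => []
  | S j, v :: l' =>
      map (fun '(s, a, b) => (s, v :: a, b)) (shuffles j l') ++
      map (fun '(s, a, b) => ((- 1) ^ k * s, a, v :: b)) (shuffles k l')
  end.

(* the wedge product of a [W]-valued k-form with a real form *)
Definition wedge {W : NormedModule R_AbsRing} (k : nat) (alpha : form W) (beta : form R)
  : form W :=
  fun m l =>
    fold_right (fun '(s, a, b) r => plus (scal (s * beta m b) (alpha m a)) r) zero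
      (shuffles k l).

(* On H x SU(2), [rfield m w] is the vector field extending [w] in TM m which is
   constant on the first factor and right-invariant on the second one, and
   [rbracket m v w] is the Lie bracket of [rfield m v] and [rfield m w] at [m]. *)
Definition rfield (m w m' : HH) : HH := (fst w, snd w ** qconj (snd m) ** snd m').

Definition rbracket (m v w : HH) : HH :=
  (zero,
   opp (bracket (snd v ** qconj (snd m)) (snd w ** qconj (snd m)) ** snd m)).

(* d alpha (X, Y) = X (alpha Y) - Y (alpha X) - alpha [X, Y] *)
Definition dform1 (alpha : HH -> HH -> quat) (m v w : HH) : quat :=
  minus
    (minus (dQ (fun m' => alpha m' (rfield m w m')) m v)
           (dQ (fun m' => alpha m' (rfield m v m')) m w))
    (alpha m (rbracket m v w)).

(* F = d alpha + 1/2 [alpha /\ alpha] *)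
Definition curvature (alpha : HH -> HH -> quat) (m v w : HH) : quat :=
  plus (dform1 alpha m v w) (bracket (alpha m v) (alpha m w)).

(** * The G2-structure *)

(* [mc1], [mc2] are the components on M0 of the left-invariant Maurer-Cartan
   form of SU(2)^2.  As (x1, x2) = sum_i e_i (T_i, T_i) + f_i (T_i, - T_i) with
   e_i, f_i half the sum, resp. difference, of the T_i-coordinates of x1 and x2,
   the forms dual to T_i^+ and T_i^- are [etap i] and [etam i]. *)
Definition mc1 (m v : HH) : quat := qconj (a1 m) ** dQ a1 m v.
Definition mc2 (m v : HH) : quat := qconj (a2 m) ** dQ a2 m v.

Definition etap (i : idx) (m v : HH) : R := (qcomp i (mc1 m v) + qcomp i (mc2 m v)) / 2.
Definition etam (i : idx) (m v : HH) : R := (qcomp i (mc1 m v) - qcomp i (mc2 m v)) / 2.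
Definition dt (m v : HH) : R := dR radius m v.

Definition etap_ (i : idx) : form R := form1 (etap i).
Definition etam_ (i : idx) : form R := form1 (etam i).

Section G2Structure.
Variables A B : idx -> R -> R.

Definition omega : form R := fun m l =>
  4 * sum3 (fun i => A i (radius m) * B i (radius m) * wedge 1 (etam_ i) (etap_ i) m l).

Definition Omega2 : form R := fun m l =>
  - 8 * A I1 (radius m) * A I2 (radius m) * A I3 (radius m)
      * wedge 1 (etap_ I1) (wedge 1 (etap_ I2) (etap_ I3)) m l
  + 8 * sum3 (fun i => let j := nxt i in let k := nxt j in
      B i (radius m) * B j (radius m) * A k (radius m)
      * wedge 1 (etam_ i) (wedge 1 (etam_ j) (etap_ k)) m l).

(* on M0, the Hodge dual of phi = dt /\ omega + Omega_1 for the metric of phi; the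
   instanton equation involves the G2-structure only through psi *)
Definition psi : form R := fun m l =>
  / 2 * wedge 2 omega omega m l - wedge 1 (form1 dt) Omega2 m l.

(* [Psi] is a smooth 4-form on M which restricts to [psi] on M0 *)
Definition extends_psi (Psi : form R) : Prop :=
  smooth_on
    (fun z : HH * (HH * HH * HH * HH) =>
       let '(m, (v1, v2, v3, v4)) := z in
       M m /\ TM m v1 /\ TM m v2 /\ TM m v3 /\ TM m v4)
    (fun z : HH * (HH * HH * HH * HH) =>
       let '(m, (v1, v2, v3, v4)) := z in Psi m [v1; v2; v3; v4]) /\
  forall m v1 v2 v3 v4,
    M0 m -> TM m v1 -> TM m v2 -> TM m v3 -> TM m v4 ->
    Psi m [v1; v2; v3; v4] = psi m [v1; v2; v3; v4].

End G2Structure.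

(** * The bundles P_lambda *)

(* The homomorphisms lambda from the diagonal SU(2) to SU(2). *)
Definition lambda_1 (a : quat) : quat := qone.
Definition lambda_id (a : quat) : quat := a.

(* SU(2)^2 x_(Delta SU(2), lambda) SU(2) is the quotient of SU(2)^2 x SU(2) by
   ((h1, h2), g) ~ ((h1 k, h2 k), lambda(k)^-1 g).  It is identified with
   S^3 x SU(2) by means of [assoc], with inverse (q, u) |-> [(q, 1), lambda(q)^-1 u];
   the next lemmas check that the fibres of [assoc] are the equivalence classes. *)
Definition assoc (lambda : quat -> quat) (h1 h2 g : quat) : HH :=
  (h1 ** qconj h2, lambda h1 ** g).

Definition is_hom (lambda : quat -> quat) : Prop :=
  (forall a, SU2 a -> SU2 (lambda a)) /\
  lambda qone = qone /\
  forall a b, SU2 a -> SU2 b -> lambda (a ** b) = lambda a ** lambda b.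

Lemma lambda_1_hom : is_hom lambda_1.
Proof.
repeat split; unfold lambda_1; intros; [unfold SU2, qone; cbn; ring|].
symmetry; apply qmul1l.
Qed.

Lemma lambda_id_hom : is_hom lambda_id.
Proof. repeat split; intros; assumption. Qed.

Lemma assoc_section lambda q u :
  is_hom lambda -> SU2 q -> assoc lambda q qone (qconj (lambda q) ** u) = (q, u).
Proof.
intros [Hs _] Hq; unfold assoc; rewrite qmulA, mul_qconj, qmul1l by auto.
f_equal; rewrite <- (qmul1r q) at 2; f_equal.
unfold qone; cbn; qsplit; ring.
Qed.

Lemma assoc_fibre lambda h1 h2 g h1' h2' g' :
  is_hom lambda ->
  SU2 h1 -> SU2 h2 -> SU2 g -> SU2 h1' -> SU2 h2' -> SU2 g' ->
  (assoc lambda h1 h2 g = assoc lambda h1' h2' g' <->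
   exists k, SU2 k /\ h1' = h1 ** k /\ h2' = h2 ** k /\ g' = qconj (lambda k) ** g).
Proof.
intros (Hs & H1 & Hm) ? ? ? ? ? ?; unfold assoc; split.
- intros E; injection E as E1 E2.
  exists (qconj h1 ** h1').
  assert (SU2 (qconj h1 ** h1')) by (apply SU2_mul; [apply SU2_qconj|]; assumption).
  assert (Eh : h1' = h1 ** (qconj h1 ** h1')) by
    (rewrite qmulA, mul_qconj, qmul1l by assumption; reflexivity).
  repeat split; [assumption..| |].
  + transitivity (h2 ** qconj h2 ** h2').
      rewrite mul_qconj, qmul1l by assumption; reflexivity.
    transitivity (h2 ** (qconj h1 ** (h1 ** qconj h2)) ** h2').
      rewrite (qmulA (qconj h1)), qconj_mul_self, qmul1l by assumption; reflexivity.
    rewrite E1, <- !qmulA, qconj_mul_self, qmul1r by assumption; reflexivity.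
  + transitivity (qconj (lambda h1') ** (lambda h1' ** g')).
      rewrite qmulA, qconj_mul_self, qmul1l by auto; reflexivity.
    rewrite <- E2, Eh at 1; rewrite Hm, qconj_mul, <- !qmulA by assumption.
    rewrite (qmulA (qconj (lambda h1))), (qconj_mul_self (lambda h1)), qmul1l by auto.
    reflexivity.
- intros (k & Hk & -> & -> & ->); f_equal.
  + rewrite qconj_mul, <- !qmulA, (qmulA k), mul_qconj, qmul1l by assumption; reflexivity.
  + rewrite Hm, <- !qmulA, (qmulA (lambda k)), mul_qconj, qmul1l by auto; reflexivity.
Qed.

(* With this identification the total space of the pull-back of P_lambda to M is
   M x SU(2), with the right SU(2)-action on the second factor; the left action
   h'.[h, g] = [h' h, g] of SU(2)^2 becomes [actP]. *)
Notation PP := (HH * quat)%type.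

Definition P (z : PP) : Prop := M (fst z) /\ SU2 (snd z).

Definition TP (z w : PP) : Prop := TM (fst z) (fst w) /\ qdot (snd z) (snd w) = 0.

Definition actP (lambda : quat -> quat) (h1 h2 : quat) (z : PP) : PP :=
  (actM (h1, h2, qone) (fst z), lambda h1 ** snd z).

Lemma actP_assoc lambda h1' h2' h1 h2 g p :
  is_hom lambda -> SU2 h1' -> SU2 h1 ->
  let x := assoc lambda h1 h2 g in
  let x' := assoc lambda (h1' ** h1) (h2' ** h2) g in
  actP lambda h1' h2' ((p, fst x), snd x) = ((h1' ** p, fst x'), snd x').
Proof.
intros (_ & _ & Hm) ? ?; cbn -[qmul]; unfold actP; cbn -[qmul qone].
rewrite Hm, qconj_mul, !qmulA by assumption.
replace (qconj qone) with qone by (unfold qone; cbn; qsplit; ring).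
rewrite qmul1r; reflexivity.
Qed.

(** * Connections *)

(* [theta z w] is the value at the tangent vector [w] in TP z of an su(2)-valued
   1-form on the total space. *)
Definition smooth_connection (theta : PP -> PP -> quat) : Prop :=
  smooth_on (fun zw : PP * PP => P (fst zw) /\ TP (fst zw) (snd zw))
    (fun zw : PP * PP => theta (fst zw) (snd zw)) /\
  (forall z w, P z -> TP z w -> su2 (theta z w)) /\
  (forall z w w' c, P z -> TP z w -> TP z w' ->
     theta z (plus (scal c w) w') = plus (scal c (theta z w)) (theta z w')) /\
  (forall m u xi, P (m, u) -> su2 xi -> theta (m, u) (zero, u ** xi) = xi) /\
  (forall m u v w g, P (m, u) -> TP (m, u) (v, w) -> SU2 g ->
     theta (m, u ** g) (v, w ** g) = qconj g ** theta (m, u) (v, w) ** g).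

(* [theta] is invariant under a lift [L] to P_lambda (by bundle automorphisms) of
   the SU(2)^3-action on M, extending the given SU(2)^2-action on P_lambda. *)
Definition SU2cube_lift (lambda : quat -> quat) (L : SU2cube_carrier -> PP -> PP) : Prop :=
  smooth_on (fun gz : SU2cube_carrier * PP => SU2cube (fst gz) /\ P (snd gz))
    (fun gz : SU2cube_carrier * PP => L (fst gz) (snd gz)) /\
  (forall g z, SU2cube g -> P z -> P (L g z) /\ fst (L g z) = actM g (fst z)) /\
  (forall g m u a, SU2cube g -> P (m, u) -> SU2 a ->
     L g (m, u ** a) = (fst (L g (m, u)), snd (L g (m, u)) ** a)) /\
  (forall z, P z -> L one3 z = z) /\
  (forall g g' z, SU2cube g -> SU2cube g' -> P z -> L (mul3 g g') z = L g (L g' z)) /\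
  (forall h1 h2 z, SU2 h1 -> SU2 h2 -> P z ->
     L (h1, h2, qone) z = actP lambda h1 h2 z).

(* invariance of [theta] under pull-back, tested on the velocities of curves *)
Definition SU2cube_invariant (lambda : quat -> quat) (theta : PP -> PP -> quat) : Prop :=
  exists L, SU2cube_lift lambda L /\
  forall g (gamma : R -> PP) w w',
    SU2cube g -> (forall s, P (gamma s)) ->
    is_derive gamma 0 w -> is_derive (fun s => L g (gamma s)) 0 w' ->
    theta (L g (gamma 0)) w' = theta (gamma 0) w.

(* Over M0 the equivariant trivialisation (h, g) |-> [h, g] is the section [h, 1],
   i.e. m |-> (m, lambda (a1 m)); [restricts_to] says that the su(2)-valued 1-form
   [A] on M0 is the pull-back of the connection [theta] by this section. *)
Definition restricts_to (lambda : quat -> quat) (theta : PP -> PP -> quat)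
  (A : HH -> HH -> quat) : Prop :=
  forall m v, M0 m -> TM m v ->
    theta (m, lambda (a1 m)) (v, dQ (fun m' => lambda (a1 m')) m v) = A m v.

(* the local connection form in the global section m |-> (m, 1); the vanishing of
   F /\ psi does not depend on the choice of the section *)
Definition potential (theta : PP -> PP -> quat) (m v : HH) : quat :=
  theta (m, qone) (v, zero).

Definition wedge_vanishes (D : HH -> Prop) (F : form quat) (Psi : form R) : Prop :=
  forall m v1 v2 v3 v4 v5 v6, D m ->
    TM m v1 -> TM m v2 -> TM m v3 -> TM m v4 -> TM m v5 -> TM m v6 ->
    wedge 2 F Psi m [v1; v2; v3; v4; v5; v6] = zero.

(* F /\ psi = 0 on all of M.  The formula for psi makes sense on M0 only; on the
   singular orbit psi is given by its (unique) smooth extension to M. *)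
Definition G2_instanton (A B : idx -> R -> R) (theta : PP -> PP -> quat) : Prop :=
  let F := form2 (curvature (potential theta)) in
  wedge_vanishes M0 F (psi A B) /\
  forall Psi, extends_psi A B Psi -> wedge_vanishes M F Psi.

(** * The two families on M0 *)

(* a T_i (x) eta_i^+ + b T_i (x) eta_i^-, summed over i *)
Definition invariant_form (a b : R -> R) (m v : HH) : quat :=
  plus (scal (a (radius m)) (sum3 (fun i => scal (etap i m v) (T i))))
       (scal (b (radius m)) (sum3 (fun i => scal (etam i m v) (T i)))).

Section Families.
Variables A1 B1 : R -> R.

Definition F_ (t : R) : R := - Derive A1 t / A1 t + 1 / A1 t - A1 t / B1 t ^ 2.

Definition expF (t : R) : R := exp (RInt F_ (1 / 2) t).

(* [expF 0] is a junk value, but it does not affect the integral. *)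
Definition theta_x1 (x1 : R) : HH -> HH -> quat :=
  invariant_form
    (fun t => x1 * A1 t * expF t / (1 + x1 * RInt expF 0 t)) (fun _ => 0).

Definition theta_xy (x y : R -> R) : HH -> HH -> quat :=
  invariant_form (fun t => A1 t * x t) (fun t => B1 t * y t).

End Families.

(* Main.v *)
Require Import Defs.
From Stdlib Require Import Reals Lra Lia List FunctionalExtensionality IndefiniteDescription.
From Coquelicot Require Import Coquelicot.
Import ListNotations.
Open Scope R_scope.

(* Write the invariant form as u T_i eta_i^+ + v T_i eta_i^-.  The instanton equation becomes
     u' = u (1 - u) / A1 + (A1 / B1^2) (v^2 - u),    v' = 2 v (u - 1) / A1.
   For v = 0 it is a Riccati equation and has the explicit solutions of the first family.
   For the second one, u(0) = 1 and v(0) = b0 y0; the substitution v = v(0) f^2,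
   1 - u = - A1 f' / f reduces the system to a singular scalar equation of the form
     f'' + (3 / t + ...) f' = - (f - v(0)^2 f^5) / B1^2,    f(0) = 1,
   which is solved globally by Picard iteration, monotonicity showing 0 < f <= 1 when
   |v(0)| <= 1.  All profiles are even smooth functions of t, and if f is even and smooth
   then f(|p|) is a smooth function of the quaternion p, because its derivative along v is
   (f'(t) / t)(|p|) <p, v>, where f'(t) / t is again even and smooth.  Hence the potentials,
   which are polynomial in p, q and their differentials up to such factors, extend over the
   singular orbit, where the instanton equation holds by continuity. *)

(** * Calculus of C^n maps *)

(** The trivialisation over the complement degenerates at p = 0, so the connections are built from
    potentials in a section defined on all of [M]. For [lambda_id] the two sections differ by the
    gauge transformation [a1], whose inhomogeneous term, the sum of the T_i (eta_i^+ + eta_i^-),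
    accounts for u(0) = 1. The substitution linearises the Riccati part by a logarithmic derivative:
    v'/v = 2 f'/f becomes an identity, and the term quadratic in 1 - u cancels. The price is a
    division by f, so f must stay positive for all time, and a quintic term, which is not globally
    Lipschitz and is truncated before the iteration. The coefficient 3/t disappears after one
    integration against t^3. Averages of s^k f(ts) over [0, 1] replace t^(-k-1) times integrals from
    0 to t; they preserve smoothness and parity, so a regular Volterra equation on the whole line
    remains. The range |y0| <= 1/b0 enters through f - v(0)^2 f^5 >= 0 on [0, 1], which makes f
    nonincreasing for t >= 0. *)

Ltac real_eq := match goal with |- @eq _ ?x ?y => change (@eq R x y) end.

(** The whole ambient space serves as domain because the connections, lifts and curvature formulas
    below make sense, and are smooth, off the submanifolds as well. *)
Definition Cn {V W : NormedModule R_AbsRing} (n : nat) (f : V -> W) : Prop :=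
  Ck n (fun _ => True) f.

Lemma Cn_ext {V W : NormedModule R_AbsRing} n (f g : V -> W) :
  (forall x, f x = g x) -> Cn n f -> Cn n g.
Proof.
intros E; replace g with f by (apply functional_extensionality; exact E); auto.
Qed.

Lemma Cn_continuous {V W : NormedModule R_AbsRing} n (f : V -> W) x :
  Cn n f -> continuous f x.
Proof. destruct n; intros [H _]; exact (H x I). Qed.

Lemma Cn_le {V W : NormedModule R_AbsRing} m n (f : V -> W) :
  (m <= n)%nat -> Cn n f -> Cn m f.
Proof.
revert n f; induction m as [|m IH]; intros n f L Hf.
- split; [|exact I]; intros x _; exact (Cn_continuous n f x Hf).
- destruct n as [|n]; [lia|].
  destruct Hf as [Hc Hd]; split; [exact Hc|]; intros v.
  destruct (Hd v) as [g [Hg Dg]]; exists g; split; [|exact Dg].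
  apply (IH n); [lia|exact Hg].
Qed.

Lemma Cn_const {V W : NormedModule R_AbsRing} n (c : W) : Cn n (fun _ : V => c).
Proof.
revert c; induction n as [|n IH]; intros c.
- split; [|exact I]; intros; apply continuous_const.
- split; [intros; apply continuous_const|]; intros v; exists (fun _ => zero).
  split; [apply IH|]; intros; apply (is_derive_const (K := R_AbsRing)).
Qed.

Lemma continuous_linear {V W : NormedModule R_AbsRing} (l : V -> W) x :
  is_linear l -> continuous l x.
Proof. intros H; apply linear_cont; exact H. Qed.

Lemma is_derive_linear_comp {V W : NormedModule R_AbsRing} (l : V -> W) (f : R -> V) x df :
  is_linear l -> is_derive f x df -> is_derive (fun s => l (f s)) x (l df).
Proof.
intros Hl Hf; unfold is_derive.
apply (filterdiff_ext_lin _ (fun y : R => l (scal y df))).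
  apply (filterdiff_comp f l _ l Hf); apply filterdiff_linear, Hl.
intros y; apply (linear_scal l Hl).
Qed.

Lemma Cn_linear_comp {V W X : NormedModule R_AbsRing} n (l : W -> X) (f : V -> W) :
  is_linear l -> Cn n f -> Cn n (fun x => l (f x)).
Proof.
intros Hl; revert f; induction n as [|n IH]; intros f Hf.
- split; [|exact I]; intros x _; apply continuous_comp;
    [apply (Cn_continuous 0), Hf | apply continuous_linear, Hl].
- split.
    intros x _; apply continuous_comp;
    [apply (Cn_continuous (S n)), Hf | apply continuous_linear, Hl].
  intros v; destruct Hf as [_ Hf]; destruct (Hf v) as [g [Hg Dg]].
  exists (fun x => l (g x)); split; [apply IH, Hg|].
  intros x _; exact (is_derive_linear_comp l _ _ _ Hl (Dg x I)).
Qed.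

Lemma Cn_linear {V W : NormedModule R_AbsRing} n (l : V -> W) :
  is_linear l -> Cn n l.
Proof.
intros Hl; destruct n as [|n].
  split; [|exact I]; intros x _; apply continuous_linear, Hl.
split; [intros x _; apply continuous_linear, Hl|].
intros v; exists (fun _ => l v); split; [apply Cn_const|]; intros x _.
apply (is_derive_linear_comp l); [exact Hl|].
assert (H : is_derive (fun s : R => plus x (scal s v)) 0 (plus zero (scal one v))).
  apply (is_derive_plus (K := R_AbsRing)); [apply (is_derive_const (K := R_AbsRing))|].
  apply (is_derive_scal_l (K := R_AbsRing)), (is_derive_id (K := R_AbsRing)).
rewrite plus_zero_l, scal_one in H; exact H.
Qed.

Lemma Cn_plus {V W : NormedModule R_AbsRing} n (f g : V -> W) :
  Cn n f -> Cn n g -> Cn n (fun x => plus (f x) (g x)).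
Proof.
revert f g; induction n as [|n IH]; intros f g Hf Hg.
- split; [|exact I]; intros x _;
  apply (continuous_plus (K := R_AbsRing)); apply (Cn_continuous 0); assumption.
- split.
    intros x _; apply (continuous_plus (K := R_AbsRing));
    apply (Cn_continuous (S n)); assumption.
  intros v; destruct Hf as [_ Hf]; destruct (Hf v) as [f' [Hf' Df]].
  destruct Hg as [_ Hg]; destruct (Hg v) as [g' [Hg' Dg]].
  exists (fun x => plus (f' x) (g' x)); split; [apply IH; assumption|].
  intros x _; apply (is_derive_plus (K := R_AbsRing)); [apply Df | apply Dg]; exact I.
Qed.

Lemma is_linear_inl {V W : NormedModule R_AbsRing} :
  is_linear (fun x : V => (x, zero) : V * W).
Proof. apply is_linear_prod; [apply is_linear_id | apply is_linear_zero]. Qed.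

Lemma is_linear_inr {V W : NormedModule R_AbsRing} :
  is_linear (fun x : W => (zero, x) : V * W).
Proof. apply is_linear_prod; [apply is_linear_zero | apply is_linear_id]. Qed.

Lemma pair_decomp {V W : NormedModule R_AbsRing} (x : V) (y : W) :
  (x, y) = plus ((x, zero) : V * W) (zero, y).
Proof.
apply injective_projections; cbn; symmetry; [apply plus_zero_r | apply plus_zero_l].
Qed.

Lemma Cn_pair {X V W : NormedModule R_AbsRing} n (f : X -> V) (g : X -> W) :
  Cn n f -> Cn n g -> Cn n (fun x => (f x, g x)).
Proof.
intros Hf Hg; apply (Cn_ext n _ _ (fun x => eq_sym (pair_decomp (f x) (g x)))).
apply (Cn_plus (W := prod_NormedModule R_AbsRing V W) n
  (fun x => (f x, zero)) (fun x => (zero, g x))).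
- exact (Cn_linear_comp n _ f is_linear_inl Hf).
- exact (Cn_linear_comp n _ g is_linear_inr Hg).
Qed.

Lemma is_derive_pair {V W : NormedModule R_AbsRing} (f : R -> V) (g : R -> W) x df dg :
  is_derive f x df -> is_derive g x dg ->
  is_derive (fun s => (f s, g s) : V * W) x (df, dg).
Proof.
intros Hf Hg; rewrite (pair_decomp df dg).
apply (is_derive_ext (fun s => plus ((f s, zero) : V * W) (zero, g s))).
  intros; symmetry; apply pair_decomp.
apply (is_derive_plus (V := prod_NormedModule R_AbsRing V W)
  (fun s => (f s, zero)) (fun s => (zero, g s))).
- exact (is_derive_linear_comp _ f _ _ is_linear_inl Hf).
- exact (is_derive_linear_comp _ g _ _ is_linear_inr Hg).
Qed.

Lemma is_derive_Rmult (f g : R -> R) x df dg :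
  is_derive f x df -> is_derive g x dg ->
  is_derive (fun s => f s * g s) x (df * g x + f x * dg).
Proof.
intros Hf Hg; apply (is_derive_mult (K := R_AbsRing) f g); auto.
intros; apply Rmult_comm.
Qed.

Lemma line_0 {V : NormedModule R_AbsRing} (x v : V) : plus x (scal 0 v) = x.
Proof. rewrite <- (plus_zero_r x) at 2; f_equal; apply (scal_zero_l v). Qed.

Lemma Cn_mult {V : NormedModule R_AbsRing} n (f g : V -> R) :
  Cn n f -> Cn n g -> Cn n (fun x => f x * g x).
Proof.
revert f g; induction n as [|n IH]; intros f g Hf Hg.
- split; [|exact I]; intros x _;
  apply (continuous_mult (K := R_AbsRing) f g);
    [exact (Cn_continuous 0 f x Hf) | exact (Cn_continuous 0 g x Hg)].
- split.
    intros x _; apply (continuous_mult (K := R_AbsRing) f g);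
      [exact (Cn_continuous _ f x Hf) | exact (Cn_continuous _ g x Hg)].
  assert (Hf0 := Cn_le n (S n) f ltac:(lia) Hf).
  assert (Hg0 := Cn_le n (S n) g ltac:(lia) Hg).
  intros v; destruct Hf as [_ Hf]; destruct (Hf v) as [f' [Hf' Df]].
  destruct Hg as [_ Hg]; destruct (Hg v) as [g' [Hg' Dg]].
  exists (fun x => f' x * g x + f x * g' x); split.
    apply (Cn_plus (W := R_NormedModule)); apply IH; assumption.
  intros x _.
  replace (f' x * g x + f x * g' x) with
    (f' x * g (plus x (scal 0 v)) + f (plus x (scal 0 v)) * g' x).
    apply is_derive_Rmult; [apply Df | apply Dg]; exact I.
  rewrite line_0; reflexivity.
Qed.

Lemma Cn_opp {V : NormedModule R_AbsRing} n (f : V -> R) :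
  Cn n f -> Cn n (fun x => - f x).
Proof. exact (Cn_linear_comp n _ f (is_linear_opp (V := R_NormedModule))). Qed.

Lemma Cn_minus {V : NormedModule R_AbsRing} n (f g : V -> R) :
  Cn n f -> Cn n g -> Cn n (fun x => f x - g x).
Proof.
intros Hf Hg; apply (Cn_plus (W := R_NormedModule)); [|apply Cn_opp]; assumption.
Qed.

Lemma Cn_exp {V : NormedModule R_AbsRing} n (f : V -> R) :
  Cn n f -> Cn n (fun x => exp (f x)).
Proof.
revert f; induction n as [|n IH]; intros f Hf.
- split; [|exact I]; intros x _; apply (continuous_comp f exp);
    [exact (Cn_continuous 0 f x Hf) | apply continuous_exp].
- split.
    intros x _; apply (continuous_comp f exp);
      [exact (Cn_continuous _ f x Hf) | apply continuous_exp].
  assert (Hf0 := Cn_le n (S n) f ltac:(lia) Hf).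
  intros v; destruct Hf as [_ Hf]; destruct (Hf v) as [f' [Hf' Df]].
  exists (fun x => f' x * exp (f x)); split; [apply Cn_mult; [|apply IH]; assumption|].
  intros x _.
  replace (exp (f x)) with (exp (f (plus x (scal 0 v)))) by
    (rewrite line_0; reflexivity).
  apply (is_derive_comp exp); [|apply Df, I].
  apply is_derive_Reals, derivable_pt_lim_exp.
Qed.

Lemma Cn_inv {V : NormedModule R_AbsRing} n (f : V -> R) :
  (forall x, f x <> 0) -> Cn n f -> Cn n (fun x => / f x).
Proof.
intros Hnz; revert f Hnz; induction n as [|n IH]; intros f Hnz Hf.
- split; [|exact I]; intros x _; apply (continuous_comp f Rinv);
    [exact (Cn_continuous 0 f x Hf) | apply continuous_Rinv, Hnz].
- split.
    intros x _; apply (continuous_comp f Rinv);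
      [exact (Cn_continuous _ f x Hf) | apply continuous_Rinv, Hnz].
  assert (Hf0 := Cn_le n (S n) f ltac:(lia) Hf).
  intros v; destruct Hf as [_ Hf]; destruct (Hf v) as [f' [Hf' Df]].
  exists (fun x => - (f' x * (/ f x * / f x))); split.
    apply Cn_opp; apply Cn_mult; [assumption|apply Cn_mult; apply IH; assumption].
  intros x _.
  assert (E : f (plus x (scal 0 v)) = f x) by
    (rewrite line_0; reflexivity).
  replace (- (f' x * (/ f x * / f x))) with
    (- f' x / f (plus x (scal 0 v)) ^ 2) by (rewrite E; field; apply Hnz).
  apply is_derive_inv; [apply Df, I | rewrite E; apply Hnz].
Qed.

Lemma Cn_id {V : NormedModule R_AbsRing} n : Cn n (fun x : V => x).
Proof. apply (Cn_linear n (fun x : V => x)), is_linear_id. Qed.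

Lemma Cn_pow {V : NormedModule R_AbsRing} n k (f : V -> R) :
  Cn n f -> Cn n (fun x => f x ^ k).
Proof.
intros Hf; induction k as [|k IH]; cbn; [apply Cn_const | apply Cn_mult; assumption].
Qed.

Lemma is_derive_affine (a b s : R) : is_derive (fun s => a + s * b) s b.
Proof. auto_derive; [exact I | ring]. Qed.

Lemma Cn_R_intro n (f f' : R -> R) :
  (forall x, is_derive f x (f' x)) -> Cn n f' -> Cn (S n) f.
Proof.
intros D Hf'; split.
  intros x _; apply (ex_derive_continuous (K := R_AbsRing)); exists (f' x); apply D.
intros v; exists (fun x => v * f' x); split.
  apply Cn_mult; [apply Cn_const | exact Hf'].
intros x _; apply (is_derive_comp f (fun s : R => (x : R) + s * (v : R))).
  assert (E : forall a b : R, a + 0 * b = a) by (intros; ring).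
  rewrite (E x v); apply D.
apply is_derive_affine.
Qed.

(** On the line the direction 1 carries all the information of [Ck], so smoothness can be handled
    with [Derive] alone. *)
Lemma Cn_R_elim n (f : R -> R) :
  Cn (S n) f -> (forall x, is_derive f x (Derive f x)) /\ Cn n (Derive f).
Proof.
intros [_ H]; destruct (H 1) as [g [Hg Dg]].
assert (D : forall x, is_derive f x (g x)).
  intros x.
  assert (Dx := Dg x I).
  apply (is_derive_ext (fun y => f (plus x (scal (y - x) 1)))).
    intros y; f_equal; change (x + (y - x) * 1 = y); ring.
  replace (g x) with (scal 1 (g x)) by (apply (scal_one (g x))).
  apply (is_derive_comp (fun s => f (plus x (scal s 1))) (fun y : R => y - x)).
    rewrite (Rminus_diag_eq x x eq_refl); exact Dx.
  auto_derive; [exact I | ring].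
assert (E : forall x, Derive f x = g x) by (intros x; apply is_derive_unique, D).
split; [intros x; rewrite E; apply D|].
apply (Cn_ext n g); [intros; symmetry; apply E | exact Hg].
Qed.

(** * Weighted averages *)

Lemma ex_RInt_cont (f : R -> R) a b : (forall x, continuous f x) -> ex_RInt f a b.
Proof. intros H; apply (ex_RInt_continuous (V := R_CompleteNormedModule)); auto. Qed.

Lemma continuous_Rmult (f g : R -> R) x :
  continuous f x -> continuous g x -> continuous (fun s => f s * g s) x.
Proof. apply (continuous_mult (K := R_AbsRing)). Qed.

Lemma continuous_Rplus (f g : R -> R) x :
  continuous f x -> continuous g x -> continuous (fun s => f s + g s) x.
Proof. apply (continuous_plus (K := R_AbsRing) (V := R_NormedModule) f g). Qed.

Lemma continuous_Rminus (f g : R -> R) x :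
  continuous f x -> continuous g x -> continuous (fun s => f s - g s) x.
Proof. apply (continuous_minus (K := R_AbsRing) (V := R_NormedModule) f g). Qed.

Lemma continuous_of_derive (f : R -> R) x l : is_derive f x l -> continuous f x.
Proof. intros H; apply (ex_derive_continuous (K := R_AbsRing) (V := R_NormedModule) f); exists l; exact H. Qed.

Lemma continuous_pow k (x : R) : continuous (fun s : R => s ^ k) x.
Proof.
apply (continuous_of_derive _ _ (INR k * 1 * x ^ pred k)).
apply (is_derive_pow (fun s => s)), (is_derive_id (K := R_AbsRing)).
Qed.

Lemma continuous_scaled (f : R -> R) c x :
  (forall x, continuous f x) -> continuous (fun s => f (c * s)) x.
Proof.
intros H; apply (continuous_comp (fun s => c * s) f); [|apply H].
apply (continuous_of_derive _ _ c); auto_derive; [exact I | ring].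
Qed.

(** For t different from 0 this is t^(-k-1) times the integral of s^k f(s) from 0 to t. The
    rescaling to [0, 1] extends it to t = 0 without any case distinction. *)
Definition Jint (k : nat) (f : R -> R) (t : R) : R :=
  RInt (fun s => s ^ k * f (t * s)) 0 1.

Lemma Jint_integrand_continuous k f t x :
  (forall x, continuous f x) -> continuous (fun s => s ^ k * f (t * s)) x.
Proof.
intros H; apply continuous_Rmult; [apply continuous_pow | apply continuous_scaled, H].
Qed.

Lemma Jint_ex k f t :
  (forall x, continuous f x) -> ex_RInt (fun s => s ^ k * f (t * s)) 0 1.
Proof. intros H; apply ex_RInt_cont; intros; apply Jint_integrand_continuous, H. Qed.

Lemma pow_unit_interval k s : 0 <= s <= 1 -> 0 <= s ^ k <= 1.
Proof.
intros [H0 H1]; split; [apply pow_le, H0|].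
rewrite <- (pow1 k); apply pow_incr; lra.
Qed.

Lemma Jint_diff_bound k f g t u M :
  (forall x, continuous f x) -> (forall x, continuous g x) ->
  (forall s, 0 <= s <= 1 -> Rabs (f (t * s) - g (u * s)) <= M) ->
  Rabs (Jint k f t - Jint k g u) <= M.
Proof.
intros Hf Hg HM; unfold Jint.
assert (E := RInt_minus _ _ 0 1 (Jint_ex k f t Hf) (Jint_ex k g u Hg)).
change (RInt (fun s => s ^ k * f (t * s) - s ^ k * g (u * s)) 0 1 =
  RInt (fun s => s ^ k * f (t * s)) 0 1 - RInt (fun s => s ^ k * g (u * s)) 0 1) in E.
rewrite <- E; replace M with ((1 - 0) * M) by ring.
apply abs_RInt_le_const; [lra| |].
  apply ex_RInt_cont; intros; apply continuous_Rminus;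
    apply Jint_integrand_continuous; assumption.
intros s Hs; assert (Hp := pow_unit_interval k s Hs).
replace (_ - _) with (s ^ k * (f (t * s) - g (u * s))) by ring.
rewrite Rabs_mult, (Rabs_pos_eq (s ^ k)) by lra.
assert (H := HM s Hs); assert (H0 := Rabs_pos (f (t * s) - g (u * s))); nra.
Qed.

Lemma Jint_continuous k f t :
  (forall x, continuous f x) -> continuous (Jint k f) t.
Proof.
intros Hf; apply filterlim_locally; intros eps.
(* All points t s and u s with |u - t| < 1 and s in [0, 1] lie in this interval, where f is
   uniformly continuous. *)
destruct (unifcont_normed_1d (K := R_AbsRing) f (- (Rabs t + 1)) (Rabs t + 1)
  (fun x _ => Hf x) (mkposreal (eps / 2) (is_pos_div_2 eps))) as [d Hd].
assert (Hm : 0 < Rmin d 1) by (apply Rmin_pos; [apply d | lra]).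
exists (mkposreal _ Hm); intros u Hu.
change (Rabs (u - t) < Rmin d 1) in Hu.
change (Rabs (Jint k f u - Jint k f t) < eps).
assert (H1 := Rmin_l d 1); assert (H2 := Rmin_r d 1).
apply Rle_lt_trans with (eps / 2); [|assert (He := cond_pos eps); lra].
apply Jint_diff_bound; auto; intros s Hs; left.
assert (Hb : forall v, Rabs v <= Rabs t + 1 ->
  - (Rabs t + 1) <= v * s <= Rabs t + 1).
  intros v Hv; apply Rabs_le_between; rewrite Rabs_mult, (Rabs_pos_eq s) by lra.
  assert (H := Rabs_pos v); nra.
apply (Hd (t * s) (u * s)).
- apply Hb; lra.
- apply Hb; replace u with (t + (u - t)) by ring.
  eapply Rle_trans; [apply Rabs_triang|]; lra.
- change (Rabs (u * s - t * s) < d); rewrite <- Rmult_minus_distr_r, Rabs_mult.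
  rewrite (Rabs_pos_eq s) by lra; assert (H := Rabs_pos (u - t)); nra.
Qed.

(** Differentiation under the integral sign: the chain rule contributes a factor s, which raises the
    weight by one. Smoothness of [Jint] is therefore an induction over all weights at once. *)
Lemma Jint_derive k f t :
  Cn 1 f -> is_derive (Jint k f) t (Jint (S k) (Derive f) t).
Proof.
intros Hf; destruct (Cn_R_elim 0 f Hf) as [D Cf'].
assert (Cf : forall x, continuous f x) by (intros; exact (Cn_continuous _ _ _ Hf)).
assert (C' : forall x, continuous (Derive f) x) by (intros; exact (Cn_continuous _ _ _ Cf')).
assert (Di : forall s u, is_derive (fun u => s ^ k * f (u * s)) u (s ^ S k * Derive f (u * s))).
  intros s u; replace (s ^ S k * Derive f (u * s)) with (s ^ k * (s * Derive f (u * s)))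
    by (cbn; ring).
  apply is_derive_scal; apply (is_derive_comp f (fun u => u * s)); [apply D|].
  auto_derive; [exact I | ring].
replace (Jint (S k) (Derive f) t) with
  (RInt (fun s => Derive (fun u => s ^ k * f (u * s)) t) 0 1).
2: { apply RInt_ext; intros s _; apply is_derive_unique, Di. }
apply (is_derive_RInt_param (fun u s => s ^ k * f (u * s))).
- exists posreal_one; intros u _ s _; eexists; apply Di.
- intros s _; apply continuity_2d_pt_filterlim.
  apply (filterlim_ext (fun z : R * R => snd z ^ S k * Derive f (fst z * snd z))).
    intros z; symmetry; apply is_derive_unique, Di.
  replace (Derive (fun z => s ^ k * f (z * s)) t) with (s ^ S k * Derive f (t * s)) by
    (symmetry; apply is_derive_unique, Di).
  apply (continuous_mult (K := R_AbsRing) (fun z : R * R => snd z ^ S k)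
    (fun z : R * R => Derive f (fst z * snd z)) (t, s)).
    apply (continuous_comp (fun z : R * R => snd z) (fun s => s ^ S k));
      [apply continuous_snd | apply continuous_pow].
  apply (continuous_comp (fun z : R * R => fst z * snd z) (Derive f)); [|apply C'].
  apply (continuous_mult (K := R_AbsRing) (fun z : R * R => fst z) (fun z => snd z));
    [apply continuous_fst | apply continuous_snd].
- exists posreal_one; intros u _; apply Jint_ex, Cf.
Qed.

Lemma Cn_Jint n k f : Cn n f -> Cn n (Jint k f).
Proof.
revert k f; induction n as [|n IH]; intros k f Hf.
- split; [|exact I]; intros x _; apply Jint_continuous.
  intros; exact (Cn_continuous _ _ _ Hf).
- apply (Cn_R_intro n _ (Jint (S k) (Derive f))).
    intros x; apply Jint_derive, (Cn_le 1 (S n)); [lia | exact Hf].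
  apply IH, Cn_R_elim, Hf.
Qed.

Lemma Jint_prim k f t :
  (forall x, continuous f x) -> t ^ S k * Jint k f t = RInt (fun s => s ^ k * f s) 0 t.
Proof.
intros Hf; assert (Hc : forall x, continuous (fun s => s ^ k * f s) x).
  intros; apply continuous_Rmult; [apply continuous_pow | apply Hf].
assert (E := RInt_comp_lin (V := R_CompleteNormedModule) (fun s => s ^ k * f s) t 0 0 1).
replace (t * 0 + 0) with 0 in E by ring; replace (t * 1 + 0) with t in E by ring.
rewrite <- (E (ex_RInt_cont _ _ _ Hc)).
unfold Jint; assert (E2 := RInt_scal (V := R_CompleteNormedModule)
  (fun s => s ^ k * f (t * s)) 0 1 (t ^ S k) (Jint_ex k f t Hf)).
change (RInt (fun s => t ^ S k * (s ^ k * f (t * s))) 0 1 =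
  t ^ S k * RInt (fun s => s ^ k * f (t * s)) 0 1) in E2.
rewrite <- E2; apply RInt_ext; intros s _.
change (t ^ S k * (s ^ k * f (t * s)) = t * ((t * s + 0) ^ k * f (t * s + 0))).
rewrite Rplus_0_r, Rpow_mult_distr; cbn; ring.
Qed.

Lemma Jint_ftc k f t :
  (forall x, continuous f x) ->
  is_derive (fun t => t ^ S k * Jint k f t) t (t ^ k * f t).
Proof.
intros Hf; assert (Hc : forall x, continuous (fun s => s ^ k * f s) x).
  intros; apply continuous_Rmult; [apply continuous_pow | apply Hf].
apply (is_derive_ext (RInt (fun s => s ^ k * f s) 0)).
  intros u; symmetry; apply Jint_prim, Hf.
apply (is_derive_RInt (fun s => s ^ k * f s) _ 0); [|apply Hc].
exists posreal_one; intros u _.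
apply (RInt_correct (V := R_CompleteNormedModule)), ex_RInt_cont, Hc.
Qed.

Lemma Jint_even k f t : (forall x, f (- x) = f x) -> Jint k f (- t) = Jint k f t.
Proof.
intros H; apply RInt_ext; intros s _; rewrite <- H; do 2 f_equal; ring.
Qed.

Lemma Jint_pos k f t :
  (forall x, continuous f x) -> (forall s, 0 <= s <= 1 -> 0 <= f (t * s)) -> 0 <= Jint k f t.
Proof.
intros Hf Hp; apply RInt_ge_0; [lra | apply Jint_ex, Hf|].
intros s Hs; apply Rmult_le_pos; [apply pow_le; lra | apply Hp; lra].
Qed.

(** * Even smooth functions *)

(** Evenness is what makes [f (qabs p)] smooth at p = 0. Profiles live on the whole line, so that
    neither parity nor smoothness needs one-sided derivatives. *)
Definition esmooth (f : R -> R) : Prop :=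
  (forall n, Cn n f) /\ forall t, f (- t) = f t.

Lemma esmooth_continuous f x : esmooth f -> continuous f x.
Proof. intros [H _]; exact (Cn_continuous 0 f x (H 0%nat)). Qed.

Lemma esmooth_const c : esmooth (fun _ => c).
Proof. split; [intros; apply Cn_const | reflexivity]. Qed.

Lemma esmooth_plus f g : esmooth f -> esmooth g -> esmooth (fun t => f t + g t).
Proof.
intros [Hf Ef] [Hg Eg]; split; [|intros; rewrite Ef, Eg; reflexivity].
intros n; apply (Cn_plus (W := R_NormedModule) n f g); auto.
Qed.

Lemma esmooth_minus f g : esmooth f -> esmooth g -> esmooth (fun t => f t - g t).
Proof.
intros [Hf Ef] [Hg Eg]; split; [|intros; rewrite Ef, Eg; reflexivity].
intros n; apply Cn_minus; auto.
Qed.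

Lemma esmooth_opp f : esmooth f -> esmooth (fun t => - f t).
Proof.
intros [Hf Ef]; split; [|intros; rewrite Ef; reflexivity]; intros n; apply Cn_opp; auto.
Qed.

Lemma esmooth_mult f g : esmooth f -> esmooth g -> esmooth (fun t => f t * g t).
Proof.
intros [Hf Ef] [Hg Eg]; split; [|intros; rewrite Ef, Eg; reflexivity].
intros n; apply Cn_mult; auto.
Qed.

Lemma esmooth_inv f : (forall t, f t <> 0) -> esmooth f -> esmooth (fun t => / f t).
Proof.
intros H [Hf Ef]; split; [|intros; rewrite Ef; reflexivity].
intros n; apply Cn_inv; auto.
Qed.

Lemma esmooth_div f g :
  (forall t, g t <> 0) -> esmooth f -> esmooth g -> esmooth (fun t => f t / g t).
Proof. intros H Hf Hg; apply esmooth_mult; [|apply esmooth_inv]; assumption. Qed.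

Lemma esmooth_exp f : esmooth f -> esmooth (fun t => exp (f t)).
Proof.
intros [Hf Ef]; split; [|intros; rewrite Ef; reflexivity].
intros n; apply Cn_exp; auto.
Qed.

Lemma esmooth_pow k f : esmooth f -> esmooth (fun t => f t ^ k).
Proof.
intros H; induction k as [|k IH]; [exact (esmooth_const 1) | apply esmooth_mult; assumption].
Qed.

Lemma esmooth_sqr : esmooth (fun t => t ^ 2).
Proof.
split; [intros n; apply Cn_pow, (Cn_id (V := R_NormedModule))|intros; ring].
Qed.

Lemma esmooth_Jint k f : esmooth f -> esmooth (Jint k f).
Proof.
intros [Hf Ef]; split; [intros; apply Cn_Jint; auto | intros; apply Jint_even, Ef].
Qed.

(* [Dq f t] is [f' t / t], extended to [t = 0]; the integral form shows that it is
   smooth and even again. *)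
Definition Dq (f : R -> R) : R -> R := Jint 0 (Derive (Derive f)).

Lemma Derive_even f t : esmooth f -> Derive f (- t) = - Derive f t.
Proof.
intros [Hf Ef]; destruct (Cn_R_elim 0 f (Hf 1%nat)) as [D _].
assert (H : Derive f t = - Derive f (- t)); [|rewrite H; ring].
apply is_derive_unique, (is_derive_ext (fun s => f (- s)) _ _ _ (fun s => Ef s)).
replace (- Derive f (- t)) with (scal (- (1)) (Derive f (- t))) by
  (change (- (1) * Derive f (- t) = - Derive f (- t)); ring).
apply (is_derive_comp f Ropp); [apply D|]; auto_derive; [exact I | ring].
Qed.

Lemma is_derive_esmooth f t : esmooth f -> is_derive f t (t * Dq f t).
Proof.
intros H; assert (H' := H); destruct H as [Hf _].
destruct (Cn_R_elim 1 f (Hf 2%nat)) as [D C1]; destruct (Cn_R_elim 0 _ C1) as [D2 C0].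
assert (C : forall x, continuous (Derive (Derive f)) x) by
  (intros; exact (Cn_continuous _ _ _ C0)).
replace (t * Dq f t) with (Derive f t); [apply D|].
assert (E := Jint_prim 0 _ t C).
rewrite (RInt_ext _ (Derive (Derive f))), RInt_Derive in E.
- unfold Dq; rewrite pow_1 in E.
  assert (E0 := Derive_even f 0 H'); rewrite Ropp_0 in E0; lra.
- intros; eexists; apply D2.
- intros; apply C.
- intros; cbn; ring.
Qed.

Lemma esmooth_Dq f : esmooth f -> esmooth (Dq f).
Proof.
intros H; assert (H' := H); destruct H as [Hf _].
apply (esmooth_Jint 0 (Derive (Derive f))); split.
  intros n; destruct (Cn_R_elim (S n) f (Hf _)) as [_ C1].
  exact (proj2 (Cn_R_elim n _ C1)).
intros t; destruct (Cn_R_elim 1 f (Hf 2%nat)) as [_ C1].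
destruct (Cn_R_elim 0 _ C1) as [D _].
symmetry; apply is_derive_unique.
apply (is_derive_ext (fun s => - Derive f (- s))).
  intros; rewrite Derive_even, Ropp_involutive; auto.
replace (Derive (Derive f) (- t)) with (- (scal (- (1)) (Derive (Derive f) (- t)))) by
  (change (- (- (1) * Derive (Derive f) (- t)) = Derive (Derive f) (- t)); ring).
apply (is_derive_opp (K := R_AbsRing) (V := R_NormedModule) (fun s => Derive f (- s))).
apply (is_derive_comp (Derive f) Ropp); [apply D|]; auto_derive; [exact I | ring].
Qed.

(* the primitive of [t g t] vanishing at 0 *)
Definition prim1 (g : R -> R) (t : R) : R := t ^ 2 * Jint 1 g t.

Lemma prim1_derive g t :
  (forall x, continuous g x) -> is_derive (prim1 g) t (t * g t).
Proof.
intros H; assert (D := Jint_ftc 1 g t H); rewrite pow_1 in D; exact D.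
Qed.

Lemma prim1_0 g : prim1 g 0 = 0.
Proof. unfold prim1; ring. Qed.

Lemma esmooth_prim1 g : esmooth g -> esmooth (prim1 g).
Proof. intros H; apply esmooth_mult; [apply esmooth_sqr | apply esmooth_Jint, H]. Qed.

Lemma constant_of_derive_0 (f : R -> R) s t :
  (forall x, is_derive f x 0) -> f s = f t.
Proof.
intros H; destruct (MVT_gen f s t (fun _ => 0)) as [c [_ E]].
- intros; apply H.
- intros; apply continuity_pt_filterlim, (continuous_of_derive f x 0), H.
- lra.
Qed.

Lemma esmooth_prim1_Dq f t : esmooth f -> f t = f 0 + prim1 (Dq f) t.
Proof.
intros H; assert (E := constant_of_derive_0 (fun t => f t - prim1 (Dq f) t) t 0).
cbn beta in E; rewrite prim1_0 in E; enough (f t - prim1 (Dq f) t = f 0 - 0) by lra.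
apply E; intros x; replace 0 with (x * Dq f x - x * Dq f x) by ring.
apply (is_derive_minus (K := R_AbsRing) (V := R_NormedModule)).
  apply is_derive_esmooth, H.
apply prim1_derive; intros; apply esmooth_continuous, esmooth_Dq, H.
Qed.

(** * Even and odd extensions of functions on the half-line *)

Definition reflect (eps : R) (g : R -> R) (t : R) : R :=
  if Rle_dec 0 t then g t else eps * g (- t).

(** Differentiation exchanges even and odd reflections. The two conditions at 0 say that the halves
    agree there in value and in slope. *)
Lemma reflect_derive eps g g' t :
  (eps = 1 \/ eps = - 1) -> (forall x, is_derive g x (g' x)) ->
  g 0 = eps * g 0 -> g' 0 = - eps * g' 0 ->
  is_derive (reflect eps g) t (reflect (- eps) g' t).
Proof.
intros He Dg E0 E1.
assert (Dn : forall x, is_derive (fun s => eps * g (- s)) x (- eps * g' (- x))).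
  intros x; replace (- eps * g' (- x)) with (eps * (scal (- (1)) (g' (- x)))) by
    (change (eps * (- (1) * g' (- x)) = - eps * g' (- x)); ring).
  apply is_derive_scal.
  apply (is_derive_comp g Ropp); [apply Dg|]; auto_derive; [exact I | ring].
destruct (Rtotal_order t 0) as [Ht|[->|Ht]].
- apply (is_derive_ext_loc (fun s => eps * g (- s))).
    exists (mkposreal (- t) ltac:(lra)); intros s Hs; change (Rabs (s - t) < - t) in Hs.
    apply Rabs_lt_between in Hs; unfold reflect; destruct Rle_dec; [lra | reflexivity].
  unfold reflect; destruct Rle_dec; [lra | apply Dn].
- apply is_derive_Reals; intros e Hp.
  destruct (proj1 (is_derive_Reals _ _ _) (Dg 0) e Hp) as [d1 H1].
  destruct (proj1 (is_derive_Reals _ _ _) (Dn 0) e Hp) as [d2 H2].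
  exists (mkposreal _ (Rmin_pos d1 d2 (cond_pos d1) (cond_pos d2))); cbn; intros h Hh Hd.
  assert (Hl := Rmin_l d1 d2); assert (Hr := Rmin_r d1 d2).
  unfold reflect at 2 3; destruct (Rle_dec 0 0) as [_|]; [|lra].
  unfold reflect; destruct Rle_dec; [apply H1; lra|].
  specialize (H2 h Hh ltac:(lra)); rewrite Ropp_0, <- E0, <- E1 in H2; exact H2.
- apply (is_derive_ext_loc g).
    exists (mkposreal t Ht); intros s Hs; change (Rabs (s - t) < t) in Hs.
    apply Rabs_lt_between in Hs; unfold reflect; destruct Rle_dec; [reflexivity | lra].
  unfold reflect; destruct Rle_dec; [apply Dg | lra].
Qed.

(** The m-th derivative of the reflection is the reflection of [Derive_n g m] with sign
    [eps * (- 1) ^ m]. The hypothesis at 0 makes the Taylor coefficients of the wrong parity vanish,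
    so all derivatives match across 0. *)
Lemma reflect_Cn eps g n :
  (eps = 1 \/ eps = - 1) -> (forall n t, ex_derive_n g n t) ->
  (forall j, Derive_n g j 0 = eps * (- 1) ^ j * Derive_n g j 0) ->
  Cn n (reflect eps g).
Proof.
intros He Hg H0.
assert (Hm : forall m, eps * (- 1) ^ m = 1 \/ eps * (- 1) ^ m = - 1).
  intros m; induction m as [|m IH]; cbn; [lra|].
  destruct IH as [E|E]; [right|left];
    replace (eps * (-1 * (-1) ^ m)) with (- (eps * (-1) ^ m)) by ring; rewrite E; ring.
assert (D : forall m t, is_derive (reflect (eps * (- 1) ^ m) (Derive_n g m)) t
  (reflect (eps * (- 1) ^ S m) (Derive_n g (S m)) t)).
  intros m t; replace (eps * (- 1) ^ S m) with (- (eps * (- 1) ^ m)) by (cbn; ring).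
  apply reflect_derive; auto.
    intros x; apply Derive_correct, (Hg (S m)).
  rewrite (H0 (S m)) at 1; cbn; ring.
enough (H : forall m, Cn n (reflect (eps * (- 1) ^ m) (Derive_n g m))).
  specialize (H 0%nat); cbn in H; rewrite Rmult_1_r in H; exact H.
induction n as [|n IH]; intros m.
- split; [|exact I]; intros x _; exact (continuous_of_derive _ _ _ (D m x)).
- exact (Cn_R_intro n _ _ (D m) (IH (S m))).
Qed.

(** A smooth extension from the half-line need not be even itself; its values at negative arguments
    are discarded and replaced by the reflection. *)
Lemma even_extension B :
  smooth_halfline B -> even_at_0 B ->
  exists b, esmooth b /\ forall t, 0 <= t -> B t = b t.
Proof.
intros [g Hg] He; assert (Hg' := Hg); destruct Hg as [Sg Eg]; exists (reflect 1 g); split.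
- split.
  + intros n; apply reflect_Cn; auto; intros j.
    destruct (Nat.Even_or_Odd j) as [[k ->]|[k ->]].
      rewrite pow_1_even; ring.
    rewrite (He g k Hg'); ring.
  + intros t; unfold reflect; destruct (Rle_dec 0 t), (Rle_dec 0 (- t)); try lra.
    * replace t with 0 by lra; f_equal; ring.
    * rewrite Ropp_involutive; ring.
- intros t Ht; unfold reflect; destruct Rle_dec; [symmetry; auto | lra].
Qed.

(** If h is the odd extension, then h(t) = t times the average of h' over [0, t], and this average
    is even because h' is. Its value at 0 is the limit of A(t) / t, the one-sided derivative. *)
Lemma odd_extension A l :
  smooth_halfline A -> odd_at_0 A -> is_right_derive A 0 l ->
  exists a, esmooth a /\ a 0 = l /\ forall t, 0 <= t -> A t = t * a t.
Proof.
intros [g Hg] Ho Hl; assert (Hg' := Hg); destruct Hg as [Sg Eg].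
set (h := reflect (- 1) g).
assert (Ch : forall n, Cn n h).
  intros n; apply reflect_Cn; auto; intros j.
  destruct (Nat.Even_or_Odd j) as [[k ->]|[k ->]].
    rewrite (Ho g k Hg'); ring.
  rewrite pow_add, pow_1_even; ring.
assert (h0 : h 0 = 0).
  unfold h, reflect; destruct Rle_dec; [|lra].
  exact (Ho g 0%nat Hg').
assert (Oh : forall t, h (- t) = - h t).
  intros t; unfold h, reflect; destruct (Rle_dec 0 t), (Rle_dec 0 (- t)); try lra.
  - replace t with 0 by lra; rewrite Ropp_0.
    assert (E := Ho g 0%nat Hg'); cbn in E; rewrite E; ring.
  - rewrite Ropp_involutive; ring.
assert (Dh : forall x, is_derive h x (Derive h x)) by apply (Cn_R_elim 0 h (Ch 1%nat)).
assert (Ch' : forall n, Cn n (Derive h)) by (intros n; apply Cn_R_elim, Ch).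
assert (Cc : forall x, continuous (Derive h) x) by
  (intros x; exact (Cn_continuous 0 _ x (Ch' 0%nat))).
assert (Ha : esmooth (Jint 0 (Derive h))).
  apply esmooth_Jint; split; [exact Ch'|]; intros t; symmetry; apply is_derive_unique.
  apply (is_derive_ext (fun s => - h (- s))); [intros s; rewrite Oh; apply Ropp_involutive|].
  replace (Derive h (- t)) with (- (scal (- (1)) (Derive h (- t)))) by
    (change (- (- (1) * Derive h (- t)) = Derive h (- t)); ring).
  apply (is_derive_opp (K := R_AbsRing) (V := R_NormedModule) (fun s => h (- s))).
  apply (is_derive_comp h Ropp); [apply Dh|]; auto_derive; [exact I | ring].
assert (E : forall t, 0 <= t -> A t = t * Jint 0 (Derive h) t).
  intros t Ht; assert (E := Jint_prim 0 _ t Cc).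
  rewrite (RInt_ext _ (Derive h)), RInt_Derive, h0 in E.
  - transitivity (h t); [|rewrite pow_1 in E; lra].
    unfold h, reflect; destruct Rle_dec; [symmetry; auto | lra].
  - intros; eexists; apply Dh.
  - intros; apply Cc.
  - intros; cbn; ring.
exists (Jint 0 (Derive h)); split; [exact Ha|split; [|exact E]].
apply (filterlim_locally_unique (F := at_right 0) (Jint 0 (Derive h))).
- apply (filterlim_filter_le_1 (F := locally 0) _ (filter_le_within _)).
  apply esmooth_continuous, Ha.
- apply (filterlim_ext_loc (fun t => (A t - A 0) / (t - 0))); [|exact Hl].
  exists posreal_one; intros t _ Ht; rewrite !E by lra; field; lra.
Qed.

(** * Radial functions of a quaternion *)

Definition q0 (x : quat) : R := fst (fst (fst x)).
Definition q1 (x : quat) : R := snd (fst (fst x)).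
Definition q2 (x : quat) : R := snd (fst x).
Definition q3 (x : quat) : R := snd x.

Lemma quat_eta (x : quat) : x = (q0 x, q1 x, q2 x, q3 x).
Proof. destruct x as [[[? ?] ?] ?]; reflexivity. Qed.

Lemma quat_eq (x y : quat) :
  q0 x = q0 y -> q1 x = q1 y -> q2 x = q2 y -> q3 x = q3 y -> x = y.
Proof. intros; rewrite (quat_eta x), (quat_eta y); congruence. Qed.

Lemma is_linear_q0 : is_linear q0.
Proof.
apply (is_linear_comp (fun x : quat => fst (fst x)) fst); [|apply is_linear_fst].
apply (is_linear_comp (fun x : quat => fst x) fst); apply is_linear_fst.
Qed.

Lemma is_linear_q1 : is_linear q1.
Proof.
apply (is_linear_comp (fun x : quat => fst (fst x)) snd); [|apply is_linear_snd].
apply (is_linear_comp (fun x : quat => fst x) fst); apply is_linear_fst.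
Qed.

Lemma is_linear_q2 : is_linear q2.
Proof.
apply (is_linear_comp (fun x : quat => fst x) snd);
  [apply is_linear_fst | apply is_linear_snd].
Qed.

Lemma is_linear_q3 : is_linear q3.
Proof. apply (is_linear_snd (U := prod_NormedModule _ _ _)). Qed.

Lemma qmul_coord x y : x ** y =
  (q0 x * q0 y - q1 x * q1 y - q2 x * q2 y - q3 x * q3 y,
   q0 x * q1 y + q1 x * q0 y + q2 x * q3 y - q3 x * q2 y,
   q0 x * q2 y - q1 x * q3 y + q2 x * q0 y + q3 x * q1 y,
   q0 x * q3 y + q1 x * q2 y - q2 x * q1 y + q3 x * q0 y).
Proof. destruct x as [[[? ?] ?] ?], y as [[[? ?] ?] ?]; reflexivity. Qed.

Lemma qconj_coord x : qconj x = (q0 x, - q1 x, - q2 x, - q3 x).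
Proof. destruct x as [[[? ?] ?] ?]; reflexivity. Qed.

Lemma qdot_coord x y : qdot x y = q0 x * q0 y + q1 x * q1 y + q2 x * q2 y + q3 x * q3 y.
Proof. destruct x as [[[? ?] ?] ?], y as [[[? ?] ?] ?]; reflexivity. Qed.

Section SmoothQuat.
Context {V : NormedModule R_AbsRing}.

Lemma Cn_quat_intro n (f0 f1 f2 f3 : V -> R) :
  Cn n f0 -> Cn n f1 -> Cn n f2 -> Cn n f3 ->
  Cn n (fun x => (f0 x, f1 x, f2 x, f3 x)).
Proof.
intros H0 H1 H2 H3.
apply (Cn_pair n (fun x => (f0 x, f1 x, f2 x)) f3); [|exact H3].
apply (Cn_pair n (fun x => (f0 x, f1 x)) f2); [|exact H2].
apply (Cn_pair n f0 f1); assumption.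
Qed.

Lemma Cn_quat_elim n (f : V -> quat) : Cn n f ->
  Cn n (fun x => q0 (f x)) /\ Cn n (fun x => q1 (f x)) /\
  Cn n (fun x => q2 (f x)) /\ Cn n (fun x => q3 (f x)).
Proof.
intros H; repeat split.
- exact (Cn_linear_comp n _ f is_linear_q0 H).
- exact (Cn_linear_comp n _ f is_linear_q1 H).
- exact (Cn_linear_comp n _ f is_linear_q2 H).
- exact (Cn_linear_comp n _ f is_linear_q3 H).
Qed.

Lemma Cn_qmul n (f g : V -> quat) :
  Cn n f -> Cn n g -> Cn n (fun x => f x ** g x).
Proof.
intros Hf Hg; apply (Cn_ext n _ _ (fun x => eq_sym (qmul_coord (f x) (g x)))).
destruct (Cn_quat_elim n f Hf) as (? & ? & ? & ?).
destruct (Cn_quat_elim n g Hg) as (? & ? & ? & ?).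
apply Cn_quat_intro;
  repeat first [apply Cn_minus | apply (Cn_plus (W := R_NormedModule)) | apply Cn_mult];
  assumption.
Qed.

Lemma Cn_qconj n (f : V -> quat) : Cn n f -> Cn n (fun x => qconj (f x)).
Proof.
intros Hf; apply (Cn_ext n _ _ (fun x => eq_sym (qconj_coord (f x)))).
destruct (Cn_quat_elim n f Hf) as (? & ? & ? & ?).
apply Cn_quat_intro; repeat apply Cn_opp; assumption.
Qed.

Lemma Cn_qdot n (f g : V -> quat) :
  Cn n f -> Cn n g -> Cn n (fun x => qdot (f x) (g x)).
Proof.
intros Hf Hg; apply (Cn_ext n _ _ (fun x => eq_sym (qdot_coord (f x) (g x)))).
destruct (Cn_quat_elim n f Hf) as (? & ? & ? & ?).
destruct (Cn_quat_elim n g Hg) as (? & ? & ? & ?).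
repeat first [apply (Cn_plus (W := R_NormedModule)) | apply Cn_mult]; assumption.
Qed.

Lemma Cn_qscal n (f : V -> R) (g : V -> quat) :
  Cn n f -> Cn n g -> Cn n (fun x => scal (f x) (g x) : quat).
Proof.
intros Hf Hg; destruct (Cn_quat_elim n g Hg) as (? & ? & ? & ?).
apply (Cn_ext n (fun x => (f x * q0 (g x), f x * q1 (g x), f x * q2 (g x), f x * q3 (g x)))).
  intros x; destruct (g x) as [[[? ?] ?] ?]; reflexivity.
apply Cn_quat_intro; apply Cn_mult; assumption.
Qed.

Lemma Cn_qplus n (f g : V -> quat) :
  Cn n f -> Cn n g -> Cn n (fun x => plus (f x) (g x)).
Proof. exact (Cn_plus n f g). Qed.

End SmoothQuat.

Lemma continuous_qabs (p : quat) : continuous qabs p.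
Proof.
apply (continuous_comp (fun p => qdot p p) sqrt); [|apply continuous_sqrt].
assert (H : Cn 0 (fun p : quat => p)) by apply Cn_id.
exact (Cn_continuous 0 _ p (Cn_qdot 0 _ _ H H)).
Qed.

Lemma qdot_line (p v : quat) (s : R) :
  qdot (plus p (scal s v)) (plus p (scal s v)) =
  qdot p p + 2 * qdot p v * s + qdot v v * s ^ 2.
Proof.
destruct p as [[[? ?] ?] ?], v as [[[? ?] ?] ?].
cbv -[Rplus Rmult pow]; ring.
Qed.

(** Away from 0 this is the chain rule for the norm. At p = 0 the norm is not differentiable, but
    along the line it equals |s| |v|, and evenness of f removes the absolute value. *)
Lemma radial_derive f (p v : quat) :
  esmooth f ->
  is_derive (fun s : R => f (qabs (plus p (scal s v)))) 0 (Dq f (qabs p) * qdot p v).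
Proof.
intros Hf; assert (Df := fun t => is_derive_esmooth f t Hf).
apply (is_derive_ext (fun s => f (sqrt (qdot p p + 2 * qdot p v * s + qdot v v * s ^ 2)))).
  intros s; unfold qabs; rewrite qdot_line; reflexivity.
destruct (Req_dec (qdot p p) 0) as [E0|E0].
- assert (p = (0, 0, 0, 0)) as ->.
    destruct (Req_dec (q0 p) 0), (Req_dec (q1 p) 0), (Req_dec (q2 p) 0), (Req_dec (q3 p) 0);
      [apply quat_eq; assumption|rewrite qdot_coord in E0; nra..].
  assert (E : forall s, qdot (0, 0, 0, 0) (0, 0, 0, 0) + 2 * qdot (0, 0, 0, 0) v * s
    + qdot v v * s ^ 2 = qdot v v * Rsqr s).
    intros s; rewrite !(qdot_coord (0, 0, 0, 0)); unfold Rsqr, q0, q1, q2, q3; cbn [fst snd]; ring.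
  assert (Hv : 0 <= qdot v v) by (rewrite qdot_coord; nra).
  apply (is_derive_ext (fun s => f (s * sqrt (qdot v v)))).
    intros s; rewrite E, sqrt_mult, sqrt_Rsqr_abs by (try apply Rle_0_sqr; exact Hv).
    unfold Rabs; destruct Rcase_abs; [rewrite <- (proj2 Hf)|]; f_equal; ring.
  replace (_ * qdot _ v) with
    (scal (sqrt (qdot v v)) (0 * sqrt (qdot v v) * Dq f (0 * sqrt (qdot v v)))).
    apply (is_derive_comp f (fun s => s * sqrt (qdot v v))); [apply Df|].
    auto_derive; [exact I | ring].
  replace (qdot (0, 0, 0, 0) v) with 0 by
    (rewrite qdot_coord; unfold q0, q1, q2, q3; cbn [fst snd]; ring).
  set (c := sqrt (qdot v v)); change (c * (0 * c * Dq f (0 * c)) =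
    Dq f (qabs (0, 0, 0, 0)) * 0); ring.
- assert (Hp : 0 < qdot p p) by (rewrite qdot_coord in *; nra).
  assert (Hs : sqrt (qdot p p) <> 0) by (apply Rgt_not_eq, sqrt_lt_R0, Hp).
  set (r := sqrt (qdot p p)) in *.
  replace (Dq f (qabs p) * qdot p v) with (scal (qdot p v / r) (r * Dq f r)).
    apply (is_derive_comp f (fun s =>
      sqrt (qdot p p + 2 * qdot p v * s + qdot v v * s ^ 2))).
      replace (qdot p p + _ + _) with (qdot p p) by ring; apply Df.
    auto_derive.
      replace (qdot p p + _ + _) with (qdot p p) by ring; auto.
    replace (qdot p p + _ + _) with (qdot p p) by ring; fold r; field; exact Hs.
  change (qdot p v / r * (r * Dq f r) = Dq f (qabs p) * qdot p v).
  change (qabs p) with r; field; exact Hs.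
Qed.

Lemma Cn_radial {V : NormedModule R_AbsRing} n (l : V -> quat) f :
  is_linear l -> esmooth f -> Cn n (fun x => f (qabs (l x))).
Proof.
intros Hl; revert f; induction n as [|n IH]; intros f Hf;
  assert (Hc : forall x, continuous (fun x => f (qabs (l x))) x) by
   (intros x; apply (continuous_comp (fun x => qabs (l x)) f);
    [apply (continuous_comp l qabs);
      [apply (continuous_linear l x Hl) | apply continuous_qabs]
    | apply esmooth_continuous, Hf]).
- split; [intros; apply Hc | exact I].
- split; [intros; apply Hc|].
  intros v; exists (fun x => Dq f (qabs (l x)) * qdot (l x) (l v)); split.
    apply Cn_mult; [apply IH, esmooth_Dq, Hf|].
    apply Cn_qdot; [apply Cn_linear, Hl | apply Cn_const].
  intros x _.
  apply (is_derive_ext (fun s : R => f (qabs (plus (l x) (scal s (l v)))))).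
    intros s; rewrite (linear_plus l Hl), (linear_scal l Hl); reflexivity.
  apply radial_derive, Hf.
Qed.

(** * A singular Volterra equation *)

Lemma continuous_bounded (f : R -> R) L :
  (forall x, continuous f x) -> exists K, 0 <= K /\ forall t, Rabs t <= L -> Rabs (f t) <= K.
Proof.
intros Hf; destruct (Rle_dec 0 L) as [HL|HL].
- destruct (continuity_ab_maj (fun t => Rabs (f t)) (- L) L) as [x [Hx _]]; [lra| |].
    intros c _; apply continuity_pt_filterlim.
    apply (continuous_comp f Rabs); [apply Hf | apply continuous_Rabs].
  exists (Rabs (f x)); split; [apply Rabs_pos|]; intros t Ht.
  apply Hx, Rabs_le_between, Ht.
- exists 0; split; [lra|]; intros t Ht; assert (H := Rabs_pos t); lra.
Qed.

Lemma Jint_minus k f g t :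
  (forall x, continuous f x) -> (forall x, continuous g x) ->
  Jint k (fun s => f s - g s) t = Jint k f t - Jint k g t.
Proof.
intros Hf Hg; unfold Jint.
assert (E := RInt_minus _ _ 0 1 (Jint_ex k f t Hf) (Jint_ex k g t Hg)).
change (RInt (fun s => s ^ k * f (t * s) - s ^ k * g (t * s)) 0 1 =
  RInt (fun s => s ^ k * f (t * s)) 0 1 - RInt (fun s => s ^ k * g (t * s)) 0 1) in E.
rewrite <- E; apply RInt_ext; intros s _.
change (s ^ k * (f (t * s) - g (t * s)) = s ^ k * f (t * s) - s ^ k * g (t * s)); ring.
Qed.

Lemma prim1_minus f g t :
  (forall x, continuous f x) -> (forall x, continuous g x) ->
  prim1 (fun s => f s - g s) t = prim1 f t - prim1 g t.
Proof. intros Hf Hg; unfold prim1; rewrite Jint_minus by assumption; ring. Qed.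

Lemma prim1_opp f t :
  (forall x, continuous f x) -> prim1 (fun s => - f s) t = - prim1 f t.
Proof.
intros Hf; unfold prim1, Jint.
rewrite Ropp_mult_distr_r; f_equal.
assert (E := RInt_opp (V := R_CompleteNormedModule) _ 0 1 (Jint_ex 1 f t Hf)).
change (RInt (fun s => - (s ^ 1 * f (t * s))) 0 1 =
  - RInt (fun s => s ^ 1 * f (t * s)) 0 1) in E.
rewrite <- E; apply RInt_ext; intros s _; symmetry; exact (Ropp_mult_distr_r _ _).
Qed.

Lemma prim1_monotone f g t :
  (forall x, continuous f x) -> (forall x, continuous g x) ->
  (forall s, Rabs s <= Rabs t -> f s <= g s) -> prim1 f t <= prim1 g t.
Proof.
intros Hf Hg H; enough (0 <= prim1 (fun s => g s - f s) t) by
  (rewrite prim1_minus in H0 by assumption; lra).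
apply Rmult_le_pos; [apply pow2_ge_0|]; apply Jint_pos.
  intros; apply continuous_Rminus; auto.
intros s Hs; enough (f (t * s) <= g (t * s)) by lra; apply H.
rewrite Rabs_mult, (Rabs_pos_eq s) by lra; assert (H0 := Rabs_pos t); nra.
Qed.

Lemma exp_monotone x y : x <= y -> exp x <= exp y.
Proof.
intros [H| ->]; [left; apply exp_increasing, H | apply Rle_refl].
Qed.

Lemma is_derive_gauss D l x :
  is_derive (fun s => D * exp (l * s ^ 2)) x (D * (2 * l * x * exp (l * x ^ 2))).
Proof. auto_derive; [exact I | cbn [pow]; ring]. Qed.

Lemma prim1_exp l t : 0 < l ->
  prim1 (fun s => exp (l * s ^ 2)) t = (exp (l * t ^ 2) - 1) / (2 * l).
Proof.
intros Hl.
assert (E := constant_of_derive_0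
  (fun t => prim1 (fun s => exp (l * s ^ 2)) t - exp (l * t ^ 2) / (2 * l)) t 0).
cbn beta in E; rewrite prim1_0, pow_i, Rmult_0_r, exp_0 in E by lia.
enough (prim1 (fun s => exp (l * s ^ 2)) t - exp (l * t ^ 2) / (2 * l) = 0 - 1 / (2 * l)).
  replace ((exp (l * t ^ 2) - 1) / (2 * l)) with
    (exp (l * t ^ 2) / (2 * l) + (0 - 1 / (2 * l))) by (field; lra); lra.
apply E; intros x.
replace 0 with (x * exp (l * x ^ 2) - x * exp (l * x ^ 2)) by ring.
apply (is_derive_minus (K := R_AbsRing) (V := R_NormedModule)).
  apply (prim1_derive (fun s => exp (l * s ^ 2))); intros y.
  apply (continuous_comp (fun s => l * s ^ 2) exp); [|apply continuous_exp].
  apply (continuous_Rmult (fun _ => l)); [apply continuous_const | apply continuous_pow].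
auto_derive; [exact I | cbn [pow]; field; lra].
Qed.

(** In the norm with weight exp(l t^2), integration against s ds gains a factor 1/(2l). A large l
    thus makes any Lipschitz operator contract on an interval of any length. *)
Lemma prim1_exp_bound g l C t :
  0 < l -> 0 <= C -> (forall x, continuous g x) ->
  (forall s, Rabs s <= Rabs t -> Rabs (g s) <= C * exp (l * s ^ 2)) ->
  Rabs (prim1 g t) <= C / (2 * l) * exp (l * t ^ 2).
Proof.
intros Hl HC Hg H.
assert (HE : forall D x, continuous (fun s => D * exp (l * s ^ 2)) x).
  intros D x; exact (continuous_of_derive _ _ _ (is_derive_gauss D l x)).
assert (ED : forall D, prim1 (fun s => D * exp (l * s ^ 2)) t =
  D * ((exp (l * t ^ 2) - 1) / (2 * l))).
  intros D; rewrite <- prim1_exp by assumption; unfold prim1, Jint.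
  rewrite <- Rmult_assoc, (Rmult_comm D), Rmult_assoc; f_equal.
  assert (HE1 := HE 1).
  assert (E := RInt_scal (V := R_CompleteNormedModule)
    (fun s => s ^ 1 * exp (l * (t * s) ^ 2)) 0 1 D).
  change (RInt (fun s => s ^ 1 * (D * exp (l * (t * s) ^ 2))) 0 1 =
    scal D (RInt (fun s => s ^ 1 * exp (l * (t * s) ^ 2)) 0 1)).
  rewrite <- E.
    apply RInt_ext; intros s _.
    change (s ^ 1 * (D * exp (l * (t * s) ^ 2)) = D * (s ^ 1 * exp (l * (t * s) ^ 2))); ring.
  apply (Jint_ex 1 (fun s => exp (l * s ^ 2))); intros x.
  apply (continuous_ext (fun s => 1 * exp (l * s ^ 2))); [intros; apply Rmult_1_l | apply HE1].
assert (H1 : prim1 g t <= prim1 (fun s => C * exp (l * s ^ 2)) t).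
  apply prim1_monotone; auto; intros s Hs; specialize (H s Hs).
  apply Rabs_le_between in H; lra.
assert (H2 : prim1 (fun s => - C * exp (l * s ^ 2)) t <= prim1 g t).
  apply prim1_monotone; auto; intros s Hs; specialize (H s Hs).
  apply Rabs_le_between in H; lra.
rewrite ED in H1, H2.
assert (H3 : C / (2 * l) * exp (l * t ^ 2) =
  C * ((exp (l * t ^ 2) - 1) / (2 * l)) + C / (2 * l)) by (field; lra).
assert (0 <= C / (2 * l)) by (apply Rdiv_le_0_compat; lra).
apply Rabs_le; lra.
Qed.

Lemma eq_of_geometric_bound x y C : (forall n, Rabs (x - y) <= C * (/ 2) ^ n) -> x = y.
Proof.
intros H; apply Rminus_diag_uniq, Rabs_eq_0.
apply Rle_antisym; [|apply Rabs_pos].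
apply (is_lim_seq_le (fun _ => Rabs (x - y)) (fun n => C * (/ 2) ^ n) (Rabs (x - y)) 0 H).
  apply is_lim_seq_const.
replace (Finite 0) with (Rbar_mult C 0) by (cbn; f_equal; ring).
apply is_lim_seq_scal_l, is_lim_seq_geom; rewrite Rabs_pos_eq; lra.
Qed.

Section Volterra.
Variable N : (R -> R) -> R -> R.
Hypothesis N_continuous :
  forall f, (forall x, continuous f x) -> forall x, continuous (N f) x.
Hypothesis N_even :
  forall f, (forall t, f (- t) = f t) -> forall t, N f (- t) = N f t.
Hypothesis N_lipschitz : forall L, exists K, 0 <= K /\
  forall f g t D, (forall x, continuous f x) -> (forall x, continuous g x) ->
  Rabs t <= L -> (forall s, Rabs s <= Rabs t -> Rabs (f s - g s) <= D) ->
  Rabs (N f t - N g t) <= K * D.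

(** Iterates for f(t) = 1 - int_0^t s N(f)(s) ds. The value of N(f) at t is controlled by f on
    [-|t|, |t|] only, as [N_lipschitz] records; the estimates therefore close on each compact
    interval, and the limit is global. *)
Fixpoint picard (n : nat) : R -> R :=
  match n with
  | O => fun _ => 1
  | S k => fun t => 1 - prim1 (N (picard k)) t
  end.

Lemma prim1_continuous g x : (forall x, continuous g x) -> continuous (prim1 g) x.
Proof. intros H; exact (continuous_of_derive _ _ _ (prim1_derive g x H)). Qed.

Lemma picard_continuous n x : continuous (picard n) x.
Proof.
revert x; induction n as [|n IH]; intros x; [apply continuous_const|].
apply (continuous_Rminus (fun _ => 1)); [apply continuous_const|].
apply prim1_continuous, N_continuous, IH.
Qed.

Lemma picard_even n t : picard n (- t) = picard n t.
Proof.
revert t; induction n as [|n IH]; intros t; [reflexivity|]; cbn [picard].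
unfold prim1; rewrite Jint_even by (apply N_even, IH); f_equal; f_equal; ring.
Qed.

Lemma picard_step L : exists C, 0 <= C /\
  forall n t, Rabs t <= L -> Rabs (picard (S n) t - picard n t) <= C * (/ 2) ^ n.
Proof.
destruct (N_lipschitz L) as [K [HK HN]].
destruct (continuous_bounded (fun t => picard 1 t - picard 0 t) L) as [M [HM HB]].
  intros x; apply continuous_Rminus; apply picard_continuous.
(* With this weight the contraction factor K / (2 l) is at most 1/2. *)
set (l := K + 1).
assert (Hl : 0 < l) by (unfold l; lra).
assert (Hexp : forall t, 1 <= exp (l * t ^ 2)).
  intros t; rewrite <- exp_0; apply exp_monotone; assert (H := pow2_ge_0 t); nra.
assert (Hmono : forall s t, Rabs s <= Rabs t -> exp (l * s ^ 2) <= exp (l * t ^ 2)).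
  intros s t Hst; apply exp_monotone; apply Rmult_le_compat_l; [lra|].
  rewrite <- (pow2_abs s), <- (pow2_abs t); apply pow_incr; split; [apply Rabs_pos | exact Hst].
exists (M * exp (l * L ^ 2)); split.
  apply Rmult_le_pos; [exact HM | left; apply exp_pos].
enough (H : forall n t, Rabs t <= L ->
  Rabs (picard (S n) t - picard n t) <= M * (/ 2) ^ n * exp (l * t ^ 2)).
  intros n t Ht; eapply Rle_trans; [apply H, Ht|].
  rewrite Rmult_assoc, (Rmult_comm ((/ 2) ^ n)), <- Rmult_assoc.
  apply Rmult_le_compat_r; [apply pow_le; lra|].
  apply Rmult_le_compat_l; [exact HM|]; apply Hmono.
  rewrite (Rabs_pos_eq L); [exact Ht|]; assert (H0 := Rabs_pos t); lra.
intros n; induction n as [|n IH]; intros t Ht.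
- eapply Rle_trans; [apply HB, Ht|]; specialize (Hexp t); rewrite pow_O; nra.
- change (picard (S (S n)) t - picard (S n) t) with
    ((1 - prim1 (N (picard (S n))) t) - (1 - prim1 (N (picard n)) t)).
  replace (_ - _) with (- (prim1 (N (picard (S n))) t - prim1 (N (picard n)) t)) by ring.
  rewrite Rabs_Ropp, <- prim1_minus by (apply N_continuous, picard_continuous).
  assert (Hq : 0 <= M * (/ 2) ^ n) by (apply Rmult_le_pos; [|apply pow_le]; lra).
  eapply Rle_trans; [apply (prim1_exp_bound _ l (K * (M * (/ 2) ^ n)))|].
  + exact Hl.
  + apply Rmult_le_pos; assumption.
  + intros x; apply continuous_Rminus; apply N_continuous, picard_continuous.
  + intros s Hs; rewrite Rmult_assoc; apply HN; try (apply picard_continuous); [lra|].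
    intros r Hr; eapply Rle_trans; [apply IH; lra|].
    apply Rmult_le_compat_l; [exact Hq | apply Hmono, Hr].
  + apply Rmult_le_compat_r; [left; apply exp_pos|].
    replace (M * (/ 2) ^ S n) with (M * (/ 2) ^ n * / 2) by (cbn; ring).
    replace (K * (M * (/ 2) ^ n) / (2 * l)) with (M * (/ 2) ^ n * (K / (2 * l))) by
      (field; lra).
    apply Rmult_le_compat_l; [exact Hq|].
    apply (Rmult_le_reg_r (2 * l)); [lra|]; replace (K / (2 * l) * (2 * l)) with K by
      (field; lra); unfold l; lra.
Qed.

Lemma picard_tail L : exists C, 0 <= C /\
  forall n m t, Rabs t <= L -> Rabs (picard (n + m) t - picard n t) <= C * (/ 2) ^ n.
Proof.
destruct (picard_step L) as [C [HC H]]; exists (2 * C); split; [lra|].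
intros n m t Ht.
(* The last factor is the partial geometric sum 1 + 1/2 + ... with m terms, which makes the
   induction on m exact. *)
enough (Rabs (picard (n + m) t - picard n t) <= C * (/ 2) ^ n * (2 - 2 * (/ 2) ^ m)).
  assert (0 <= (/ 2) ^ m) by (apply pow_le; lra).
  assert (0 <= C * (/ 2) ^ n) by (apply Rmult_le_pos; [|apply pow_le]; lra); nra.
induction m as [|m IH].
- rewrite Nat.add_0_r, Rminus_diag_eq, Rabs_R0 by reflexivity; rewrite pow_O; lra.
- rewrite Nat.add_succ_r.
  replace (_ - _) with ((picard (S (n + m)) t - picard (n + m) t) +
    (picard (n + m) t - picard n t)) by ring.
  eapply Rle_trans; [apply Rabs_triang|].
  specialize (H (n + m)%nat t Ht); rewrite pow_add in H; cbn [pow]; lra.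
Qed.

Definition picard_lim (t : R) : R := real (Lim_seq (fun n => picard n t)).

Lemma picard_lim_bound L : exists C, 0 <= C /\
  forall n t, Rabs t <= L -> Rabs (picard_lim t - picard n t) <= C * (/ 2) ^ n.
Proof.
destruct (picard_tail L) as [C [HC H]]; exists C; split; [exact HC|]; intros n t Ht.
assert (Hl : ex_finite_lim_seq (fun n => picard n t)).
  apply ex_lim_seq_cauchy_corr; intros eps.
  assert (Hz : is_lim_seq (fun n => C * (/ 2) ^ n) 0).
    replace (Finite 0) with (Rbar_mult C 0) by (cbn; f_equal; ring).
    apply is_lim_seq_scal_l, is_lim_seq_geom; rewrite Rabs_pos_eq; lra.
  apply is_lim_seq_spec in Hz.
  destruct (Hz (mkposreal _ (is_pos_div_2 eps))) as [n0 Hn0]; exists n0.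
  specialize (Hn0 n0 (Nat.le_refl _)); cbn in Hn0; rewrite Rminus_0_r in Hn0.
  assert (He := Rle_lt_trans _ _ _ (Rle_abs _) Hn0).
  intros p q Hp Hq.
  assert (H1 := H n0 (p - n0)%nat t Ht); assert (H2 := H n0 (q - n0)%nat t Ht).
  replace (n0 + (p - n0))%nat with p in H1 by lia.
  replace (n0 + (q - n0))%nat with q in H2 by lia.
  replace (picard p t - picard q t) with
    ((picard p t - picard n0 t) - (picard q t - picard n0 t)) by ring.
  eapply Rle_lt_trans; [apply Rabs_triang|]; rewrite Rabs_Ropp; lra.
apply Lim_seq_correct' in Hl; fold (picard_lim t) in Hl.
apply (is_lim_seq_le (fun m => Rabs (picard (n + m) t - picard n t))
  (fun _ => C * (/ 2) ^ n) (Rabs (picard_lim t - picard n t)) (C * (/ 2) ^ n)).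
- intros m; apply H, Ht.
- apply (is_lim_seq_abs _ (Finite (picard_lim t - picard n t))).
  apply is_lim_seq_minus'; [|apply is_lim_seq_const].
  apply (is_lim_seq_ext (fun m => picard (m + n) t)).
    intros; rewrite Nat.add_comm; reflexivity.
  apply (is_lim_seq_incr_n (fun m => picard m t)), Hl.
- apply is_lim_seq_const.
Qed.

Lemma picard_lim_continuous x : continuous picard_lim x.
Proof.
destruct (picard_lim_bound (Rabs x + 1)) as [C [HC H]].
apply filterlim_locally; intros eps.
assert (Hz : is_lim_seq (fun n => C * (/ 2) ^ n) 0).
  replace (Finite 0) with (Rbar_mult C 0) by (cbn; f_equal; ring).
  apply is_lim_seq_scal_l, is_lim_seq_geom; rewrite Rabs_pos_eq; lra.
apply is_lim_seq_spec in Hz.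
assert (He3 : 0 < eps / 3) by (assert (H0 := cond_pos eps); lra).
destruct (Hz (mkposreal _ He3)) as [n Hn].
specialize (Hn n (Nat.le_refl _)); cbn in Hn; rewrite Rminus_0_r in Hn.
assert (Hn' := Rle_lt_trans _ _ _ (Rle_abs _) Hn).
destruct (proj1 (filterlim_locally _ _) (picard_continuous n x) (mkposreal _ He3)) as [d Hd].
exists (mkposreal _ (Rmin_pos d 1 (cond_pos d) Rlt_0_1)); intros y Hy.
change (Rabs (y - x) < Rmin d 1) in Hy.
assert (Hl := Rmin_l d 1); assert (Hr := Rmin_r d 1).
assert (Hyx : Rabs y <= Rabs x + 1).
  replace y with (x + (y - x)) by ring; eapply Rle_trans; [apply Rabs_triang|]; lra.
specialize (Hd y ltac:(change (Rabs (y - x) < d); lra)).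
change (Rabs (picard n y - picard n x) < eps / 3) in Hd.
change (Rabs (picard_lim y - picard_lim x) < eps).
assert (H1 := H n y Hyx); assert (H2 := H n x ltac:(lra)).
replace (picard_lim y - picard_lim x) with
  ((picard_lim y - picard n y) + (picard n y - picard n x) - (picard_lim x - picard n x))
  by ring.
eapply Rle_lt_trans; [apply Rabs_triang|]; rewrite Rabs_Ropp.
eapply Rle_lt_trans; [apply Rplus_le_compat_r, Rabs_triang|]; lra.
Qed.

Lemma volterra_fixpoint : exists f : R -> R,
  (forall x, continuous f x) /\ (forall t, f (- t) = f t) /\
  forall t, f t = 1 - prim1 (N f) t.
Proof.
exists picard_lim; split; [apply picard_lim_continuous|split].
- intros t; unfold picard_lim; f_equal; apply Lim_seq_ext; intros n; apply picard_even.
- intros t; destruct (picard_lim_bound (Rabs t)) as [C [HC H]].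
  destruct (N_lipschitz (Rabs t)) as [K [HK HN]].
  assert (Hc := picard_lim_continuous).
  (* The residual of the equation is compared with the n-th iterate: the distance from the limit to
     the next iterate gives [C], and the integral of the Lipschitz error, estimated with weight l =
     1, gives the other term. *)
  apply (eq_of_geometric_bound _ _ (C + K * C / 2 * exp (1 * t ^ 2))); intros n.
  replace (picard_lim t - (1 - prim1 (N picard_lim) t)) with
    ((picard_lim t - picard (S n) t) - prim1 (fun s => N (picard n) s - N picard_lim s) t).
  2: { rewrite prim1_minus by (apply N_continuous; first [exact Hc | apply picard_continuous]).
       cbn [picard]; ring. }
  eapply Rle_trans; [apply Rabs_triang|]; rewrite Rabs_Ropp, Rmult_plus_distr_r.
  assert (Hp : 0 <= (/ 2) ^ n) by (apply pow_le; lra).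
  apply Rplus_le_compat.
    eapply Rle_trans; [apply H; lra|]; cbn [pow].
    assert (H0 := Rmult_le_pos _ _ HC Hp). lra.
  eapply Rle_trans; [apply (prim1_exp_bound _ 1 (K * (C * (/ 2) ^ n)))|].
  + lra.
  + apply Rmult_le_pos; [|apply Rmult_le_pos]; assumption.
  + intros x; apply continuous_Rminus; apply N_continuous;
      first [exact Hc | apply picard_continuous].
  + intros s Hs; assert (He : 1 <= exp (1 * s ^ 2)).
      rewrite <- exp_0 at 1; apply exp_monotone; assert (H0 := pow2_ge_0 s); lra.
    apply Rle_trans with (K * (C * (/ 2) ^ n) * 1).
    2: { apply Rmult_le_compat_l; [|exact He].
         apply Rmult_le_pos; [|apply Rmult_le_pos]; assumption. }
    rewrite Rmult_1_r; apply HN; auto; [apply picard_continuous|].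
    intros r Hr; rewrite Rabs_minus_sym; apply H; lra.
  + apply Req_le; field.
Qed.

End Volterra.

(** * Solutions of the instanton equations *)

Definition clamp (x : R) : R := Rmax 0 (Rmin x 1).

Lemma clamp_range x : 0 <= clamp x <= 1.
Proof. unfold clamp, Rmax, Rmin; repeat destruct Rle_dec; lra. Qed.

Lemma clamp_id x : 0 <= x <= 1 -> clamp x = x.
Proof. intros H; unfold clamp, Rmax, Rmin; repeat destruct Rle_dec; lra. Qed.

Lemma clamp_lipschitz x y : Rabs (clamp x - clamp y) <= Rabs (x - y).
Proof.
unfold clamp, Rmax, Rmin, Rabs; repeat destruct Rle_dec; repeat destruct Rcase_abs; lra.
Qed.

(* The nonlinearity [x - c x^5], truncated so as to be globally Lipschitz; the
   solution found below takes its values in [0, 1], where [clamp] is the identity. *)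
Definition damped (c x : R) : R := x - c * clamp x ^ 5.

(** 6 = 1 + 5: one for the linear term, five for the summands u^i v^(4-i) in the factorisation of
    u^5 - v^5, each at most 1 on clamped values. *)
Lemma damped_lipschitz c x y : 0 <= c <= 1 ->
  Rabs (damped c x - damped c y) <= 6 * Rabs (x - y).
Proof.
intros Hc; unfold damped; assert (H := clamp_lipschitz x y).
assert (Hx := clamp_range x); assert (Hy := clamp_range y).
set (u := clamp x) in *; set (v := clamp y) in *.
replace (x - c * u ^ 5 - (y - c * v ^ 5)) with ((x - y) - c * (u ^ 5 - v ^ 5)) by ring.
eapply Rle_trans; [apply Rabs_triang|]; rewrite Rabs_Ropp.
enough (Rabs (c * (u ^ 5 - v ^ 5)) <= 5 * Rabs (x - y)) by lra.
replace (c * (u ^ 5 - v ^ 5)) with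
  (c * (u ^ 4 + u ^ 3 * v + u ^ 2 * v ^ 2 + u * v ^ 3 + v ^ 4) * (u - v)) by ring.
assert (Hu4 := pow_unit_interval 4 u Hx); assert (Hu3 := pow_unit_interval 3 u Hx).
assert (Hu2 := pow_unit_interval 2 u Hx); assert (Hv4 := pow_unit_interval 4 v Hy).
assert (Hv3 := pow_unit_interval 3 v Hy); assert (Hv2 := pow_unit_interval 2 v Hy).
assert (Hs : 0 <= u ^ 4 + u ^ 3 * v + u ^ 2 * v ^ 2 + u * v ^ 3 + v ^ 4 <= 5).
  assert (forall p q, 0 <= p <= 1 -> 0 <= q <= 1 -> 0 <= p * q <= 1) by (intros; nra).
  assert (H1 := H0 _ _ Hu3 Hy); assert (H2 := H0 _ _ Hu2 Hv2); assert (H3 := H0 _ _ Hx Hv3).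
  lra.
set (s := u ^ 4 + _ + _ + _ + _) in *.
rewrite Rabs_mult, Rabs_pos_eq by (apply Rmult_le_pos; lra).
assert (H0 := Rabs_pos (u - v)).
apply Rmult_le_compat; [apply Rmult_le_pos; lra | exact H0 | nra | exact H].
Qed.

Lemma damped_continuous c x : 0 <= c <= 1 -> continuous (damped c) x.
Proof.
intros Hc; apply filterlim_locally; intros eps.
assert (He : 0 < eps / 6) by (assert (H := cond_pos eps); lra).
exists (mkposreal _ He); intros y Hy; change (Rabs (y - x) < eps / 6) in Hy.
change (Rabs (damped c y - damped c x) < eps).
assert (H := damped_lipschitz c y x Hc); lra.
Qed.

(** The bound c <= 1 matters here, since x >= clamp x >= c (clamp x)^5. With c = v(0)^2 it is the
    condition |b0 y0| <= 1. *)
Lemma damped_nonneg c x : 0 <= c <= 1 -> 0 <= x -> 0 <= damped c x.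
Proof.
intros Hc Hx; unfold damped.
assert (H : clamp x <= x) by (unfold clamp, Rmax, Rmin; repeat destruct Rle_dec; lra).
assert (Hr := clamp_range x); assert (H4 := pow_unit_interval 4 _ Hr).
replace (clamp x ^ 5) with (clamp x * clamp x ^ 4) by ring; set (p := clamp x ^ 4) in *.
assert (clamp x * p <= clamp x) by nra; assert (0 <= clamp x * p) by nra; nra.
Qed.

Section Profiles.
Variables a b : R -> R.
Hypothesis a_smooth : esmooth a.
Hypothesis b_smooth : esmooth b.
Hypothesis a_pos : forall t, 0 < a t.
Hypothesis b_pos : forall t, 0 < b t.
Hypothesis a_0 : a 0 = 1 / 2.

Lemma a_neq0 t : a t <> 0.
Proof. apply Rgt_not_eq, a_pos. Qed.

Lemma b_sqr_neq0 t : b t ^ 2 <> 0.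
Proof. apply pow_nonzero, Rgt_not_eq, b_pos. Qed.

(** With A(t) = t a(t) and B = b, the coefficient A / B^2 of the instanton equations is
    [t * ab2 t]. *)
Definition ab2 (t : R) : R := a t / b t ^ 2.

Lemma ab2_smooth : esmooth ab2.
Proof.
apply esmooth_div; [apply b_sqr_neq0 | exact a_smooth | apply esmooth_pow, b_smooth].
Qed.

(* [(1 / A - 2 / t) / t], where [A t = t a t] *)
Definition defect : R -> R := Jint 1 (Dq (fun t => / a t)).

Lemma inv_a_smooth : esmooth (fun t => / a t).
Proof. apply esmooth_inv; [apply a_neq0 | exact a_smooth]. Qed.

Lemma defect_smooth : esmooth defect.
Proof. apply esmooth_Jint, esmooth_Dq, inv_a_smooth. Qed.

(** The normalisation a(0) = 1/2 makes 2/t the exact singular part of 1/A. *)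
Lemma defect_eq t : t ^ 2 * defect t = / a t - 2.
Proof.
assert (E := esmooth_prim1_Dq _ t inv_a_smooth); cbn beta in E.
unfold prim1 in E; fold defect in E; rewrite E, a_0; field.
Qed.

Lemma exp_prim1_derive g t : esmooth g ->
  is_derive (fun t => exp (prim1 g t)) t (t * g t * exp (prim1 g t)).
Proof.
intros Hg; apply (is_derive_comp exp (prim1 g)).
  apply is_derive_Reals, derivable_pt_lim_exp.
apply prim1_derive; intros; apply esmooth_continuous, Hg.
Qed.

(** The regular part of the integrating factor mu = t^3 rho of the second order equation for f: mu
    is A times the exponential of a primitive of 1/A + A/B^2, where t^2 comes from the singular part
    2/t. *)
Definition rho (t : R) : R := a t * exp (prim1 (fun s => defect s + ab2 s) t).

Lemma rho_smooth : esmooth rho.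
Proof.
apply esmooth_mult; [exact a_smooth|]; apply esmooth_exp, esmooth_prim1, esmooth_plus;
  [apply defect_smooth | apply ab2_smooth].
Qed.

Lemma rho_pos t : 0 < rho t.
Proof. apply Rmult_lt_0_compat; [apply a_pos | apply exp_pos]. Qed.

Section Nonlinear.
Variable c : R.
Hypothesis c_range : 0 <= c <= 1.

Definition source (f : R -> R) (t : R) : R := rho t * damped c (f t) / b t ^ 2.

(** This is - f'/t after integrating (mu f')' once: mu f' is minus the integral of s^3 [source f s],
    and dividing by t mu = t^4 rho leaves exactly the average with weight 3. *)
Definition slope (f : R -> R) (t : R) : R := / rho t * Jint 3 (source f) t.

Lemma source_continuous f :
  (forall x, continuous f x) -> forall x, continuous (source f) x.
Proof.
intros Hf x; apply continuous_Rmult.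
- apply (continuous_Rmult rho (fun t => damped c (f t))).
    apply esmooth_continuous, rho_smooth.
  apply (continuous_comp f (damped c)); [apply Hf | apply damped_continuous, c_range].
- apply (esmooth_continuous (fun t => / b t ^ 2)), esmooth_inv.
    apply b_sqr_neq0.
  apply esmooth_pow, b_smooth.
Qed.

Lemma inv_rho_smooth : esmooth (fun t => / rho t).
Proof. apply esmooth_inv; [intros; apply Rgt_not_eq, rho_pos | apply rho_smooth]. Qed.

Lemma slope_continuous f :
  (forall x, continuous f x) -> forall x, continuous (slope f) x.
Proof.
intros Hf x; apply (continuous_Rmult (fun t => / rho t)).
  apply (esmooth_continuous (fun t => / rho t)), inv_rho_smooth.
apply Jint_continuous, source_continuous, Hf.
Qed.

Lemma slope_even f : (forall t, f (- t) = f t) -> forall t, slope f (- t) = slope f t.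
Proof.
intros Hf t; unfold slope; rewrite (proj2 rho_smooth), Jint_even; [reflexivity|].
intros x; unfold source; rewrite Hf, (proj2 rho_smooth), (proj2 b_smooth); reflexivity.
Qed.

Lemma slope_lipschitz L : exists K, 0 <= K /\
  forall f g t D, (forall x, continuous f x) -> (forall x, continuous g x) ->
  Rabs t <= L -> (forall s, Rabs s <= Rabs t -> Rabs (f s - g s) <= D) ->
  Rabs (slope f t - slope g t) <= K * D.
Proof.
destruct (continuous_bounded (fun t => / rho t) L) as [K1 [HK1 H1]].
  intros; apply (esmooth_continuous (fun t => / rho t)), inv_rho_smooth.
destruct (continuous_bounded (fun t => rho t / b t ^ 2) L) as [K2 [HK2 H2]].
  intros; apply (esmooth_continuous (fun t => rho t / b t ^ 2)), esmooth_div;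
    [apply b_sqr_neq0 | apply rho_smooth | apply esmooth_pow, b_smooth].
exists (K1 * (K2 * 6)); split; [apply Rmult_le_pos; lra|].
intros f g t D Hf Hg Ht HD.
unfold slope; rewrite <- Rmult_minus_distr_l, Rabs_mult, Rmult_assoc.
apply Rmult_le_compat; [apply Rabs_pos | apply Rabs_pos | apply H1, Ht|].
apply Jint_diff_bound; [apply source_continuous, Hf | apply source_continuous, Hg|].
intros s Hs; assert (Hts : Rabs (t * s) <= Rabs t).
  rewrite Rabs_mult, (Rabs_pos_eq s) by lra; assert (H := Rabs_pos t); nra.
unfold source; replace (_ - _) with (rho (t * s) / b (t * s) ^ 2 *
  (damped c (f (t * s)) - damped c (g (t * s)))) by (field; apply Rgt_not_eq, b_pos).
rewrite Rabs_mult, Rmult_assoc.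
apply Rmult_le_compat; [apply Rabs_pos | apply Rabs_pos | apply H2; lra|].
eapply Rle_trans; [apply damped_lipschitz, c_range|].
specialize (HD (t * s) Hts); lra.
Qed.

(** For a solution f of the Volterra equation, [t ^ 2 * a t * slope f t] is - A f', that is f (1 -
    u). Its first order equation is the one that yields the equation for u. *)
Lemma slope_ode f : (forall x, continuous f x) ->
  forall t, 0 < t -> is_derive (fun t => t ^ 2 * a t * slope f t) t
    (- (t ^ 2 * a t * slope f t) * (/ (t * a t) + t * ab2 t) + t * ab2 t * damped c (f t)).
Proof.
intros Hf t Ht.
set (g := fun s => - (defect s + ab2 s)).
assert (Hg : esmooth g) by
  (apply esmooth_opp, esmooth_plus; [apply defect_smooth | apply ab2_smooth]).
set (Y := fun t => t ^ 4 * Jint 3 (source f) t).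
assert (DY : is_derive Y t (t ^ 3 * source f t)) by
  (apply Jint_ftc, source_continuous, Hf).
(* The exponential cancels the one inside [rho], so the function to differentiate is a product of
   this exponential, the plain integral [Y] and 1/t^2. *)
assert (Er : forall s, exp (prim1 g s) * rho s = a s).
  intros s; unfold rho.
  unfold g; rewrite prim1_opp, exp_Ropp.
    field; apply Rgt_not_eq, exp_pos.
  intros; apply esmooth_continuous, esmooth_plus; [apply defect_smooth | apply ab2_smooth].
apply (is_derive_ext_loc (fun t => exp (prim1 g t) * Y t * / t ^ 2)).
  exists (mkposreal t Ht); intros s Hs; change (Rabs (s - t) < t) in Hs.
  apply Rabs_lt_between in Hs; unfold Y, slope; rewrite <- Er.
  assert (H := rho_pos s); real_eq; field; split; lra.
assert (D1 := exp_prim1_derive g t Hg).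
assert (D2 : is_derive (fun t => / t ^ 2) t (- 2 / t ^ 3)).
  auto_derive; [apply Rgt_not_eq; nra | cbn; field; lra].
assert (D := is_derive_Rmult _ _ _ _ _ (is_derive_Rmult _ _ _ _ _ D1 DY) D2).
match type of D with is_derive _ _ ?l => replace (_ + _) with l; [exact D|] end.
assert (Ed : defect t = (/ a t - 2) / t ^ 2) by (rewrite <- defect_eq; field; lra).
assert (Ha := a_pos t); assert (Hb := b_pos t); assert (Hr := rho_pos t).
unfold g at 1, source, slope, Y, ab2; rewrite Ed, <- (Er t).
set (e := exp _) in *; assert (He : 0 < e) by apply exp_pos.
set (J := Jint 3 _ t); field; repeat split; lra.
Qed.

(** The order matters: positivity of f uses only that the truncated term c (clamp f)^5 is
    nonnegative; then the source is nonnegative and f <= 1; only then is the truncation known to be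
    inactive, which gives the true equation and makes the nonlinearity polynomial. *)
Lemma profile_exists : exists f n : R -> R,
  esmooth f /\ esmooth n /\ f 0 = 1 /\ (forall t, 0 < f t) /\
  (forall t, is_derive f t (- (t * n t))) /\
  (forall t, 0 < t -> is_derive (fun t => t ^ 2 * a t * n t) t
    (- (t ^ 2 * a t * n t) * (/ (t * a t) + t * ab2 t) +
     t * ab2 t * (f t - c * f t ^ 5))).
Proof.
destruct (volterra_fixpoint slope slope_continuous slope_even slope_lipschitz)
  as (f & Cf & Ef & If).
assert (Cs := slope_continuous f Cf).
assert (Df : forall t, is_derive f t (- (t * slope f t))).
  intros t; apply (is_derive_ext (fun t => 1 - prim1 (slope f) t)).
    intros; symmetry; apply If.
  replace (- (t * slope f t)) with (0 - t * slope f t) by ring.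
  apply (is_derive_minus (K := R_AbsRing) (V := R_NormedModule) (fun _ => 1)).
    apply (is_derive_const (K := R_AbsRing) (V := R_NormedModule)).
  apply prim1_derive, Cs.
assert (f0 : f 0 = 1) by (rewrite If, prim1_0; ring).
assert (DW := slope_ode f Cf).
set (W := fun t => t ^ 2 * a t * slope f t) in *.
(* [exp (prim1 ab2) (f - W)] is non-decreasing, so [f - W > 0]; this makes
   [exp (prim1 defect) t^2 f] increasing, so [f > 0]. *)
assert (HfW : forall t, 0 <= t -> 0 < f t - W t).
  set (S := fun t => exp (prim1 ab2 t) * (f t - W t)).
  assert (CW : forall t, continuous W t).
    intros t; apply (continuous_Rmult (fun t => t ^ 2 * a t)); [|apply Cs].
    apply (continuous_Rmult (fun t => t ^ 2)); [apply continuous_pow|].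
    apply esmooth_continuous, a_smooth.
  assert (S0 : S 0 = 1).
    unfold S, W; rewrite prim1_0, exp_0, f0; ring.
  enough (H : forall t, 0 <= t -> 1 <= S t).
    intros t Ht; assert (H0 := H t Ht); unfold S in H0.
    assert (He := exp_pos (prim1 ab2 t)); nra.
  intros t [Ht| <-]; [|lra].
  destruct (MVT_gen S 0 t (fun t => exp (prim1 ab2 t) * (t * ab2 t * (c * clamp (f t) ^ 5))))
    as [x [Hx Ex]].
  - rewrite Rmin_left, Rmax_right by lra; intros x Hx.
    assert (D1 := exp_prim1_derive ab2 x ab2_smooth).
    assert (D2 := is_derive_minus f W x _ _ (Df x) (DW x ltac:(lra))).
    assert (D := is_derive_Rmult _ _ _ _ _ D1 D2).
    match type of D with is_derive _ _ ?l => replace (_ * _) with l; [exact D|] end.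
    change (@minus R_NormedModule) with Rminus; unfold damped, W.
    assert (Ha := a_pos x); field; split; lra.
  - intros x _; apply continuity_pt_filterlim; apply continuous_Rmult.
      apply (esmooth_continuous (fun t => exp (prim1 ab2 t))).
      apply esmooth_exp, esmooth_prim1, ab2_smooth.
    apply continuous_Rminus; auto.
  - rewrite Rmin_left, Rmax_right in Hx by lra.
    enough (0 <= exp (prim1 ab2 x) * (x * ab2 x * (c * clamp (f x) ^ 5)) * (t - 0)) by lra.
    assert (Hc := pow_unit_interval 5 _ (clamp_range (f x))).
    revert Hc; generalize (clamp (f x) ^ 5); intros p Hc; repeat apply Rmult_le_pos; try lra.
    + left; apply exp_pos.
    + left; apply a_pos.
    + left; apply Rinv_0_lt_compat, pow_lt, b_pos.
assert (Hf : forall t, 0 < t -> 0 < f t).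
  intros t Ht; set (Z := fun t => exp (prim1 defect t) * (t ^ 2 * f t)).
  destruct (MVT_cor2 Z (fun t => exp (prim1 defect t) * (t * (f t - W t) / a t)) 0 t)
    as [x [Ex Hx]]; [exact Ht| |].
  - intros x Hx; apply is_derive_Reals.
    assert (D1 := exp_prim1_derive defect x defect_smooth).
    assert (D2 : is_derive (fun t => t ^ 2) x (2 * x)) by (auto_derive; [exact I | ring]).
    assert (D := is_derive_Rmult _ _ _ _ _ D1 (is_derive_Rmult _ _ _ _ _ D2 (Df x))).
    match type of D with is_derive _ _ ?l => replace (_ * _) with l; [exact D|] end.
    replace (x * (f x - W x) / a x) with (x * (f x * / a x - x ^ 2 * slope f x)) by
      (unfold W; field; apply a_neq0).
    replace (/ a x) with (x ^ 2 * defect x + 2) by (rewrite defect_eq; ring); ring.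
  - assert (H1 : 0 < exp (prim1 defect x) * (x * (f x - W x) / a x)).
      apply Rmult_lt_0_compat; [apply exp_pos|]; apply Rdiv_lt_0_compat; [|apply a_pos].
      apply Rmult_lt_0_compat; [|apply HfW]; lra.
    assert (H2 : 0 < Z t).
      assert (Z0 : Z 0 = 0) by (unfold Z; ring).
      assert (H3 := Rmult_lt_0_compat _ _ H1 (proj2 (Rlt_0_minus _ _) Ht)); lra.
    unfold Z in H2; assert (H3 := exp_pos (prim1 defect t)); assert (H4 := pow2_gt_0 t ltac:(lra)).
    rewrite <- Rmult_assoc in H2.
    apply (Rmult_lt_reg_l (exp (prim1 defect t) * t ^ 2)); [|lra].
    apply Rmult_lt_0_compat; assumption.
assert (Hf' : forall t, 0 < f t).
  intros t; destruct (Rtotal_order t 0) as [Ht|[->|Ht]]; [|lra|auto].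
  rewrite <- Ef; apply Hf; lra.
assert (Hf1 : forall t, f t <= 1).
  intros t; rewrite If; enough (0 <= prim1 (slope f) t) by lra.
  assert (Hs : forall t, 0 <= slope f t).
    intros s; apply Rmult_le_pos; [left; apply Rinv_0_lt_compat, rho_pos|].
    apply Jint_pos; [apply source_continuous, Cf|]; intros r _.
    apply Rmult_le_pos; [|left; apply Rinv_0_lt_compat, pow_lt, b_pos].
    apply Rmult_le_pos; [left; apply rho_pos|]; apply damped_nonneg; [exact c_range|].
    left; apply Hf'.
  apply Rmult_le_pos; [apply pow2_ge_0|]; apply Jint_pos; auto.
assert (Ed : forall t, damped c (f t) = f t - c * f t ^ 5).
  intros t; unfold damped; rewrite clamp_id; [reflexivity|].
  specialize (Hf' t); specialize (Hf1 t); lra.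
(* Bootstrap: [slope] loses no derivatives and f' = - t [slope f t], so f gains one order at each
   round. *)
assert (Sn : forall k, Cn k f -> Cn k (slope f)).
  intros k Hk; apply Cn_mult; [apply inv_rho_smooth|]; apply Cn_Jint.
  apply (Cn_ext k (fun t => rho t * (f t - c * f t ^ 5) * / b t ^ 2)).
    intros t; unfold source; rewrite Ed; reflexivity.
  apply Cn_mult; [apply Cn_mult; [apply rho_smooth|]|].
  - apply Cn_minus; [exact Hk|]; apply Cn_mult; [apply Cn_const | apply Cn_pow, Hk].
  - apply (esmooth_inv (fun t => b t ^ 2)); [apply b_sqr_neq0 | apply esmooth_pow, b_smooth].
assert (Sf : forall k, Cn k f).
  induction k as [|k IH]; [split; [intros; apply Cf | exact I]|].
  apply (Cn_R_intro k f _ Df), Cn_opp, Cn_mult; [apply (Cn_id (V := R_NormedModule)) | auto].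
exists f, (slope f).
refine (conj (conj Sf Ef) (conj (conj (fun k => Sn k (Sf k)) _) (conj f0 (conj Hf' (conj Df _))))).
  intros t; apply slope_even, Ef.
intros t Ht; rewrite <- Ed; apply DW, Ht.
Qed.

End Nonlinear.

(* In terms of [u = 1 - t^2 z] and [v], with connection form
   [u T_i eta_i^+ + v T_i eta_i^-], these are the instanton equations; the
   substitution [v = v0 f^2], [1 - u = - A f' / f] turns them into
   [(mu f')' = - mu (f - v0^2 f^5) / B^2] with [mu = t^3 rho]. *)
Lemma nonflat_profiles v0 : - 1 <= v0 <= 1 -> exists z v : R -> R,
  esmooth z /\ esmooth v /\ v 0 = v0 /\
  (forall t, 0 < t -> is_derive (fun t => t ^ 2 * z t) t
    (- (1 - t ^ 2 * z t) * (t ^ 2 * z t) / (t * a t)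
     + t * ab2 t * (1 - t ^ 2 * z t - v t ^ 2))) /\
  (forall t, 0 < t -> is_derive v t (- 2 * v t * (t ^ 2 * z t) / (t * a t))).
Proof.
intros Hv; destruct (profile_exists (v0 ^ 2)) as (f & n & Sf & Sn & f0 & Pf & Df & DW).
  nra.
(* From f' = - t n and A = t a follows 1 - u = - A f'/f = t^2 (a n / f). *)
exists (fun t => a t * n t / f t), (fun t => v0 * f t ^ 2).
assert (Nf : forall t, f t <> 0) by (intros; apply Rgt_not_eq, Pf).
split; [apply esmooth_div; [exact Nf | apply esmooth_mult | ]; assumption|].
split; [apply esmooth_mult; [apply esmooth_const | apply esmooth_pow, Sf]|].
split; [rewrite f0; ring|]; split; intros t Ht; assert (Ha := a_pos t).
- apply (is_derive_ext (fun t => (t ^ 2 * a t * n t) * / f t)).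
    intros s; real_eq; field; apply Nf.
  assert (Di := is_derive_inv f t _ (Df t) (Nf t)).
  assert (D := is_derive_Rmult _ _ _ _ _ (DW t Ht) Di).
  match type of D with is_derive _ _ ?l => replace (_ + _) with l; [exact D|] end.
  assert (Pt := Pf t); field; repeat split; lra.
- assert (D := is_derive_scal _ _ v0 _ (is_derive_Rmult _ _ _ _ _ (Df t) (Df t))).
  apply (is_derive_ext (fun t => v0 * (f t * f t))); [intros; real_eq; ring|].
  match type of D with is_derive _ _ ?l => replace (_ / _) with l; [exact D|] end.
  assert (Pt := Pf t); field; repeat split; lra.
Qed.

(** Writing u = A h'/h turns the Riccati equation into h'' = F h', with F = - A'/A + 1/A - A/B^2.
    Here h = 1 + k [prim1 e t], and t e(t) solves y' = F y, starting linearly at 0; k >= 0 keeps h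
    positive. *)
Lemma flat_profile k : 0 <= k ->
  let e t := exp (prim1 (fun t => defect t - Dq a t / a t - ab2 t) t) in
  let U t := k * a t * e t / (1 + k * prim1 e t) in
  esmooth U /\
  forall t, 0 < t -> is_derive (fun t => t ^ 2 * U t) t
    (t ^ 2 * U t * (1 - t ^ 2 * U t) / (t * a t) - t * ab2 t * (t ^ 2 * U t)).
Proof.
intros Hk e U; set (g := fun t => defect t - Dq a t / a t - ab2 t) in e.
assert (Sg : esmooth g).
  apply esmooth_minus; [apply esmooth_minus; [apply defect_smooth|]|apply ab2_smooth].
  apply esmooth_div; [apply a_neq0 | apply esmooth_Dq, a_smooth | exact a_smooth].
assert (Se : esmooth e) by (apply esmooth_exp, esmooth_prim1, Sg).
assert (Ne : forall t, 0 < 1 + k * prim1 e t).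
  intros t; enough (0 <= k * prim1 e t) by lra; apply Rmult_le_pos; [exact Hk|].
  apply Rmult_le_pos; [apply pow2_ge_0|]; apply Jint_pos.
    intros; apply esmooth_continuous, Se.
  intros; left; apply exp_pos.
split.
  apply esmooth_div; [intros; apply Rgt_not_eq, Ne| |].
    apply esmooth_mult; [apply esmooth_mult; [apply esmooth_const | exact a_smooth] | exact Se].
  apply esmooth_plus; [apply esmooth_const|].
  apply esmooth_mult; [apply esmooth_const | apply esmooth_prim1, Se].
intros t Ht.
assert (D1 := is_derive_Rmult _ _ _ _ _ (is_derive_esmooth a t a_smooth)
  (exp_prim1_derive g t Sg)).
assert (D2 : is_derive (fun t => t ^ 2) t (2 * t)) by (auto_derive; [exact I | ring]).
assert (D3 : is_derive (fun t => 1 + k * prim1 e t) t (0 + k * (t * e t))).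
  apply (is_derive_plus (K := R_AbsRing) (V := R_NormedModule) (fun _ => 1)).
    apply (is_derive_const (K := R_AbsRing) (V := R_NormedModule)).
  apply is_derive_scal, prim1_derive; intros; apply esmooth_continuous, Se.
assert (Nt := Ne t).
assert (D4 := is_derive_inv _ t _ D3 (Rgt_not_eq _ _ Nt)).
assert (D := is_derive_scal _ _ k _
  (is_derive_Rmult _ _ _ _ _ D2 (is_derive_Rmult _ _ _ _ _ D1 D4))).
eapply is_derive_ext; [|match type of D with is_derive _ _ ?l => replace (_ - _) with l; [exact D|] end].
  intros s; real_eq; unfold U; fold (e s); field; apply Rgt_not_eq, Ne.
assert (Ed : defect t = (/ a t - 2) / t ^ 2) by (rewrite <- defect_eq; field; lra).
assert (Ha := a_pos t); unfold U; fold (e t); unfold g at 1; rewrite Ed.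
field; repeat split; lra.
Qed.
End Profiles.

(** * The first family in terms of its explicit integrals *)

Section ExplicitFamily.
Variables A1 B1 a b : R -> R.
Hypothesis a_smooth : esmooth a.
Hypothesis b_smooth : esmooth b.
Hypothesis a_pos : forall t, 0 < a t.
Hypothesis b_pos : forall t, 0 < b t.
Hypothesis a_0 : a 0 = 1 / 2.
Hypothesis A1_a : forall t, 0 <= t -> A1 t = t * a t.
Hypothesis B1_b : forall t, 0 <= t -> B1 t = b t.

(** F has a simple pole with residue 1 at 0: - A1'/A1 contributes - 1/t and 1/A1 contributes 2/t.
    All the rest is t times an even function. *)
Lemma F_regular t : 0 < t ->
  F_ A1 B1 t = / t + t * (defect a t - Dq a t / a t - ab2 a b t).
Proof.
intros Ht.
assert (D : is_derive A1 t (a t + t * (t * Dq a t))).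
  apply (is_derive_ext_loc (fun t => t * a t)).
    exists (mkposreal t Ht); intros s Hs; change (Rabs (s - t) < t) in Hs.
    apply Rabs_lt_between in Hs; symmetry; apply A1_a; lra.
  replace (a t + t * (t * Dq a t)) with (1 * a t + t * (t * Dq a t)) by ring.
  apply (is_derive_Rmult (fun t => t)); [apply (is_derive_id (K := R_AbsRing))|].
  apply is_derive_esmooth, a_smooth.
unfold F_; rewrite (is_derive_unique _ _ _ D), A1_a, B1_b by lra.
assert (Ed : defect a t = (/ a t - 2) / t ^ 2).
  rewrite <- (defect_eq a); auto; field; lra.
assert (Ha := a_pos t); assert (Hb := b_pos t); rewrite Ed; unfold ab2.
field; repeat split; lra.
Qed.

Let g t := defect a t - Dq a t / a t - ab2 a b t.
Let e t := exp (prim1 g t).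
(** Normalisation at t = 1/2, where the exponential of the integral of F is 1; the factor 2 is the
    reciprocal of that base point. *)
Let C := 2 * exp (- prim1 g (1 / 2)).

Lemma g_smooth : esmooth g.
Proof.
apply esmooth_minus; [apply esmooth_minus|apply ab2_smooth; assumption].
  apply defect_smooth; assumption.
apply esmooth_div; [intros; apply a_neq0, a_pos | apply esmooth_Dq, a_smooth | exact a_smooth].
Qed.

Lemma expF_regular t : 0 < t -> expF A1 B1 t = C * (t * e t).
Proof.
intros Ht; unfold expF.
assert (H : forall s, Rmin (1 / 2) t <= s -> 0 < s).
  intros s Hs; assert (0 < Rmin (1 / 2) t) by (apply Rmin_pos; lra); lra.
assert (E : is_RInt (F_ A1 B1) (1 / 2) t
  (minus (ln t + prim1 g t) (ln (1 / 2) + prim1 g (1 / 2)))).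
  apply (is_RInt_ext (fun s => / s + s * g s)).
    intros s Hs; symmetry; apply F_regular, H; lra.
  apply (is_RInt_derive (V := R_CompleteNormedModule) (fun s => ln s + prim1 g s)).
  - intros s Hs; apply (is_derive_plus (K := R_AbsRing) (V := R_NormedModule)).
      apply is_derive_ln, H, Hs.
    apply prim1_derive; intros; apply esmooth_continuous, g_smooth.
  - intros s Hs; specialize (H s (proj1 Hs)); apply continuous_Rplus.
      apply continuous_Rinv; lra.
    apply (continuous_Rmult (fun s => s)); [apply continuous_id|].
    apply esmooth_continuous, g_smooth.
rewrite (is_RInt_unique _ _ _ _ E).
change (exp (ln t + prim1 g t - (ln (1 / 2) + prim1 g (1 / 2))) = C * (t * e t)).
replace (1 / 2) with (/ 2) at 1 by field; rewrite ln_Rinv by lra.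
replace (ln t + prim1 g t - (- ln 2 + prim1 g (1 / 2))) with
  (ln t + ln 2 + (prim1 g t + - prim1 g (1 / 2))) by ring.
rewrite !exp_plus, !exp_ln by lra; unfold C, e; ring.
Qed.

Lemma RInt_expF t : 0 < t -> RInt (expF A1 B1) 0 t = C * prim1 e t.
Proof.
intros Ht; apply is_RInt_unique.
assert (Se : esmooth e) by (apply esmooth_exp, esmooth_prim1, g_smooth).
(* Agreement on the open interval suffices, so the value at 0 does not enter. *)
apply (is_RInt_ext (fun s => C * (s * e s))).
  intros s; rewrite Rmin_left, Rmax_right by lra; intros Hs; symmetry; apply expF_regular; lra.
replace (C * prim1 e t) with (minus (C * prim1 e t) (C * prim1 e 0)).
  apply (is_RInt_derive (V := R_CompleteNormedModule) (fun s => C * prim1 e s)).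
    intros s _; apply is_derive_scal, prim1_derive; intros; apply esmooth_continuous, Se.
  intros s _; apply (continuous_Rmult (fun _ => C)); [apply continuous_const|].
  apply (continuous_Rmult (fun s => s)); [apply continuous_id|].
  apply esmooth_continuous, Se.
rewrite prim1_0; change (C * prim1 e t - C * 0 = C * prim1 e t); ring.
Qed.

Lemma explicit_profile x1 : 0 <= x1 -> exists U, esmooth U /\
  (forall t, 0 < t ->
     x1 * A1 t * expF A1 B1 t / (1 + x1 * RInt (expF A1 B1) 0 t) = t ^ 2 * U t) /\
  forall t, 0 < t -> is_derive (fun t => t ^ 2 * U t) t
    (t ^ 2 * U t * (1 - t ^ 2 * U t) / (t * a t) - t * ab2 a b t * (t ^ 2 * U t)).
Proof.
intros Hx.
assert (HC : 0 < C) by (apply Rmult_lt_0_compat; [lra | apply exp_pos]).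
assert (Hk : 0 <= x1 * C) by (apply Rmult_le_pos; lra).
(* The normalisation constant [C] of [expF] is absorbed into the parameter k = x1 C. *)
destruct (flat_profile a b a_smooth b_smooth a_pos b_pos a_0 (x1 * C) Hk) as [SU DU].
eexists; split; [exact SU|split; [|exact DU]].
intros t Ht; rewrite expF_regular, RInt_expF, A1_a by lra.
change (x1 * (t * a t) * (C * (t * e t)) / (1 + x1 * (C * prim1 e t)) =
  t ^ 2 * (x1 * C * a t * e t / (1 + x1 * C * prim1 e t))).
rewrite (Rmult_assoc x1 C (prim1 e t)); unfold Rdiv; ring.
Qed.
End ExplicitFamily.

(** * Exterior algebra at a point *)

Section ExteriorAlgebra.
Context {X : Type}.

(** The product [wedge] at a fixed base point, over an arbitrary type of vectors: the identities
    below are combinatorics of shuffles, without multilinearity. *)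
Definition pwedge {W : NormedModule R_AbsRing} (k : nat) (a : list X -> W)
  (b : list X -> R) (l : list X) : W :=
  fold_right (fun '(s, x, y) r => plus (scal (s * b y) (a x)) r) zero (shuffles k l).

Lemma shuffles_short k (l : list X) : (length l < k)%nat -> shuffles k l = [].
Proof.
revert k; induction l as [|v l IH]; intros [|k] H; cbn in *; try lia; [reflexivity|].
rewrite !IH by lia; reflexivity.
Qed.

(** In a wedge product only lists of the right length, made of the given vectors, are ever
    evaluated. This allows replacing forms by expressions that agree with them on tangent vectors
    only. *)
Lemma shuffles_spec k (l : list X) s x y : In (s, x, y) (shuffles k l) ->
  length x = k /\ incl x l /\ length y = (length l - k)%nat /\ incl y l.
Proof.
revert k s x y; induction l as [|v l IH]; intros [|k] s x y Hi; cbn in Hi.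
  - destruct Hi as [E|[]]; injection E as <- <- <-; repeat split; auto using incl_nil_l, incl_refl.
  - destruct Hi.
  - destruct Hi as [E|[]]; injection E as <- <- <-; repeat split; auto using incl_nil_l, incl_refl.
  - apply in_app_or in Hi; destruct Hi as [Hi|Hi]; apply in_map_iff in Hi;
      destruct Hi as [[[s' x'] y'] [E Hi]]; injection E as <- <- <-.
    + destruct (IH _ _ _ _ Hi) as (H1 & H2 & H3 & H4); cbn; rewrite H1, H3.
      repeat split; auto; [|intros z Hz; right; auto].
      intros z [->|Hz]; [left; reflexivity | right; auto].
    + assert (Hle : (S k <= length l)%nat).
        destruct (Nat.le_gt_cases (S k) (length l)) as [|Hl]; [assumption|exfalso].
        rewrite shuffles_short in Hi by exact Hl; destruct Hi.
      destruct (IH _ _ _ _ Hi) as (H1 & H2 & H3 & H4); cbn [length]; rewrite H1, H3.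
      repeat split; auto; [intros z Hz; right; auto|lia|].
      intros z [->|Hz]; [left; reflexivity | right; auto].
Qed.

Lemma pwedge_ext {W : NormedModule R_AbsRing} k (a a' : list X -> W) b b' l :
  (forall x y, length x = k -> incl x l -> length y = (length l - k)%nat -> incl y l ->
    a x = a' x /\ b y = b' y) ->
  pwedge k a b l = pwedge k a' b' l.
Proof.
intros H; unfold pwedge.
assert (Hs := shuffles_spec k l).
revert Hs; induction (shuffles k l) as [|[[s x] y] L IH]; intros Hs;
  [reflexivity|]; cbn.
destruct (Hs s x y (or_introl eq_refl)) as (H1 & H2 & H3 & H4).
destruct (H x y H1 H2 H3 H4) as [-> ->].
f_equal; apply IH; intros; apply (Hs s0); right; assumption.
Qed.

Lemma pwedge_0 {W : NormedModule R_AbsRing} (a : list X -> W) b l :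
  pwedge 0 a b l = scal (b l) (a []).
Proof.
unfold pwedge; destruct l; cbn [shuffles fold_right]; rewrite plus_zero_r, Rmult_1_l; reflexivity.
Qed.

(** The antiderivation rule for the interior product with the first vector; it drives all inductions
    on the list of arguments. *)
Lemma pwedge_cons {W : NormedModule R_AbsRing} k (a : list X -> W) b v l :
  pwedge (S k) a b (v :: l) =
  plus (pwedge k (fun x => a (v :: x)) b l)
    (scal ((- 1) ^ S k) (pwedge (S k) a (fun y => b (v :: y)) l)).
Proof.
unfold pwedge; cbn [shuffles]; rewrite fold_right_app.
set (z := fold_right _ zero (map _ (shuffles (S k) l))).
assert (Ez : z = scal ((- 1) ^ S k) (fold_right
  (fun '(s, x, y) r => plus (scal (s * b (v :: y)) (a x)) r) zero (shuffles (S k) l))).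
  unfold z; induction (shuffles (S k) l) as [|[[s x] y] L IH]; cbn [map fold_right].
    symmetry; apply (scal_zero_r ((- 1) ^ S k)).
  rewrite IH; etransitivity; [|symmetry; apply (scal_distr_l ((- 1) ^ S k))].
  f_equal; rewrite scal_assoc; f_equal; apply Rmult_assoc.
rewrite <- Ez; clearbody z; clear Ez.
induction (shuffles k l) as [|[[s x] y] L IH]; cbn [map fold_right].
  symmetry; apply plus_zero_l.
rewrite IH, plus_assoc; reflexivity.
Qed.

Lemma pwedge_plus_l {W : NormedModule R_AbsRing} k (a a' : list X -> W) b l :
  pwedge k (fun x => plus (a x) (a' x)) b l = plus (pwedge k a b l) (pwedge k a' b l).
Proof.
unfold pwedge; induction (shuffles k l) as [|[[s x] y] L IH]; cbn [fold_right].
  symmetry; apply plus_zero_l.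
rewrite IH.
assert (E : scal (s * b y) (plus (a x) (a' x)) =
  plus (scal (s * b y) (a x)) (scal (s * b y) (a' x))) by
  exact (scal_distr_l (V := NormedModule.ModuleSpace R_AbsRing W) _ _ _).
rewrite E, <- !plus_assoc; f_equal; rewrite !plus_assoc; f_equal; apply plus_comm.
Qed.

Lemma pwedge_scal_l {W : NormedModule R_AbsRing} k (a : list X -> R) (q : W) b l :
  pwedge k (fun x => scal (a x) q) b l = scal (pwedge k a b l) q.
Proof.
unfold pwedge; induction (shuffles k l) as [|[[s x] y] L IH]; cbn [fold_right].
  symmetry; apply (scal_zero_l q).
rewrite IH.
assert (E : forall u v : R, scal (plus u v) q = plus (scal u q) (scal v q)) by
  exact (fun u v => scal_distr_r (V := NormedModule.ModuleSpace R_AbsRing W) u v q).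
etransitivity; [|symmetry; apply E]; f_equal; rewrite scal_assoc; reflexivity.
Qed.

Notation covector := (X -> R).

Definition one_form (al : covector) (l : list X) : R :=
  match l with [v] => al v | _ => 0 end.

Definition unit_form (l : list X) : R := match l with [] => 1 | _ => 0 end.

Definition covwedge (al : covector) (b : list X -> R) : list X -> R :=
  pwedge (W := R_NormedModule) 1 (one_form al) b.

Definition fadd (b c : list X -> R) (l : list X) : R := b l + c l.
Definition fscal (x : R) (b : list X -> R) (l : list X) : R := x * b l.

Lemma covwedge_cons al b v l :
  covwedge al b (v :: l) = al v * b l - covwedge al (fun y => b (v :: y)) l.
Proof.
unfold covwedge; rewrite pwedge_cons, pwedge_0.
set (z := pwedge _ _ _ l); change (b l * al v + (- 1) * 1 * z = al v * b l - z); ring.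
Qed.

Lemma covwedge_nil al b : covwedge al b [] = 0.
Proof. reflexivity. Qed.

Lemma covwedge_add al b c : covwedge al (fadd b c) = fadd (covwedge al b) (covwedge al c).
Proof.
apply functional_extensionality; intros l; revert b c.
induction l as [|v l IH]; intros b c; unfold fadd at 2; [rewrite !covwedge_nil; ring|].
rewrite !covwedge_cons.
change (fun y => fadd b c (v :: y)) with (fadd (fun y => b (v :: y)) (fun y => c (v :: y))).
rewrite IH.
unfold fadd; ring.
Qed.

Lemma covwedge_scal al x b : covwedge al (fscal x b) = fscal x (covwedge al b).
Proof.
apply functional_extensionality; intros l; revert b.
induction l as [|v l IH]; intros b; unfold fscal at 2; [rewrite !covwedge_nil; ring|].
rewrite !covwedge_cons.
change (fun y => fscal x b (v :: y)) with (fscal x (fun y => b (v :: y))); rewrite IH.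
unfold fscal; ring.
Qed.

Lemma covwedge_cons_fun al b v :
  (fun l => covwedge al b (v :: l)) = fadd (fscal (al v) b) (fscal (- 1) (covwedge al (fun y => b (v :: y)))).
Proof.
apply functional_extensionality; intros l; rewrite covwedge_cons; unfold fadd, fscal; ring.
Qed.

(** Anticommutation of left multiplications by covectors, for arbitrary functions [c] of lists,
    alternating or not: contracting with one more vector reduces both sides to shorter lists. *)
Lemma covwedge_swap al be c : covwedge al (covwedge be c) = fscal (- 1) (covwedge be (covwedge al c)).
Proof.
apply functional_extensionality; intros l; revert c.
induction l as [|v l IH]; intros c; unfold fscal; [rewrite !covwedge_nil; ring|].
rewrite !covwedge_cons, !covwedge_cons_fun, !covwedge_add, !covwedge_scal.
unfold fadd, fscal; rewrite IH; unfold fscal; ring.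
Qed.

Lemma covwedge_same al c : covwedge al (covwedge al c) = fun _ => 0.
Proof.
apply functional_extensionality; intros l.
assert (H := f_equal (fun f => f l) (covwedge_swap al al c)); cbn beta in H.
unfold fscal in H; lra.
Qed.

Lemma covwedge_0 al : covwedge al (fun _ => 0) = fun _ => 0.
Proof.
apply functional_extensionality; intros l; induction l as [|v l IH]; [reflexivity|].
rewrite covwedge_cons, IH; ring.
Qed.

Lemma covwedge_one al : covwedge al unit_form = one_form al.
Proof.
apply functional_extensionality; intros [|v [|w l]]; [reflexivity|..]; rewrite covwedge_cons.
  cbn; ring.
change (fun y => unit_form (v :: y)) with (fun _ : list X => 0); rewrite covwedge_0; cbn; ring.
Qed.

(** This instance of associativity replaces products with two-forms by repeated left multiplication
    with covectors, so that every form becomes a combination of words in covectors. *)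
Lemma pwedge_covwedge al be c l :
  pwedge (W := R_NormedModule) 2 (covwedge al (one_form be)) c l = covwedge al (covwedge be c) l.
Proof.
revert c; induction l as [|v l IH]; intros c; [reflexivity|].
rewrite pwedge_cons, IH, covwedge_cons, (covwedge_cons_fun be c v), covwedge_add, !covwedge_scal.
assert (E : (fun x => covwedge al (one_form be) (v :: x)) =
  fadd (fscal (al v) (one_form be)) (fscal (- be v) (one_form al))).
  rewrite covwedge_cons_fun; f_equal.
  replace (fun y => one_form be (v :: y)) with (fscal (be v) unit_form).
    rewrite covwedge_scal, covwedge_one; apply functional_extensionality; intros x.
    unfold fscal; ring.
  apply functional_extensionality; intros [|w x]; unfold fscal; cbn; ring.
rewrite E.
assert (E2 : pwedge (W := R_NormedModule) 1
  (fadd (fscal (al v) (one_form be)) (fscal (- be v) (one_form al))) c l =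
  al v * covwedge be c l + - be v * covwedge al c l).
  etransitivity; [apply (pwedge_plus_l (W := R_NormedModule))|].
  assert (H := fun x (g : covector) => pwedge_scal_l (W := R_NormedModule) 1 (one_form g) x c l).
  rewrite <- (Rmult_comm (covwedge be c l)), <- (Rmult_comm (covwedge al c l)).
  unfold covwedge; apply (f_equal2 Rplus); (etransitivity; [|apply H]); unfold fscal;
  do 2 f_equal; apply functional_extensionality; intros x; apply Rmult_comm.
rewrite E2; unfold fadd, fscal.
set (z := covwedge al (covwedge be (fun y => c (v :: y))) l).
change (al v * covwedge be c l + - be v * covwedge al c l + - 1 * (- 1 * 1) * z =
  al v * covwedge be c l - (be v * covwedge al c l + - 1 * z)); ring.
Qed.


Lemma fscal_0 x : fscal x (fun _ => 0) = fun _ => 0.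
Proof. apply functional_extensionality; intros l; unfold fscal; ring. Qed.

Lemma pwedge2_add a a' c :
  pwedge (W := R_NormedModule) 2 (fadd a a') c = fadd (pwedge 2 a c) (pwedge 2 a' c).
Proof.
apply functional_extensionality; intros l; exact (pwedge_plus_l (W := R_NormedModule) 2 a a' c l).
Qed.

Lemma pwedge2_scal x a c :
  pwedge (W := R_NormedModule) 2 (fscal x a) c = fscal x (pwedge 2 a c).
Proof.
apply functional_extensionality; intros l; unfold fscal.
rewrite (Rmult_comm x); etransitivity; [|exact (pwedge_scal_l (W := R_NormedModule) 2 a x c l)].
f_equal; apply functional_extensionality; intros; apply Rmult_comm.
Qed.

Lemma pwedge2_covwedge al be c :
  pwedge (W := R_NormedModule) 2 (covwedge al (one_form be)) c = covwedge al (covwedge be c).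
Proof. apply functional_extensionality; intros; apply pwedge_covwedge. Qed.

(** * The instanton equation as an identity between words in seven covectors *)

Variables t m1 p1 m2 p2 m3 p3 : covector.

Definition fadd3 (f g h : list X -> R) := fadd (fadd f g) h.

Definition omega_at (A B : R) : list X -> R :=
  fscal 4 (fadd3 (fscal (A * B) (covwedge m1 (one_form p1)))
                 (fscal (A * B) (covwedge m2 (one_form p2)))
                 (fscal (A * B) (covwedge m3 (one_form p3)))).

Definition Omega2_at (A B : R) : list X -> R :=
  fadd (fscal (- 8 * A * A * A) (covwedge p1 (covwedge p2 (one_form p3))))
       (fscal 8 (fadd3 (fscal (B * B * A) (covwedge m1 (covwedge m2 (one_form p3))))
                       (fscal (B * B * A) (covwedge m2 (covwedge m3 (one_form p1))))
                       (fscal (B * B * A) (covwedge m3 (covwedge m1 (one_form p2)))))).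

Definition psi_at (A B : R) : list X -> R :=
  fadd (fscal (/ 2) (pwedge 2 (omega_at A B) (omega_at A B))) (fscal (- 1) (covwedge t (Omega2_at A B))).

(* the [T_k]-component, for cyclic [(i, j, k)], of the curvature of
   [u T_k eta_k^+ + v T_k eta_k^-] *)
Definition curv2 (mi pi mj pj mk pk : covector) (u v du dv : R) : list X -> R :=
  fadd (fadd3 (fscal du (covwedge t (one_form pk))) (fscal dv (covwedge t (one_form mk)))
              (fscal (2 * (u ^ 2 - u)) (covwedge pi (one_form pj))))
       (fadd3 (fscal (2 * (v ^ 2 - u)) (covwedge mi (one_form mj)))
              (fscal (2 * (u * v - v)) (covwedge pi (one_form mj)))
              (fscal (2 * (u * v - v)) (covwedge mi (one_form pj)))).

Lemma wedge_omega_at A B c : pwedge (W := R_NormedModule) 2 (omega_at A B) c =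
  fscal (4 * (A * B)) (fadd3 (covwedge m1 (covwedge p1 c)) (covwedge m2 (covwedge p2 c)) (covwedge m3 (covwedge p3 c))).
Proof.
unfold omega_at, fadd3; rewrite ?pwedge2_scal, ?pwedge2_add, ?pwedge2_scal, ?pwedge2_covwedge.
apply functional_extensionality; intros l; real_eq; unfold fadd, fscal; ring.
Qed.

(** Brings every word to the order t, m1, p1, m2, p2, m3, p3 and deletes words with a repeated
    letter. In this normal form an equality of forms is an identity of coefficients. *)
Ltac sort_covwedge := repeat progress
  (rewrite ?(covwedge_swap m1 t), ?(covwedge_swap p1 t), ?(covwedge_swap m2 t), ?(covwedge_swap p2 t),
     ?(covwedge_swap m3 t), ?(covwedge_swap p3 t), ?(covwedge_swap p1 m1), ?(covwedge_swap m2 m1),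
     ?(covwedge_swap p2 m1), ?(covwedge_swap m3 m1), ?(covwedge_swap p3 m1), ?(covwedge_swap m2 p1),
     ?(covwedge_swap p2 p1), ?(covwedge_swap m3 p1), ?(covwedge_swap p3 p1), ?(covwedge_swap p2 m2),
     ?(covwedge_swap m3 m2), ?(covwedge_swap p3 m2), ?(covwedge_swap m3 p2), ?(covwedge_swap p3 p2),
     ?(covwedge_swap p3 m3), ?covwedge_same, ?covwedge_scal, ?covwedge_0, ?fscal_0).

Ltac expand_covwedge := unfold psi_at, curv2; rewrite wedge_omega_at; unfold omega_at, Omega2_at, fadd3;
  rewrite <- ?covwedge_one; repeat progress
  (rewrite ?pwedge2_add, ?pwedge2_scal, ?pwedge2_covwedge, ?covwedge_add, ?covwedge_scal, ?covwedge_one);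
  rewrite <- ?covwedge_one.

(** A six-form in seven covectors is spanned by words missing one letter. For the k-th component
    only the words without mk and without pk survive; their coefficients vanish by the equations for
    u and v respectively. *)
Lemma instanton_components A B u v du dv :
  A <> 0 -> B <> 0 ->
  du = (u - u ^ 2) / A + A / B ^ 2 * (v ^ 2 - u) -> dv = 2 / A * v * (u - 1) ->
  forall l,
  pwedge (W := R_NormedModule) 2 (curv2 m2 p2 m3 p3 m1 p1 u v du dv) (psi_at A B) l = 0 /\
  pwedge (W := R_NormedModule) 2 (curv2 m3 p3 m1 p1 m2 p2 u v du dv) (psi_at A B) l = 0 /\
  pwedge (W := R_NormedModule) 2 (curv2 m1 p1 m2 p2 m3 p3 u v du dv) (psi_at A B) l = 0.
Proof.
intros HA HB Hu Hv l; repeat split; expand_covwedge; sort_covwedge; real_eq;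
  unfold fadd, fscal; rewrite Hu, Hv; field; auto.
Qed.

End ExteriorAlgebra.

(** * Connections *)

Ltac qring := intros;
  repeat match goal with x : ?A |- _ => unify A quat; destruct x as [[[? ?] ?] ?] end;
  cbv -[Rplus Rmult Ropp Rminus Rinv Rdiv IZR]; qsplit; real_eq; try first [ring | field].

(** Projecting to the imaginary part makes the potentials su(2)-valued on the whole ambient space,
    not only on tangent vectors. *)
Definition qim (x : quat) : quat := scal (1 / 2) (minus x (qconj x)).

Lemma qim_coord x : qim x = (0, q1 x, q2 x, q3 x).
Proof. qring. Qed.

Lemma qmul_plus_l x y z : plus x y ** z = plus (x ** z) (y ** z).
Proof. qring. Qed.

Lemma qmul_plus_r x y z : x ** plus y z = plus (x ** y) (x ** z).
Proof. qring. Qed.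

Lemma qmul_scal_l (k : R) x y : scal k x ** y = scal k (x ** y).
Proof. qring. Qed.

Lemma qmul_scal_r (k : R) x y : x ** scal k y = scal k (x ** y).
Proof. qring. Qed.

Section LinearMaps.
Context {V W X : NormedModule R_AbsRing}.

Lemma is_linear_fst_comp (l : V -> W * X) : is_linear l -> is_linear (fun x => fst (l x)).
Proof. intros H; exact (is_linear_comp l fst H is_linear_fst). Qed.

Lemma is_linear_snd_comp (l : V -> W * X) : is_linear l -> is_linear (fun x => snd (l x)).
Proof. intros H; exact (is_linear_comp l snd H is_linear_snd). Qed.

Lemma Cn_fst n (f : V -> W * X) : Cn n f -> Cn n (fun x => fst (f x)).
Proof. exact (Cn_linear_comp n fst f is_linear_fst). Qed.

Lemma Cn_snd n (f : V -> W * X) : Cn n f -> Cn n (fun x => snd (f x)).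
Proof. exact (Cn_linear_comp n snd f is_linear_snd). Qed.

End LinearMaps.

Lemma Cn_qim {V : NormedModule R_AbsRing} n (f : V -> quat) :
  Cn n f -> Cn n (fun x => qim (f x)).
Proof.
intros Hf; apply (Cn_ext n _ _ (fun x => eq_sym (qim_coord (f x)))).
destruct (Cn_quat_elim n f Hf) as (? & ? & ? & ?).
apply Cn_quat_intro; try assumption; apply Cn_const.
Qed.

Lemma Cn_qopp {V : NormedModule R_AbsRing} n (f : V -> quat) :
  Cn n f -> Cn n (fun x => opp (f x)).
Proof. exact (Cn_linear_comp n opp f is_linear_opp). Qed.

Ltac smooth := repeat match goal with
  | |- is_linear (fun x => fst _) => apply is_linear_fst_comp
  | |- is_linear (fun x => snd _) => apply is_linear_snd_comp
  | |- is_linear (fun x => x) => apply is_linear_id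
  | |- is_linear fst => apply is_linear_fst
  | |- is_linear snd => apply is_linear_snd
  | |- Cn _ fst => apply Cn_linear, is_linear_fst
  | |- Cn _ snd => apply Cn_linear, is_linear_snd
  | |- Cn _ (fun x => x) => apply Cn_id
  | |- Cn _ (fun x => fst _) => apply Cn_fst
  | |- Cn _ (fun x => snd _) => apply Cn_snd
  | |- Cn _ (fun x => qconj _) => apply Cn_qconj
  | |- Cn _ (fun x => qim _) => apply Cn_qim
  | |- Cn _ (fun x => opp _) => apply Cn_qopp
  | |- Cn _ (fun x => _ ** _) => apply Cn_qmul
  | |- Cn _ (fun x => qdot _ _) => apply Cn_qdot
  | |- Cn _ (fun x => _ * _) => apply Cn_mult
  | |- Cn _ (fun x => plus _ _) => apply Cn_qplus
  | |- Cn _ (fun x => scal _ _) => apply Cn_qscal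
  | |- Cn _ (fun x => (_, _)) => apply Cn_pair
  | |- Cn _ (fun x => ?f (qabs _)) => apply Cn_radial
  | |- Cn _ (fun x => ?c) => apply Cn_const
  end.

Lemma smooth_on_Cn {V W : NormedModule R_AbsRing} (S : V -> Prop) (f : V -> W) :
  (forall n, Cn n f) -> smooth_on S f.
Proof.
intros H x _; exists (fun _ => True), f; repeat split; auto.
apply open_true.
Qed.

(* The potentials in the global section [m |-> (m, 1)].  On [M0], with [r = |p|], [potential_P1 U]
   is [r^2 U T_i eta_i^+] on [P_1], and [potential_Pid Z Y] is the gauge transform by [a1] of
   [u T_i eta_i^+ + v T_i eta_i^-] on [P_id], where [u = 1 + r^2 Z] and [v = u + 2 Y]. *)
Definition potential_P1 (U : R -> R) (m v : HH) : quat :=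
  scal (U (qabs (fst m)))
    (plus (qim (qconj (fst m) ** fst v))
      (scal (- (1 / 2)) (qconj (fst m) ** qim (snd v ** qconj (snd m)) ** fst m))).

Definition potential_Pid (Z Y : R -> R) (m v : HH) : quat :=
  plus (scal (Z (qabs (fst m))) (qim (fst v ** qconj (fst m))))
       (scal (Y (qabs (fst m))) (qim (snd v ** qconj (snd m)))).

(** The usual formula u^-1 al u + u^-1 du for a connection form with potential [al], at the point
    (m, u) of the trivialised bundle. *)
Definition conn (al : HH -> HH -> quat) (z w : PP) : quat :=
  plus (qconj (snd z) ** al (fst z) (fst w) ** snd z) (qconj (snd z) ** snd w).

Lemma conn_smooth_connection al :
  (forall n, Cn n (fun zw : PP * PP => al (fst (fst zw)) (fst (snd zw)))) ->
  (forall m (c : R) v v', al m (plus (scal c v) v') = plus (scal c (al m v)) (al m v')) ->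
  (forall m v, su2 (al m v)) ->
  smooth_connection (conn al).
Proof.
intros Hs Hl Hi; split; [|split; [|split; [|split]]].
- apply smooth_on_Cn; intros n; unfold conn; smooth; apply Hs.
- intros [m u] [v w] [_ Hu] [_ Hw]; unfold conn, su2 in *; cbn [fst snd] in *.
  specialize (Hi m v); revert Hi Hw; generalize (al m v); clear.
  rewrite !qdot_coord, !qmul_coord, !qconj_coord.
  intros x; unfold qone, q0, q1, q2, q3; cbn [fst snd].
  destruct x as [[[x0 x1] x2] x3], u as [[[u0 u1] u2] u3], w as [[[w0 w1] w2] w3].
  unfold qdot; cbv -[Rplus Rmult Ropp Rminus IZR]; intros Hx Hw.
  replace x0 with 0 by lra; match type of Hw with ?a = _ => transitivity a end;
    [ring | exact Hw].
- intros [m u] [v w] [v' w'] c _ _ _; unfold conn; cbn [fst snd].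
  change (fst (plus (scal c (v, w)) (v', w'))) with (plus (scal c v) v').
  change (snd (plus (scal c (v, w)) (v', w'))) with (plus (scal c w) w').
  rewrite Hl; generalize (al m v) (al m v'); clear; qring.
- intros m u xi [_ Hu] _; unfold conn; cbn [fst snd] in *.
  assert (Ez : al m zero = zero).
    assert (E := Hl m (- (1)) zero zero).
    assert (E0 : plus (scal (- (1)) zero) zero = (zero : HH)) by
      (repeat apply injective_projections; cbv -[Rplus Rmult Ropp IZR]; ring).
    rewrite E0 in E; rewrite E; generalize (al m zero); clear; qring.
  rewrite Ez, qmulA, qconj_mul_self, qmul1l by exact Hu.
  generalize u; clear; qring.
- intros m u v w g _ _ _; unfold conn; cbn [fst snd].
  generalize (al m v); clear; qring.
Qed.

(** * Derivatives of quaternion-valued curves *)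

Lemma is_derive_q (f : R -> quat) x l : is_derive f x l ->
  is_derive (fun s => q0 (f s)) x (q0 l) /\ is_derive (fun s => q1 (f s)) x (q1 l) /\
  is_derive (fun s => q2 (f s)) x (q2 l) /\ is_derive (fun s => q3 (f s)) x (q3 l).
Proof.
intros H; refine (conj _ (conj _ (conj _ _))).
- exact (is_derive_linear_comp _ f x l is_linear_q0 H).
- exact (is_derive_linear_comp _ f x l is_linear_q1 H).
- exact (is_derive_linear_comp _ f x l is_linear_q2 H).
- exact (is_derive_linear_comp _ f x l is_linear_q3 H).
Qed.

Lemma is_derive_quat_intro (f0 f1 f2 f3 : R -> R) x l0 l1 l2 l3 :
  is_derive f0 x l0 -> is_derive f1 x l1 -> is_derive f2 x l2 -> is_derive f3 x l3 ->
  is_derive (fun s => (f0 s, f1 s, f2 s, f3 s) : quat) x (l0, l1, l2, l3).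
Proof.
intros H0 H1 H2 H3.
apply (is_derive_pair (fun s => (f0 s, f1 s, f2 s)) f3); [|exact H3].
apply (is_derive_pair (fun s => (f0 s, f1 s)) f2); [|exact H2].
apply (is_derive_pair f0 f1); assumption.
Qed.

Lemma is_derive_Rplus (f g : R -> R) x df dg :
  is_derive f x df -> is_derive g x dg -> is_derive (fun s => f s + g s) x (df + dg).
Proof. apply (is_derive_plus (K := R_AbsRing) (V := R_NormedModule)). Qed.

Lemma is_derive_Rminus (f g : R -> R) x df dg :
  is_derive f x df -> is_derive g x dg -> is_derive (fun s => f s - g s) x (df - dg).
Proof. apply (is_derive_minus (K := R_AbsRing) (V := R_NormedModule)). Qed.

Lemma is_derive_Ropp (f : R -> R) x df : is_derive f x df -> is_derive (fun s => - f s) x (- df).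
Proof. apply (is_derive_opp (K := R_AbsRing) (V := R_NormedModule)). Qed.

Lemma is_derive_eq {V : NormedModule R_AbsRing} (f : R -> V) x l l' :
  is_derive f x l -> l = l' -> is_derive f x l'.
Proof. intros H <-; exact H. Qed.

Lemma is_derive_qmul (f g : R -> quat) x df dg :
  is_derive f x df -> is_derive g x dg ->
  is_derive (fun s => f s ** g s) x (plus (df ** g x) (f x ** dg)).
Proof.
intros Hf Hg; destruct (is_derive_q f x df Hf) as (F0 & F1 & F2 & F3).
destruct (is_derive_q g x dg Hg) as (G0 & G1 & G2 & G3).
apply (is_derive_ext _ _ _ _ (fun s => eq_sym (qmul_coord (f s) (g s)))).
assert (D := fun i j di dj (Hi : is_derive i x di) (Hj : is_derive j x dj) =>
  is_derive_Rmult i j x di dj Hi Hj).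
match goal with |- is_derive _ _ ?l =>
  rewrite (quat_eta l) end.
apply is_derive_quat_intro.
all: match goal with |- is_derive (fun s => _ - _ - _ - _) _ _ =>
       eapply is_derive_eq; [apply is_derive_Rminus; [apply is_derive_Rminus; [apply is_derive_Rminus|]|]|]
     | |- is_derive (fun s => _ + _ + _ - _) _ _ =>
       eapply is_derive_eq; [apply is_derive_Rminus; [apply is_derive_Rplus; [apply is_derive_Rplus|]|]|]
     | |- is_derive (fun s => _ - _ + _ + _) _ _ =>
       eapply is_derive_eq; [apply is_derive_Rplus; [apply is_derive_Rplus; [apply is_derive_Rminus|]|]|]
     | |- is_derive (fun s => _ + _ - _ + _) _ _ =>
       eapply is_derive_eq; [apply is_derive_Rplus; [apply is_derive_Rminus; [apply is_derive_Rplus|]|]|]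
     end; try (apply is_derive_Rmult; eassumption).
all: cbn beta; generalize (f x) (g x); clear; qring.
Qed.

Lemma is_derive_qscal (f : R -> R) (g : R -> quat) x df dg :
  is_derive f x df -> is_derive g x dg ->
  is_derive (fun s => scal (f s) (g s) : quat) x (plus (scal df (g x)) (scal (f x) dg)).
Proof.
intros Hf Hg; destruct (is_derive_q g x dg Hg) as (G0 & G1 & G2 & G3).
apply (is_derive_ext (fun s => (f s * q0 (g s), f s * q1 (g s), f s * q2 (g s), f s * q3 (g s)))).
  intros s; destruct (g s) as [[[? ?] ?] ?]; reflexivity.
match goal with |- is_derive _ _ ?l => rewrite (quat_eta l) end.
apply is_derive_quat_intro; apply is_derive_Rmult; assumption.
Qed.

Lemma is_derive_qconj (f : R -> quat) x df :
  is_derive f x df -> is_derive (fun s => qconj (f s)) x (qconj df).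
Proof.
intros Hf; destruct (is_derive_q f x df Hf) as (F0 & F1 & F2 & F3).
apply (is_derive_ext _ _ _ _ (fun s => eq_sym (qconj_coord (f s)))).
rewrite qconj_coord; apply is_derive_quat_intro; try apply is_derive_Ropp; assumption.
Qed.

Lemma is_derive_qplus (f g : R -> quat) x df dg :
  is_derive f x df -> is_derive g x dg -> is_derive (fun s => plus (f s) (g s)) x (plus df dg).
Proof. exact (is_derive_plus (K := R_AbsRing) f g x df dg). Qed.

Lemma is_derive_qconst (c : quat) x : is_derive (fun _ : R => c) x (zero : quat).
Proof. exact (is_derive_const (K := R_AbsRing) c x). Qed.

Lemma is_derive_qim (f : R -> quat) x df :
  is_derive f x df -> is_derive (fun s => qim (f s)) x (qim df).
Proof.
intros Hf; destruct (is_derive_q f x df Hf) as (F0 & F1 & F2 & F3).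
apply (is_derive_ext _ _ _ _ (fun s => eq_sym (qim_coord (f s)))).
rewrite qim_coord; apply is_derive_quat_intro; try assumption.
apply (is_derive_const (K := R_AbsRing) (V := R_NormedModule)).
Qed.

Lemma is_derive_sandwich (a b : quat) (f : R -> quat) x df :
  is_derive f x df -> is_derive (fun s => a ** f s ** b) x (a ** df ** b).
Proof.
intros Hf.
assert (D := is_derive_qmul _ _ _ _ _ (is_derive_qmul _ _ _ _ _ (is_derive_qconst a x) Hf)
  (is_derive_qconst b x)).
match type of D with is_derive _ _ ?l => replace (a ** df ** b) with l; [exact D|] end.
generalize (f x); clear; qring.
Qed.

Lemma is_derive_fst {V W : NormedModule R_AbsRing} (f : R -> V * W) x l :
  is_derive f x l -> is_derive (fun s => fst (f s)) x (fst l).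
Proof. exact (is_derive_linear_comp fst f x l is_linear_fst). Qed.

Lemma is_derive_snd {V W : NormedModule R_AbsRing} (f : R -> V * W) x l :
  is_derive f x l -> is_derive (fun s => snd (f s)) x (snd l).
Proof. exact (is_derive_linear_comp snd f x l is_linear_snd). Qed.

Lemma is_derive_quat_unique (f : R -> quat) x l l' :
  is_derive f x l -> is_derive f x l' -> l = l'.
Proof.
intros H H'; destruct (is_derive_q f x l H) as (F0 & F1 & F2 & F3).
destruct (is_derive_q f x l' H') as (G0 & G1 & G2 & G3).
apply quat_eq.
- rewrite <- (is_derive_unique _ _ _ F0); apply is_derive_unique, G0.
- rewrite <- (is_derive_unique _ _ _ F1); apply is_derive_unique, G1.
- rewrite <- (is_derive_unique _ _ _ F2); apply is_derive_unique, G2.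
- rewrite <- (is_derive_unique _ _ _ F3); apply is_derive_unique, G3.
Qed.

Lemma actM_coord g m : actM g m =
  (fst (fst g) ** fst m ** qconj (snd g), fst (fst g) ** snd m ** qconj (snd (fst g))).
Proof. destruct g as [[h1 h2] c]; reflexivity. Qed.

Lemma qconj_qone : qconj qone = qone.
Proof. unfold qone; qring. Qed.

(** The lift is g.(m, u) = (g m, l(g) u), with l a homomorphism independent of m; invariance then
    reduces to equivariance of the potential. For P_1, l is the third factor, and for P_id the first
    one. *)
Lemma conn_invariant lambda al (l : SU2cube_carrier -> quat) :
  is_linear l ->
  (forall g, SU2cube g -> SU2 (l g)) -> l one3 = qone ->
  (forall g g', l (mul3 g g') = l g ** l g') ->
  (forall h1 h2, l (h1, h2, qone) = lambda h1) ->
  (forall g m v, SU2cube g -> al (actM g m) (actM g v) = l g ** al m v ** qconj (l g)) ->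
  SU2cube_invariant lambda (conn al).
Proof.
intros Ll Sl L1 Lm Lh Hal.
exists (fun g z => (actM g (fst z), l g ** snd z)); split; [split; [|split; [|split; [|split; [|split]]]]|].
- apply smooth_on_Cn; intros n.
  apply (Cn_ext n (fun gz : SU2cube_carrier * PP =>
    (fst (fst (fst gz)) ** fst (fst (snd gz)) ** qconj (snd (fst gz)),
     fst (fst (fst gz)) ** snd (fst (snd gz)) ** qconj (snd (fst (fst gz))),
     l (fst gz) ** snd (snd gz)))).
    intros gz; rewrite actM_coord; reflexivity.
  smooth; apply (Cn_linear_comp n l fst Ll); smooth.
- intros g [[p q] u] Hg [Hm Hu]; split; [|reflexivity]; assert (Hs := Sl g Hg).
  destruct g as [[h1 h2] c], Hg as (H1 & H2 & H3); split; cbn [fst snd actM] in *.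
    apply SU2_mul; [apply SU2_mul; assumption | apply SU2_qconj, H2].
  apply SU2_mul; assumption.
- intros g m u a _ _ _; cbn [fst snd]; rewrite qmulA; reflexivity.
- intros [[p q] u] _; rewrite L1; unfold one3, actM; cbn [fst snd].
  rewrite qconj_qone, !qmul1r, !qmul1l; reflexivity.
- intros [[h1 h2] c] [[h1' h2'] c'] [[p q] u] _ _ _; rewrite Lm; unfold mul3, actM; cbn [fst snd].
  rewrite !qconj_mul, !qmulA; reflexivity.
- intros h1 h2 [[p q] u] _ _ _; rewrite Lh; reflexivity.
- intros g gamma w w' Hg _ Dw Dw'; assert (Hs := Sl g Hg).
  assert (Dm := is_derive_fst gamma 0 w Dw); assert (Du := is_derive_snd gamma 0 w Dw).
  assert (Dp := is_derive_fst _ 0 _ Dm); assert (Dq := is_derive_snd _ 0 _ Dm).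
  assert (Dm' := is_derive_fst _ 0 _ Dw'); assert (Du' := is_derive_snd _ 0 _ Dw').
  assert (Dp' := is_derive_fst _ 0 _ Dm'); assert (Dq' := is_derive_snd _ 0 _ Dm').
  (* The lift of a fixed g is linear in the point, so it maps velocities as it maps points;
     uniqueness of derivatives identifies w'. *)
  assert (E : w' = (actM g (fst w), l g ** snd w)).
    destruct g as [[h1 h2] c]; destruct w' as [[p' q'] u'].
    cbn [actM fst snd]; apply f_equal2; [apply f_equal2|].
    + exact (is_derive_quat_unique _ _ _ _ Dp' (is_derive_sandwich h1 (qconj c) _ _ _ Dp)).
    + exact (is_derive_quat_unique _ _ _ _ Dq' (is_derive_sandwich h1 (qconj h2) _ _ _ Dq)).
    + apply (is_derive_quat_unique _ _ _ _ Du').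
      assert (D := is_derive_sandwich (l (h1, h2, c)) qone _ _ _ Du).
      rewrite qmul1r in D.
      exact (is_derive_ext _ _ _ _ (fun s => qmul1r (l (h1, h2, c) ** snd (gamma s))) D).
  rewrite E; unfold conn; cbn [fst snd]; rewrite Hal by exact Hg.
  rewrite !qconj_mul, <- !qmulA, (qmulA (qconj (l g)) (l g)), qconj_mul_self, qmul1l by exact Hs.
  rewrite (qmulA (qconj (l g)) (l g) (snd w)), qconj_mul_self, qmul1l by exact Hs.
  rewrite (qmulA (qconj (l g)) (l g)), qconj_mul_self, qmul1l by exact Hs.
  reflexivity.
Qed.

(** * Curvature *)

Section Potentials.
Variables U Z Y : R -> R.
Hypothesis U_smooth : esmooth U.
Hypothesis Z_smooth : esmooth Z.
Hypothesis Y_smooth : esmooth Y.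

Lemma potential_P1_smooth n : Cn n (fun zw : PP * PP => potential_P1 U (fst (fst zw)) (fst (snd zw))).
Proof. unfold potential_P1; smooth; assumption. Qed.

Lemma potential_Pid_smooth n : Cn n (fun zw : PP * PP => potential_Pid Z Y (fst (fst zw)) (fst (snd zw))).
Proof. unfold potential_Pid; smooth; assumption. Qed.

Lemma potential_P1_linear m (c : R) v v' :
  potential_P1 U m (plus (scal c v) v') = plus (scal c (potential_P1 U m v)) (potential_P1 U m v').
Proof.
unfold potential_P1; destruct m as [p q], v as [a n], v' as [a' n']; cbn [fst snd].
change (fst (plus (scal c (a, n)) (a', n'))) with (plus (scal c a) a').
change (snd (plus (scal c (a, n)) (a', n'))) with (plus (scal c n) n').
generalize (U (qabs p)); clear; qring.
Qed.

Lemma potential_Pid_linear m (c : R) v v' :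
  potential_Pid Z Y m (plus (scal c v) v') = plus (scal c (potential_Pid Z Y m v)) (potential_Pid Z Y m v').
Proof.
unfold potential_Pid; destruct m as [p q], v as [a n], v' as [a' n']; cbn [fst snd].
change (fst (plus (scal c (a, n)) (a', n'))) with (plus (scal c a) a').
change (snd (plus (scal c (a, n)) (a', n'))) with (plus (scal c n) n').
generalize (Z (qabs p)), (Y (qabs p)); clear; qring.
Qed.

Lemma potential_P1_su2 m v : su2 (potential_P1 U m v).
Proof.
unfold potential_P1, su2; destruct m as [p q], v as [a n]; cbn [fst snd].
generalize (U (qabs p)); clear; qring.
Qed.

Lemma potential_Pid_su2 m v : su2 (potential_Pid Z Y m v).
Proof.
unfold potential_Pid, su2; destruct m as [p q], v as [a n]; cbn [fst snd].
generalize (Z (qabs p)), (Y (qabs p)); clear; qring.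
Qed.

Lemma qabs_act h p c : SU2 h -> SU2 c -> qabs (h ** p ** qconj c) = qabs p.
Proof.
intros Hh Hc; unfold qabs; rewrite !qdot_mul, Hh, (SU2_qconj c Hc); f_equal; ring.
Qed.

Lemma qim_sandwich a x : qim (a ** x ** qconj a) = a ** qim x ** qconj a.
Proof. qring. Qed.

Lemma right_translation h1 h2 n q : SU2 h2 ->
  h1 ** n ** qconj h2 ** qconj (h1 ** q ** qconj h2) = h1 ** (n ** qconj q) ** qconj h1.
Proof.
intros H2; rewrite !qconj_mul, qconjK, !qmulA; f_equal; f_equal.
rewrite <- (qmulA _ (qconj h2) h2), qconj_mul_self, qmul1r by exact H2; reflexivity.
Qed.

(** In [qconj p] times dp the left factor h1 cancels and the right factor [qconj c] becomes
    conjugation by c. In dp times [qconj p], on which the other potential is built, the roles are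
    exchanged. *)
Lemma potential_P1_invariant g m v : SU2cube g ->
  potential_P1 U (actM g m) (actM g v) = snd g ** potential_P1 U m v ** qconj (snd g).
Proof.
destruct g as [[h1 h2] c], m as [p q], v as [a n]; intros (H1 & H2 & H3).
unfold potential_P1, actM; cbn [fst snd].
rewrite qabs_act, right_translation, qim_sandwich by assumption.
assert (E : forall x, qconj (h1 ** p ** qconj c) ** (h1 ** x ** qconj c) =
  c ** (qconj p ** x) ** qconj c).
  intros x; rewrite !qconj_mul, qconjK, !qmulA; f_equal; f_equal.
  rewrite <- (qmulA _ (qconj h1) h1), qconj_mul_self, qmul1r by exact H1; reflexivity.
rewrite E, qim_sandwich, qmul_scal_r, qmul_scal_l, qmul_plus_r, qmul_plus_l.
rewrite qmul_scal_r, qmul_scal_l; do 3 f_equal.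
rewrite !qconj_mul, qconjK, !qmulA; f_equal; f_equal.
rewrite <- (qmulA _ (qconj h1) h1), qconj_mul_self, qmul1r by exact H1.
rewrite <- (qmulA _ (qconj h1) h1), qconj_mul_self, qmul1r by exact H1; reflexivity.
Qed.

Lemma potential_Pid_invariant g m v : SU2cube g ->
  potential_Pid Z Y (actM g m) (actM g v) = fst (fst g) ** potential_Pid Z Y m v ** qconj (fst (fst g)).
Proof.
destruct g as [[h1 h2] c], m as [p q], v as [a n]; intros (H1 & H2 & H3).
unfold potential_Pid, actM; cbn [fst snd].
rewrite qabs_act, !right_translation, !qim_sandwich by assumption.
rewrite qmul_plus_r, qmul_plus_l, !qmul_scal_r, !qmul_scal_l; reflexivity.
Qed.

End Potentials.

(** The real part of n [qconj q] is the inner product of n and q, so the projections [qim] of these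
    terms are invisible on tangent vectors. *)
Lemma TM_imaginary m v : M m -> TM m v -> qim (snd v ** qconj (snd m)) = snd v ** qconj (snd m).
Proof.
destruct m as [p q], v as [a n]; unfold TM; cbn [fst snd]; intros _ H.
rewrite qim_coord, (quat_eta (n ** qconj q)); f_equal; f_equal; f_equal.
change (0 = q0 (n ** qconj q)).
rewrite <- H; clear; qring.
Qed.

Lemma q0_qdot x : q0 x = qdot x qone.
Proof. unfold qone; qring. Qed.

Lemma q1_qdot x : q1 x = qcomp I1 x.
Proof. qring. Qed.

Lemma q2_qdot x : q2 x = qcomp I2 x.
Proof. qring. Qed.

Lemma q3_qdot x : q3 x = qcomp I3 x.
Proof. qring. Qed.

Section Curves.
Variables m v : HH.
Hypothesis Hm : M m.
Hypothesis Hv : TM m v.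

Lemma curve_snd s : snd (curve m v s) =
  scal (/ sqrt (1 + qdot (snd v) (snd v) * s ^ 2)) (plus (snd m) (scal s (snd v))).
Proof.
unfold curve, qdir; cbn [snd]; unfold qabs; rewrite qdot_line, Hm, Hv; do 3 f_equal; ring.
Qed.

Lemma curve_norm_pos s : 0 < 1 + qdot (snd v) (snd v) * s ^ 2.
Proof.
assert (0 <= qdot (snd v) (snd v)) by (rewrite qdot_coord; nra).
assert (H0 := pow2_ge_0 s); nra.
Qed.

Lemma curve_SU2 s : SU2 (snd (curve m v s)).
Proof.
rewrite curve_snd; assert (Hp := curve_norm_pos s); unfold SU2.
set (c := / sqrt _).
transitivity (c * c * qdot (plus (snd m) (scal s (snd v))) (plus (snd m) (scal s (snd v)))).
  generalize (plus (snd m) (scal s (snd v))) c; clear; qring.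
rewrite qdot_line, Hm, Hv.
replace (1 + 2 * 0 * s + qdot (snd v) (snd v) * s ^ 2) with
  (sqrt (1 + qdot (snd v) (snd v) * s ^ 2) * sqrt (1 + qdot (snd v) (snd v) * s ^ 2)) by
  (rewrite sqrt_sqrt; lra).
unfold c; field; apply Rgt_not_eq, sqrt_lt_R0, Hp.
Qed.

Lemma is_derive_qline (x y : quat) : is_derive (fun s : R => plus x (scal s y)) 0 y.
Proof.
assert (D := is_derive_qplus _ _ 0 _ _ (is_derive_qconst x 0)
  (is_derive_qscal (fun s => s) _ 0 _ _ (is_derive_id (K := R_AbsRing) 0) (is_derive_qconst y 0))).
apply (is_derive_eq _ _ _ _ D); change (@one R_AbsRing) with 1; clear; qring.
Qed.

Lemma curve_fst_derive : is_derive (fun s => fst (curve m v s)) 0 (fst v).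
Proof. exact (is_derive_qline (fst m) (fst v)). Qed.

Lemma curve_snd_derive : is_derive (fun s => snd (curve m v s)) 0 (snd v).
Proof.
apply (is_derive_ext _ _ _ _ (fun s => eq_sym (curve_snd s))).
assert (D1 : is_derive (fun s => / sqrt (1 + qdot (snd v) (snd v) * s ^ 2)) 0 0).
  assert (Hp := curve_norm_pos 0).
  auto_derive.
    repeat split; [lra|]; apply Rgt_not_eq, sqrt_lt_R0; lra.
  field; apply Rgt_not_eq, sqrt_lt_R0; lra.
assert (D := is_derive_qscal _ _ 0 _ _ D1 (is_derive_qline (snd m) (snd v))).
apply (is_derive_eq _ _ _ _ D).
replace (1 + qdot (snd v) (snd v) * 0 ^ 2) with 1 by ring; rewrite sqrt_1.
generalize (snd m), (snd v); clear; qring.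
Qed.

Lemma dQ_unique f l : is_derive (fun s => f (curve m v s)) 0 l -> dQ f m v = l.
Proof.
intros H; destruct (is_derive_q _ 0 l H) as (F0 & F1 & F2 & F3).
unfold dQ, dR; rewrite (quat_eta l); f_equal; [f_equal; [f_equal|]|];
  apply is_derive_unique.
- exact (is_derive_ext _ _ _ _ (fun s => q0_qdot (f (curve m v s))) F0).
- exact (is_derive_ext _ _ _ _ (fun s => q1_qdot (f (curve m v s))) F1).
- exact (is_derive_ext _ _ _ _ (fun s => q2_qdot (f (curve m v s))) F2).
- exact (is_derive_ext _ _ _ _ (fun s => q3_qdot (f (curve m v s))) F3).
Qed.

(** The right-invariant extension keeps this translated velocity constant along the curve. In the
    exterior derivative of the potentials only the dependence on p is left to differentiate. *)
Lemma rfield_curve w s :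
  snd (rfield m w (curve m v s)) ** qconj (snd (curve m v s)) = snd w ** qconj (snd m).
Proof.
unfold rfield; cbn [snd].
rewrite <- qmulA, mul_qconj, qmul1r by apply curve_SU2; reflexivity.
Qed.

Definition dpotential_P1 (U : R -> R) (w : HH) : quat :=
  let p := fst m in let N := qim (snd w ** qconj (snd m)) in
  plus
    (scal (Dq U (qabs p) * qdot p (fst v))
       (plus (qim (qconj p ** fst w)) (scal (- (1 / 2)) (qconj p ** N ** p))))
    (scal (U (qabs p))
       (plus (qim (qconj (fst v) ** fst w))
         (scal (- (1 / 2)) (plus (qconj (fst v) ** N ** p) (qconj p ** N ** fst v))))).

Definition dpotential_Pid (Z Y : R -> R) (w : HH) : quat :=
  let p := fst m in let N := qim (snd w ** qconj (snd m)) in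
  plus
    (plus (scal (Dq Z (qabs p) * qdot p (fst v)) (qim (fst w ** qconj p)))
          (scal (Z (qabs p)) (qim (fst w ** qconj (fst v)))))
    (scal (Dq Y (qabs p) * qdot p (fst v)) N).

Lemma dQ_potential_P1 U w : esmooth U ->
  dQ (fun m' => potential_P1 U m' (rfield m w m')) m v = dpotential_P1 U w.
Proof.
intros HU; apply dQ_unique.
apply (is_derive_ext (fun s => let p := fst (curve m v s) in
  scal (U (qabs p)) (plus (qim (qconj p ** fst w))
    (scal (- (1 / 2)) (qconj p ** qim (snd w ** qconj (snd m)) ** p))))).
  intros s; cbv zeta; unfold potential_P1; rewrite rfield_curve; reflexivity.
assert (DU := radial_derive U (fst m) (fst v) HU).
assert (Dp := curve_fst_derive); assert (Dc := is_derive_qconj _ 0 _ Dp).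
set (N := qim (snd w ** qconj (snd m))).
assert (D1 := is_derive_qim _ 0 _ (is_derive_qmul _ _ 0 _ _ Dc (is_derive_qconst (fst w) 0))).
assert (D2 := is_derive_qmul _ _ 0 _ _ (is_derive_qmul _ _ 0 _ _ Dc (is_derive_qconst N 0)) Dp).
assert (D3 := is_derive_qscal (fun _ => - (1 / 2)) _ 0 _ _
  (is_derive_const (K := R_AbsRing) (V := R_NormedModule) (- (1 / 2)) 0) D2).
assert (D := is_derive_qscal _ _ 0 _ _ DU (is_derive_qplus _ _ 0 _ _ D1 D3)).
apply (is_derive_eq _ _ _ _ D).
assert (E0 : fst (curve m v 0) = fst m) by exact (line_0 (fst m) (fst v)).
cbn beta; rewrite !E0; unfold dpotential_P1; fold N.
replace (U (qabs (plus (fst m) (scal 0 (fst v))))) with (U (qabs (fst m))) by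
  (do 2 f_equal; symmetry; exact E0).
change (@zero R_NormedModule) with 0.
generalize (Dq U (qabs (fst m))), (U (qabs (fst m))).
generalize (fst m), (fst v), (fst w), N; clear; qring.
Qed.

Lemma dQ_potential_Pid Z Y w : esmooth Z -> esmooth Y ->
  dQ (fun m' => potential_Pid Z Y m' (rfield m w m')) m v = dpotential_Pid Z Y w.
Proof.
intros HZ HY; apply dQ_unique.
set (N := qim (snd w ** qconj (snd m))).
apply (is_derive_ext (fun s => let p := fst (curve m v s) in
  plus (scal (Z (qabs p)) (qim (fst w ** qconj p))) (scal (Y (qabs p)) N))).
  intros s; cbv zeta; unfold potential_Pid; rewrite rfield_curve; reflexivity.
assert (DZ := radial_derive Z (fst m) (fst v) HZ).
assert (DY := radial_derive Y (fst m) (fst v) HY).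
assert (Dc := is_derive_qconj _ 0 _ curve_fst_derive).
assert (D1 := is_derive_qim _ 0 _ (is_derive_qmul _ _ 0 _ _ (is_derive_qconst (fst w) 0) Dc)).
assert (D := is_derive_qplus _ _ 0 _ _ (is_derive_qscal _ _ 0 _ _ DZ D1)
  (is_derive_qscal _ _ 0 _ _ DY (is_derive_qconst N 0))).
apply (is_derive_eq _ _ _ _ D).
assert (E0 : fst (curve m v 0) = fst m) by exact (line_0 (fst m) (fst v)).
cbn beta; rewrite ?E0; unfold dpotential_Pid; fold N.
replace (Z (qabs (plus (fst m) (scal 0 (fst v))))) with (Z (qabs (fst m))) by
  (do 2 f_equal; symmetry; exact E0).
replace (Y (qabs (plus (fst m) (scal 0 (fst v))))) with (Y (qabs (fst m))) by
  (do 2 f_equal; symmetry; exact E0).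
generalize (Dq Z (qabs (fst m))), (Z (qabs (fst m))), (Dq Y (qabs (fst m))), (Y (qabs (fst m))).
generalize (fst m), (fst v), (fst w), N; clear; qring.
Qed.

End Curves.

(** The curvature with the derivatives replaced by explicit formulas. These are visibly smooth in m,
    also across p = 0, for fixed vectors v and w that need not stay tangent. *)
Definition curvature_closed (al : HH -> HH -> quat) (dal : HH -> HH -> HH -> quat)
  (m v w : HH) : quat :=
  plus (minus (minus (dal m v w) (dal m w v)) (al m (rbracket m v w)))
       (bracket (al m v) (al m w)).

Lemma curvature_potential_P1 U m v w : esmooth U -> M m -> TM m v -> TM m w ->
  curvature (potential_P1 U) m v w = curvature_closed (potential_P1 U) (fun m v => dpotential_P1 m v U) m v w.
Proof.
intros HU Hm Hv Hw; unfold curvature, dform1; rewrite !dQ_potential_P1 by assumption; reflexivity.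
Qed.

Lemma curvature_potential_Pid Z Y m v w : esmooth Z -> esmooth Y -> M m -> TM m v -> TM m w ->
  curvature (potential_Pid Z Y) m v w = curvature_closed (potential_Pid Z Y) (fun m v => dpotential_Pid m v Z Y) m v w.
Proof.
intros HZ HY Hm Hv Hw; unfold curvature, dform1; rewrite !dQ_potential_Pid by assumption; reflexivity.
Qed.

Lemma potential_conn al : potential (conn al) = al.
Proof.
apply functional_extensionality; intros m; apply functional_extensionality; intros v.
unfold potential, conn; cbn [fst snd].
generalize (al m v); clear; unfold qone; qring.
Qed.

Lemma curvature_closed_potential_P1_smooth U v w n : esmooth U ->
  Cn n (fun m => curvature_closed (potential_P1 U) (fun m v => dpotential_P1 m v U) m v w).
Proof.
intros HU; assert (HD := esmooth_Dq U HU).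
unfold curvature_closed, dpotential_P1, potential_P1, rbracket, bracket, minus; cbv zeta; cbn [fst snd].
smooth; assumption.
Qed.

Lemma curvature_closed_potential_Pid_smooth Z Y v w n : esmooth Z -> esmooth Y ->
  Cn n (fun m => curvature_closed (potential_Pid Z Y) (fun m v => dpotential_Pid m v Z Y) m v w).
Proof.
intros HZ HY; assert (DZ := esmooth_Dq Z HZ); assert (DY := esmooth_Dq Y HY).
unfold curvature_closed, dpotential_Pid, potential_Pid, rbracket, bracket, minus; cbv zeta; cbn [fst snd].
smooth; assumption.
Qed.

(** * The invariant frame *)

Definition etap_vec (m v : HH) : quat := sum3 (fun i => scal (etap i m v) (T i) : quat).
Definition etam_vec (m v : HH) : quat := sum3 (fun i => scal (etam i m v) (T i) : quat).

Lemma qconj_tangent (q n : quat) : SU2 q -> qim (n ** qconj q) = n ** qconj q ->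
  qconj n = minus zero (qconj q ** (n ** qconj q)).
Proof.
intros Hq E.
assert (E' : qconj (n ** qconj q) = minus zero (n ** qconj q)).
  rewrite <- E; generalize (n ** qconj q); clear; qring.
rewrite qconj_mul, qconjK in E'.
transitivity (qconj q ** (q ** qconj n)).
  rewrite qmulA, qconj_mul_self, qmul1l by exact Hq; reflexivity.
rewrite E'; generalize (n ** qconj q); clear; qring.
Qed.

Section Frame.
Variables m v : HH.
Hypothesis Hm : M0 m.
Hypothesis Hv : TM m v.

Local Notation p := (fst m).
Local Notation r := (radius m).

Lemma radius_sqr : r * r = qdot p p.
Proof. apply sqrt_sqrt, Rlt_le, qdot_pos, Hm. Qed.

Lemma radius_neq0 : r <> 0.
Proof. apply Rgt_not_eq, radius_pos, Hm. Qed.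

Lemma dt_frame : dt m v = qdot p (fst v) / r.
Proof.
apply is_derive_unique.
apply (is_derive_ext (fun s =>
  sqrt (qdot p p + 2 * qdot p (fst v) * s + qdot (fst v) (fst v) * s ^ 2))).
  intros s; unfold radius, qabs; cbn [curve fst]; rewrite qdot_line; reflexivity.
assert (Hr : 0 < r) by exact (radius_pos m Hm).
auto_derive; replace (qdot p p + _ + _) with (r * r) by (rewrite radius_sqr; ring).
  nra.
rewrite sqrt_square by lra; field; lra.
Qed.

Lemma a1_derive : is_derive (fun s => a1 (curve m v s)) 0
  (plus (scal (- qdot p (fst v) / r ^ 3) p) (scal (/ r) (fst v)) : quat).
Proof.
assert (Hr : 0 < r) by exact (radius_pos m Hm).
assert (D1 : is_derive (fun s : R => / qabs (plus p (scal s (fst v)))) 0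
  (- qdot p (fst v) / r ^ 3)).
  apply (is_derive_ext (fun s =>
    / sqrt (qdot p p + 2 * qdot p (fst v) * s + qdot (fst v) (fst v) * s ^ 2))).
    intros s; unfold qabs; rewrite qdot_line; reflexivity.
  auto_derive; replace (qdot p p + _ + _) with (r * r) by (rewrite radius_sqr; ring);
    rewrite ?sqrt_square by lra.
    split; [nra|split; [lra|exact I]].
  field; lra.
assert (D := is_derive_qscal _ _ 0 _ _ D1 (is_derive_qline p (fst v))).
apply (is_derive_eq _ _ _ _ D).
replace (qabs (plus p (scal 0 (fst v)))) with r.
  generalize p, (fst v), (- qdot p (fst v) / r ^ 3), (/ r); clear; qring.
unfold radius; f_equal; symmetry; exact (line_0 (fst m) (fst v)).
Qed.

Lemma a1_frame : a1 m = scal (/ r) p.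
Proof. reflexivity. Qed.

Lemma dQ_a1 : dQ a1 m v = a1 m ** mc1 m v.
Proof.
unfold mc1; rewrite qmulA, mul_qconj, qmul1l by apply SU2_a1, Hm; reflexivity.
Qed.

Lemma mc1_eq : mc1 m v = scal (/ r ^ 2) (qim (qconj p ** fst v)).
Proof.
unfold mc1; rewrite (dQ_unique m v a1 _ a1_derive), a1_frame.
assert (Hr := radius_neq0); assert (Hs := radius_sqr).
replace (- qdot p (fst v) / r ^ 3) with (/ r * (- qdot p (fst v) / r ^ 2)) by (field; exact Hr).
replace (/ r ^ 2) with (/ r * / r) by (field; exact Hr).
replace (- qdot p (fst v) / r ^ 2) with (- qdot p (fst v) * / qdot p p) by
  (rewrite <- Hs; field; exact Hr).
assert (Hp : qdot p p <> 0) by (rewrite <- Hs; apply Rmult_integral_contrapositive_currified; exact Hr).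
revert Hp; generalize p, (fst v), (/ r); clear.
intros x w k; destruct x as [[[p0 p1] p2] p3], w as [[[w0 w1] w2] w3].
cbv -[Rplus Rmult Ropp Rminus Rinv Rdiv IZR]; intros Hp; qsplit; real_eq; field; exact Hp.
Qed.

(** Differentiating a2 = [qconj q] a1 adds to [mc1] the conjugate by a1 of q d([qconj q]), which is
    - dq [qconj q] on the unit sphere. *)
Lemma mc2_eq : mc2 m v = minus (mc1 m v) (qconj (a1 m) ** (snd v ** qconj (snd m)) ** a1 m).
Proof.
assert (Hm' : M m) by apply Hm.
assert (D := is_derive_qmul _ _ 0 _ _ (is_derive_qconj _ 0 _ (curve_snd_derive m v Hm' Hv)) a1_derive).
unfold mc2; rewrite (dQ_unique m v a2 _ D), <- (dQ_unique m v a1 _ a1_derive).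
assert (E0 : fst (curve m v 0) = fst m) by exact (line_0 (fst m) (fst v)).
assert (E1 : a1 (curve m v 0) = a1 m) by (unfold a1; rewrite E0; reflexivity).
assert (E2 : snd (curve m v 0) = snd m).
  rewrite curve_snd by assumption.
  replace (1 + _ * 0 ^ 2) with 1 by ring; rewrite sqrt_1.
  generalize (snd m), (snd v); clear; qring.
rewrite E1, E2, dQ_a1.
assert (Hc := qconj_tangent (snd m) (snd v) Hm' (TM_imaginary m v Hm' Hv)).
rewrite Hc; unfold a2; rewrite qconj_mul, qconjK.
assert (Ha : forall x, qconj (a1 m) ** snd m ** (qconj (snd m) ** x) = qconj (a1 m) ** x).
  intros x; rewrite !qmulA, <- (qmulA _ (snd m)), mul_qconj, qmul1r by exact Hm'; reflexivity.
rewrite qmul_plus_r, Ha, (qmulA (qconj (a1 m))), qconj_mul_self, qmul1l by apply SU2_a1, Hm.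
set (N := snd v ** qconj (snd m)).
replace (minus zero (qconj (snd m) ** N) ** a1 m) with
  (qconj (snd m) ** (minus zero N ** a1 m)).
  rewrite Ha; generalize (mc1 m v), N, (a1 m); clear; qring.
generalize N, (a1 m), (snd m); clear; qring.
Qed.

Lemma vec_sum : plus (etap_vec m v) (etam_vec m v) = mc1 m v.
Proof.
unfold etap_vec, etam_vec, etap, etam; rewrite mc1_eq.
generalize (mc2 m v), (qconj p ** fst v), (/ r ^ 2); clear; qring.
Qed.

(** The derivative of p = r a1. Together with [frame_snd] it expresses a tangent vector through its
    values under dt and the eta_i^+, eta_i^-, and makes the curvature purely algebraic. *)
Lemma frame_fst :
  fst v = p ** plus (scal (dt m v / r) qone) (plus (etap_vec m v) (etam_vec m v)).
Proof.
rewrite vec_sum, dt_frame, mc1_eq.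
assert (Hr := radius_neq0); assert (Hs := radius_sqr).
replace (qdot p (fst v) / r / r) with (qdot p (fst v) * / qdot p p) by
  (rewrite <- Hs; field; exact Hr).
replace (/ r ^ 2) with (/ qdot p p) by (rewrite <- Hs; field; exact Hr).
assert (Hp : qdot p p <> 0) by (rewrite <- Hs; apply Rmult_integral_contrapositive_currified; exact Hr).
revert Hp; generalize p, (fst v); clear.
intros x w; destruct x as [[[p0 p1] p2] p3], w as [[[w0 w1] w2] w3].
cbv -[Rplus Rmult Ropp Rminus Rinv Rdiv IZR]; intros Hp; qsplit; real_eq; field; exact Hp.
Qed.

Lemma etam_frame :
  etam_vec m v = scal (1 / 2) (qconj (a1 m) ** (snd v ** qconj (snd m)) ** a1 m).
Proof.
unfold etam_vec, etam; rewrite mc2_eq, <- (TM_imaginary m v) by (try apply Hm; exact Hv).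
generalize (mc1 m v), (snd v ** qconj (snd m)), (a1 m); clear; qring.
Qed.

Lemma frame_snd :
  qim (snd v ** qconj (snd m)) = scal (2 / r ^ 2) (p ** etam_vec m v ** qconj p).
Proof.
rewrite etam_frame, (TM_imaginary m v) by (try apply Hm; exact Hv).
assert (Hr := radius_neq0).
assert (Ep : p = scal r (a1 m)).
  rewrite a1_frame; rewrite scal_assoc.
  replace (mult r (/ r)) with (@one R_AbsRing); [symmetry; exact (scal_one (V := prod_ModuleSpace _ _ _) p)|].
  change (1 = r * / r); field; exact Hr.
set (N := snd v ** qconj (snd m)).
transitivity (a1 m ** (qconj (a1 m) ** N ** a1 m) ** qconj (a1 m)).
  rewrite !qmulA, mul_qconj, qmul1l, <- qmulA, mul_qconj, qmul1r by apply SU2_a1, Hm; reflexivity.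
rewrite Ep; generalize N, (a1 m); revert Hr; generalize r; clear; intros k Hr N a.
transitivity (scal (2 / k ^ 2 * (1 / 2) * k * k) (a ** (qconj a ** N ** a) ** qconj a)).
  replace (2 / k ^ 2 * (1 / 2) * k * k) with 1 by (field; exact Hr).
  generalize (a ** (qconj a ** N ** a) ** qconj a); clear; qring.
generalize (qconj a ** N ** a), (2 / k ^ 2); clear; qring.
Qed.

End Frame.

(** The curvature of u T_i eta_i^+ + v T_i eta_i^- evaluated on two vectors; [t], [P0], [N0] stand
    for the values of dt, T_i eta_i^+ and T_i eta_i^- on the first one. The terms linear in u and v
    come from the Maurer-Cartan equation. *)
Definition invariant_curvature (u v du dv : R) (t : R) (P0 N0 : quat) (t' : R) (P' N' : quat) : quat :=
  plus
    (plus (plus (scal du (minus (scal t P') (scal t' P0)))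
                (scal dv (minus (scal t N') (scal t' N0))))
          (plus (scal (u ^ 2 - u) (bracket P0 P')) (scal (v ^ 2 - u) (bracket N0 N'))))
    (scal (u * v - v) (plus (bracket P0 N') (bracket N0 P'))).

(** For p of norm r this is r^2 times a rotation; leaving it unnormalised accounts for the factors
    [qdot p p] in the rules below. *)
Definition Ad (p x : quat) : quat := p ** x ** qconj p.

Lemma Ad_plus p x y : plus (Ad p x) (Ad p y) = Ad p (plus x y).
Proof. unfold Ad; rewrite qmul_plus_r, qmul_plus_l; reflexivity. Qed.

Lemma Ad_scal p (k : R) x : scal k (Ad p x) = Ad p (scal k x).
Proof. unfold Ad; rewrite qmul_scal_r, qmul_scal_l; reflexivity. Qed.

Lemma Ad_opp p x : opp (Ad p x) = Ad p (opp x).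
Proof. unfold Ad; qring. Qed.

Lemma Ad_minus p x y : minus (Ad p x) (Ad p y) = Ad p (minus x y).
Proof. unfold minus; rewrite Ad_opp, Ad_plus; reflexivity. Qed.

Lemma qim_Ad p x : qim (Ad p x) = Ad p (qim x).
Proof. apply qim_sandwich. Qed.

Lemma conj_mul_scal p x : qconj p ** (p ** x) = scal (qdot p p) x.
Proof. qring. Qed.

Lemma mul_conj_scal p x : x ** qconj p ** p = scal (qdot p p) x.
Proof. qring. Qed.

Lemma Ad_mul p x y : Ad p x ** Ad p y = Ad p (scal (qdot p p) (x ** y)).
Proof.
unfold Ad; rewrite !qmulA, mul_conj_scal, !qmul_scal_l, qmul_scal_r, !qmul_scal_l, !qmulA.
reflexivity.
Qed.

Lemma Ad_bracket p x y : bracket (Ad p x) (Ad p y) = Ad p (scal (qdot p p) (bracket x y)).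
Proof.
unfold bracket; rewrite !Ad_mul, Ad_minus; f_equal; generalize (x ** y), (y ** x), (qdot p p).
clear; qring.
Qed.

Lemma qdot_mul_l p x : qdot p (p ** x) = qdot p p * q0 x.
Proof. qring. Qed.

Lemma Ad_conj_l p a x : qconj (p ** a) ** Ad p x = scal (qdot p p) (qconj a ** x ** qconj p).
Proof.
unfold Ad; rewrite qconj_mul, <- !qmulA, conj_mul_scal, !qmul_scal_r; reflexivity.
Qed.

Lemma conj_Ad p x : qconj p ** Ad p x = scal (qdot p p) (x ** qconj p).
Proof. unfold Ad; rewrite <- !qmulA, conj_mul_scal; reflexivity. Qed.

Lemma mul_conj_mul p x : p ** x ** qconj p = Ad p x.
Proof. reflexivity. Qed.

Definition frame_vector (r t : R) (x : quat) : quat := plus (scal (t / r) qone) x.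

Lemma vec_coord m v :
  etap_vec m v = (0, etap I1 m v, etap I2 m v, etap I3 m v) /\
  etam_vec m v = (0, etam I1 m v, etam I2 m v, etam I3 m v).
Proof.
unfold etap_vec, etam_vec, sum3; split;
  [generalize (etap I1 m v), (etap I2 m v), (etap I3 m v)
  |generalize (etam I1 m v), (etam I2 m v), (etam I3 m v)]; clear; qring.
Qed.

Lemma rbracket_snd m v w : M m -> TM m v -> TM m w ->
  snd (rbracket m v w) ** qconj (snd m) =
  opp (bracket (qim (snd v ** qconj (snd m))) (qim (snd w ** qconj (snd m)))).
Proof.
intros Hm Hv Hw; rewrite (TM_imaginary m v), (TM_imaginary m w) by assumption.
unfold rbracket; cbn [snd].
set (b := bracket _ _).
transitivity (opp (b ** (snd m ** qconj (snd m)))).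
  generalize b, (snd m); clear; qring.
rewrite mul_qconj, qmul1r by exact Hm; reflexivity.
Qed.

Section CurvatureOnM0.
Variables m v w : HH.
Hypothesis Hm : M0 m.
Hypothesis Hv : TM m v.
Hypothesis Hw : TM m w.
Local Notation p := (fst m).
Local Notation r := (radius m).

(** [Ad] divided by r^2 is conjugation by [a1], the gauge transformation between the two sections.
    Every term carries the same outer [Ad]; once it is stripped, an identity in frame coordinates
    remains. *)
Lemma curvature_potential_Pid_M0 Z Y : esmooth Z -> esmooth Y ->
  curvature (potential_Pid Z Y) m v w =
  scal (/ r ^ 2) (Ad p
    (invariant_curvature (1 + r ^ 2 * Z r) (1 + r ^ 2 * Z r + 2 * Y r)
         (2 * r * Z r + r ^ 2 * (r * Dq Z r))
         (2 * r * Z r + r ^ 2 * (r * Dq Z r) + 2 * (r * Dq Y r))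
         (dt m v) (etap_vec m v) (etam_vec m v) (dt m w) (etap_vec m w) (etam_vec m w))).
Proof.
intros HZ HY; assert (Hm' : M m) by apply Hm.
rewrite curvature_potential_Pid by assumption; unfold curvature_closed, dpotential_Pid, potential_Pid.
rewrite rbracket_snd by assumption; change (fst (rbracket m v w)) with (zero : quat).
rewrite !(frame_snd m v), !(frame_snd m w), (frame_fst m v), (frame_fst m w) by assumption.
fold (frame_vector r (dt m v) (plus (etap_vec m v) (etam_vec m v))).
fold (frame_vector r (dt m w) (plus (etap_vec m w) (etam_vec m w))).
change (qabs p) with r.
rewrite !qconj_mul, !qmulA.
assert (Er : forall x y, p ** x ** y ** qconj p = Ad p (x ** y)).
  intros x y; unfold Ad; rewrite !qmulA; reflexivity.
rewrite !Er, !mul_conj_mul, !qdot_mul_l, <- radius_sqr by assumption.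
assert (Ez : zero ** qconj p = Ad p zero) by (generalize p; clear; unfold Ad; qring).
rewrite Ez, ?Ad_scal, ?qim_Ad, ?Ad_scal, ?Ad_plus, ?Ad_bracket, ?Ad_scal, ?Ad_opp, ?qim_Ad,
  ?Ad_scal, ?Ad_plus, ?Ad_minus, ?Ad_bracket, ?Ad_scal, ?Ad_plus, ?Ad_minus, <- ?radius_sqr
  by assumption.
f_equal.
assert (Hr := radius_neq0 m Hm).
destruct (vec_coord m v) as [-> ->]; destruct (vec_coord m w) as [-> ->].
generalize (etap I1 m v), (etap I2 m v), (etap I3 m v), (etam I1 m v), (etam I2 m v),
 (etam I3 m v), (dt m v), (etap I1 m w), (etap I2 m w), (etap I3 m w), (etam I1 m w),
 (etam I2 m w), (etam I3 m w), (dt m w), (Z r), (Y r), (Dq Z r), (Dq Y r).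
revert Hr; generalize r; clear; intros.
unfold invariant_curvature, frame_vector, qim; cbv -[Rplus Rmult Ropp Rminus Rinv Rdiv IZR]; qsplit; real_eq; field; exact Hr.
Qed.

Lemma curvature_potential_P1_M0 U : esmooth U ->
  curvature (potential_P1 U) m v w =
    invariant_curvature (r ^ 2 * U r) 0 (2 * r * U r + r ^ 2 * (r * Dq U r)) 0
        (dt m v) (etap_vec m v) (etam_vec m v) (dt m w) (etap_vec m w) (etam_vec m w).
Proof.
intros HU; assert (Hm' : M m) by apply Hm.
rewrite curvature_potential_P1 by assumption; unfold curvature_closed, dpotential_P1, potential_P1.
rewrite rbracket_snd by assumption; change (fst (rbracket m v w)) with (zero : quat).
rewrite !(frame_snd m v), !(frame_snd m w), (frame_fst m v), (frame_fst m w) by assumption.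
fold (frame_vector r (dt m v) (plus (etap_vec m v) (etam_vec m v))).
fold (frame_vector r (dt m w) (plus (etap_vec m w) (etam_vec m w))).
change (qabs p) with r.
rewrite !mul_conj_mul, ?Ad_scal, ?Ad_bracket, ?Ad_scal, ?Ad_opp, ?qim_Ad, ?conj_Ad, ?Ad_conj_l.
assert (E4 : forall x y, qconj (p ** x) ** (p ** y) = scal (qdot p p) (qconj x ** y)).
  intros x y; rewrite qconj_mul, <- qmulA, conj_mul_scal, qmul_scal_r; reflexivity.
assert (Ez : qconj p ** zero = zero) by (generalize p; clear; qring).
rewrite Ez, ?E4, ?conj_mul_scal, ?qdot_mul_l, ?qmul_scal_l, ?mul_conj_scal.
assert (E6 : forall x y, x ** qconj p ** (p ** y) = scal (qdot p p) (x ** y)).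
  intros x y; rewrite <- qmulA, conj_mul_scal, qmul_scal_r; reflexivity.
rewrite ?E6, <- ?radius_sqr by assumption.
assert (Hr := radius_neq0 m Hm).
destruct (vec_coord m v) as [-> ->]; destruct (vec_coord m w) as [-> ->].
generalize (etap I1 m v), (etap I2 m v), (etap I3 m v), (etam I1 m v), (etam I2 m v),
 (etam I3 m v), (dt m v), (etap I1 m w), (etap I2 m w), (etap I3 m w), (etam I1 m w),
 (etam I2 m w), (etam I3 m w), (dt m w), (U r), (Dq U r).
revert Hr; generalize r; clear; intros.
unfold invariant_curvature, frame_vector, qim; cbv -[Rplus Rmult Ropp Rminus Rinv Rdiv IZR]; qsplit; real_eq; field; exact Hr.
Qed.

End CurvatureOnM0.

(** * The instanton equation *)

Definition curv_comp (m : HH) (u v du dv : R) (k : idx) : list HH -> R :=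
  let i := nxt k in let j := nxt i in
  curv2 (dt m) (etam i m) (etap i m) (etam j m) (etap j m) (etam k m) (etap k m) u v du dv.

Lemma covwedge_eval2 (al be : HH -> R) v w :
  covwedge al (one_form be) [v; w] = al v * be w - al w * be v.
Proof. rewrite !covwedge_cons, covwedge_nil; cbn; ring. Qed.

Lemma invariant_curvature_components m u v du dv x y :
  invariant_curvature u v du dv (dt m x) (etap_vec m x) (etam_vec m x) (dt m y) (etap_vec m y) (etam_vec m y) =
  sum3 (fun k => scal (curv_comp m u v du dv k [x; y]) (T k) : quat).
Proof.
destruct (vec_coord m x) as [-> ->]; destruct (vec_coord m y) as [-> ->].
unfold sum3, curv_comp, curv2, fadd3, fadd, fscal; cbn [nxt]; rewrite !covwedge_eval2.
generalize (etap I1 m x), (etap I2 m x), (etap I3 m x), (etam I1 m x), (etam I2 m x),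
 (etam I3 m x), (dt m x), (etap I1 m y), (etap I2 m y), (etap I3 m y), (etam I1 m y),
 (etam I2 m y), (etam I3 m y), (dt m y); clear; intros.
unfold invariant_curvature; cbv -[Rplus Rmult Ropp Rminus Rinv Rdiv IZR]; qsplit; real_eq; ring.
Qed.

Lemma psi_at_eq (A1 B1 : R -> R) m l :
  psi (fun _ => A1) (fun _ => B1) m l =
  psi_at (dt m) (etam I1 m) (etap I1 m) (etam I2 m) (etap I2 m) (etam I3 m) (etap I3 m)
     (A1 (radius m)) (B1 (radius m)) l.
Proof.
set (z := psi_at _ _ _ _ _ _ _ _ _ l).
unfold psi; match goal with |- ?a - ?b = _ => transitivity (a + - (1) * b) end; [ring|].
reflexivity.
Qed.

(** The map [q] allows the curvature to be expressed in another gauge. Being linear it passes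
    through the wedge product, so it suffices that the scalar coefficients of the T_k vanish. *)
Lemma instanton_M0 (A1 B1 : R -> R) (al : HH -> HH -> quat) :
  (forall t, 0 < t -> 0 < A1 t) -> (forall t, 0 < t -> 0 < B1 t) ->
  (forall m, M0 m -> exists (q : quat -> quat) (u v du dv : R),
    (forall x y, q (plus x y) = plus (q x) (q y)) /\
    (forall (k : R) x, q (scal k x) = scal k (q x)) /\
    du = (u - u ^ 2) / A1 (radius m) + A1 (radius m) / B1 (radius m) ^ 2 * (v ^ 2 - u) /\
    dv = 2 / A1 (radius m) * v * (u - 1) /\
    forall x y, TM m x -> TM m y -> curvature al m x y =
      q (invariant_curvature u v du dv (dt m x) (etap_vec m x) (etam_vec m x)
                       (dt m y) (etap_vec m y) (etam_vec m y))) ->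
  wedge_vanishes M0 (Defs.form2 (curvature al)) (psi (fun _ => A1) (fun _ => B1)).
Proof.
intros HA HB H m v1 v2 v3 v4 v5 v6 Hm H1 H2 H3 H4 H5 H6.
destruct (H m Hm) as (q & u & v & du & dv & qp & qs & Eu & Ev & EK).
set (l := [v1; v2; v3; v4; v5; v6]).
assert (Hl : forall x, In x l -> TM m x).
  intros x [<-|[<-|[<-|[<-|[<-|[<-|[]]]]]]]; assumption.
change (pwedge 2 (Defs.form2 (curvature al) m) (psi (fun _ => A1) (fun _ => B1) m) l = zero).
assert (Hr := radius_pos m Hm).
set (f := psi_at (dt m) (etam I1 m) (etap I1 m) (etam I2 m) (etap I2 m) (etam I3 m) (etap I3 m)
     (A1 (radius m)) (B1 (radius m))).
rewrite (pwedge_ext 2 _ (fun x => sum3 (fun k => scal (curv_comp m u v du dv k x) (q (T k)) : quat)) _ f).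
- destruct (instanton_components (dt m) (etam I1 m) (etap I1 m) (etam I2 m) (etap I2 m)
    (etam I3 m) (etap I3 m) (A1 (radius m)) (B1 (radius m)) u v du dv
    (Rgt_not_eq _ _ (HA _ Hr)) (Rgt_not_eq _ _ (HB _ Hr)) Eu Ev l) as (C1 & C2 & C3).
  assert (Z : forall k, pwedge 2 (fun x => scal (curv_comp m u v du dv k x) (q (T k)) : quat) f l = zero).
    intros k.
    transitivity (scal (pwedge (W := R_NormedModule) 2 (curv_comp m u v du dv k) f l) (q (T k)) : quat).
      exact (pwedge_scal_l 2 (curv_comp m u v du dv k) (q (T k)) f l).
    replace (pwedge (W := R_NormedModule) 2 (curv_comp m u v du dv k) f l) with 0.
      generalize (q (T k)); clear; qring.
    symmetry; destruct k; assumption.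
  unfold sum3.
  transitivity (plus (plus (zero : quat) zero) zero); [|clear; qring].
  rewrite <- (Z I1) at 1; rewrite <- (Z I2) at 1; rewrite <- (Z I3) at 1.
  set (G := fun k x => scal (curv_comp m u v du dv k x) (q (T k)) : quat).
  etransitivity; [exact (pwedge_plus_l 2 (fun x => plus (G I1 x) (G I2 x)) (G I3) f l)|].
  apply f_equal2; [|reflexivity]; exact (pwedge_plus_l 2 (G I1) (G I2) f l).
- intros x y Hx Ix _ _; split; [|apply psi_at_eq].
  destruct x as [|x [|x' [|]]]; try discriminate Hx; cbn [Defs.form2].
  rewrite EK, invariant_curvature_components by (apply Hl, Ix; cbn; auto).
  unfold sum3; rewrite !qp, !qs; reflexivity.
Qed.

(** * From the complement to the singular orbit *)

Lemma wedge_psi_ext (D : HH -> Prop) F (Psi Psi' : form R) :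
  (forall m v1 v2 v3 v4, D m -> TM m v1 -> TM m v2 -> TM m v3 -> TM m v4 ->
    Psi m [v1; v2; v3; v4] = Psi' m [v1; v2; v3; v4]) ->
  wedge_vanishes D F Psi' -> wedge_vanishes D F Psi.
Proof.
intros E H m v1 v2 v3 v4 v5 v6 Hm H1 H2 H3 H4 H5 H6.
rewrite <- (H m v1 v2 v3 v4 v5 v6) by assumption.
apply (pwedge_ext 2 (F m) (F m) (Psi m) (Psi' m)); intros x y _ _ Hy Iy; split; [reflexivity|].
assert (Hl : forall x, In x [v1; v2; v3; v4; v5; v6] -> TM m x).
  intros z [<-|[<-|[<-|[<-|[<-|[<-|[]]]]]]]; assumption.
destruct y as [|y1 [|y2 [|y3 [|y4 [|]]]]]; try discriminate Hy.
apply E; [exact Hm|..]; apply Hl, Iy; cbn; auto.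
Qed.

Lemma pwedge_continuous {X : Type} {W : NormedModule R_AbsRing} k
  (a : R -> list X -> W) (b : R -> list X -> R) l s0 :
  (forall x, length x = k -> incl x l -> continuous (fun s => a s x) s0) ->
  (forall y, length y = (length l - k)%nat -> incl y l -> continuous (fun s => b s y) s0) ->
  continuous (fun s => pwedge k (a s) (b s) l) s0.
Proof.
intros Ha Hb; unfold pwedge; assert (Hs := fun s x y => shuffles_spec k l s x y).
induction (shuffles k l) as [|[[s x] y] L IH]; cbn [fold_right]; [apply continuous_const|].
destruct (Hs s x y (or_introl eq_refl)) as (H1 & H2 & H3 & H4).
apply (continuous_plus (K := R_AbsRing)).
- apply (continuous_scal (K := R_AbsRing) (fun u => s * b u y) (fun u => a u x)); [|auto].
  apply (continuous_Rmult (fun _ => s)); [apply continuous_const | auto].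
- apply IH; intros s' x' y' Hi; exact (Hs s' x' y' (or_intror Hi)).
Qed.

Lemma eq_zero_of_punctured {W : NormedModule R_AbsRing} (f : R -> W) :
  continuous f 0 -> (forall s, s <> 0 -> f s = zero) -> f 0 = zero.
Proof.
intros Hc H0; symmetry.
apply (filterlim_locally_unique (F := at_right 0) f).
- apply (filterlim_ext_loc (fun _ => zero)); [|apply filterlim_const].
  exists posreal_one; intros t _ Ht; symmetry; apply H0; lra.
- exact (filterlim_filter_le_1 (F := locally 0) f (filter_le_within _) Hc).
Qed.

(** A point of the singular orbit is approached from the complement. Along the approach the
    curvature formula and the smooth four-form are continuous, so the vanishing of their product
    passes to the limit. *)
Lemma wedge_vanishes_extension A B (K : HH -> HH -> HH -> quat) (Psi : form R) :
  extends_psi A B Psi ->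
  (forall v w n, Cn n (fun m => K m v w)) ->
  wedge_vanishes M0 (Defs.form2 K) (psi A B) -> wedge_vanishes M (Defs.form2 K) Psi.
Proof.
intros [Hs He] HK H0.
assert (H0' : wedge_vanishes M0 (Defs.form2 K) Psi) by exact (wedge_psi_ext M0 _ _ _ He H0).
intros [p q] v1 v2 v3 v4 v5 v6 Hm H1 H2 H3 H4 H5 H6.
assert (Hp : p = (0, 0, 0, 0) \/ p <> (0, 0, 0, 0)).
  destruct (Req_dec (qdot p p) 0) as [E|E].
    left; rewrite qdot_coord in E; apply quat_eq; cbn; unfold q0, q1, q2, q3 in *; nra.
  right; intros ->; apply E; rewrite qdot_coord; cbn; ring.
destruct Hp as [->|Hp]; [|apply H0'; auto; split; assumption].
set (l := [v1; v2; v3; v4; v5; v6]).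
(* Only the first factor moves. Tangency depends on q alone, so the same six vectors are tangent all
   along the path. *)
set (path := fun s : R => ((s, 0, 0, 0), q) : HH).
assert (Hl : forall x, In x l -> forall s, TM (path s) x).
  intros x Hx s; revert Hx; intros [<-|[<-|[<-|[<-|[<-|[<-|[]]]]]]]; assumption.
assert (Cp : forall s, continuous path s).
  intros s; assert (C : Cn 0 path); [|exact (Cn_continuous 0 path s C)].
  unfold path; apply Cn_pair; [|apply Cn_const]; apply Cn_quat_intro;
    first [apply (Cn_id (V := R_NormedModule)) | apply Cn_const].
apply (eq_zero_of_punctured (fun s => wedge 2 (Defs.form2 K) Psi (path s) l)).
2: { intros s Hs0; apply H0'; try assumption; split; [exact Hm|].
     intros E; apply Hs0; injection E; auto. }
apply (pwedge_continuous 2 (fun s => Defs.form2 K (path s)) (fun s => Psi (path s))).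
- intros x Hx Ix; destruct x as [|x [|x' [|]]]; try discriminate Hx; cbn [Defs.form2].
  apply (continuous_comp path (fun m => K m x x')); [apply Cp|].
  exact (Cn_continuous 0 _ _ (HK x x' 0%nat)).
- intros y Hy Iy; destruct y as [|y1 [|y2 [|y3 [|y4 [|]]]]]; try discriminate Hy.
  assert (T1 : forall s, TM (path s) y1) by (intros s; apply Hl, Iy; cbn; auto).
  assert (T2 : forall s, TM (path s) y2) by (intros s; apply Hl, Iy; cbn; auto).
  assert (T3 : forall s, TM (path s) y3) by (intros s; apply Hl, Iy; cbn; auto).
  assert (T4 : forall s, TM (path s) y4) by (intros s; apply Hl, Iy; cbn; auto).
  set (z := fun s => (path s, (y1, y2, y3, y4)) : HH * (HH * HH * HH * HH)).
  assert (C : Cn 0 z).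
    unfold z, path; apply Cn_pair; [|apply Cn_const].
    apply Cn_pair; [|apply Cn_const]; apply Cn_quat_intro;
      first [apply (Cn_id (V := R_NormedModule)) | apply Cn_const].
  assert (Cz := Cn_continuous 0 z 0 C).
  destruct (Hs (z 0)) as (O & g & HO & Oz & Hg & Eg).
    exact (conj Hm (conj (T1 0) (conj (T2 0) (conj (T3 0) (T4 0))))).
  apply (continuous_ext_loc _ (fun s => g (z s))).
    assert (Lz : locally 0 (fun s : R => O (z s))) by exact (Cz O (HO _ Oz)).
    apply (filter_imp (fun s => O (z s))); [|exact Lz]; intros s Os.
    exact (Eg (z s) Os (conj Hm (conj (T1 s) (conj (T2 s) (conj (T3 s) (T4 s)))))).
  destruct (Hg 0%nat) as [Cg _]; specialize (Cg (z 0) Oz).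
  intros Q HQ; exact (Cz _ (Cg Q HQ)).
Qed.

Lemma wedge_form_ext (D : HH -> Prop) K K' (Psi : form R) :
  (forall m v w, D m -> TM m v -> TM m w -> K m v w = K' m v w) ->
  wedge_vanishes D (Defs.form2 K') Psi -> wedge_vanishes D (Defs.form2 K) Psi.
Proof.
intros E H m v1 v2 v3 v4 v5 v6 Hm H1 H2 H3 H4 H5 H6.
rewrite <- (H m v1 v2 v3 v4 v5 v6) by assumption.
apply (pwedge_ext 2 (Defs.form2 K m) (Defs.form2 K' m) (Psi m) (Psi m)).
intros x y Hx Ix _ _; split; [|reflexivity].
assert (Hl : forall x, In x [v1; v2; v3; v4; v5; v6] -> TM m x).
  intros z [<-|[<-|[<-|[<-|[<-|[<-|[]]]]]]]; assumption.
destruct x as [|x [|x' [|]]]; try discriminate Hx.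
apply E; [exact Hm|..]; apply Hl, Ix; cbn; auto.
Qed.

Lemma G2_instanton_of_closed_curvature A B al K :
  (forall m v w, M m -> TM m v -> TM m w -> curvature al m v w = K m v w) ->
  (forall v w n, Cn n (fun m => K m v w)) ->
  wedge_vanishes M0 (Defs.form2 (curvature al)) (psi A B) -> G2_instanton A B (conn al).
Proof.
intros E HK H; unfold G2_instanton; rewrite potential_conn; split; [exact H|].
intros Psi HPsi; apply (wedge_form_ext M _ _ _ E).
apply (wedge_vanishes_extension A B K Psi HPsi HK).
apply (wedge_form_ext M0 K (curvature al)); [|exact H].
intros m v w Hm Hv Hw; symmetry; apply E; [apply Hm | exact Hv | exact Hw].
Qed.

(** * The two families *)

Section Restriction.
Variables m v : HH.
Hypothesis Hm : M0 m.
Hypothesis Hv : TM m v.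
Local Notation p := (fst m).
Local Notation r := (radius m).

Lemma restriction_potential_P1 U :
  conn (potential_P1 U) (m, lambda_1 (a1 m)) (v, dQ (fun m' => lambda_1 (a1 m')) m v) =
  scal (r ^ 2 * U r) (etap_vec m v).
Proof.
rewrite (dQ_unique m v _ zero (is_derive_qconst qone 0)).
change (potential (conn (potential_P1 U)) m v = scal (r ^ 2 * U r) (etap_vec m v)).
rewrite potential_conn; unfold potential_P1; rewrite frame_snd by assumption.
assert (Hr := radius_neq0 m Hm).
assert (E : qim (qconj p ** fst v) = scal (r ^ 2) (plus (etap_vec m v) (etam_vec m v))).
  rewrite vec_sum, mc1_eq by assumption.
  transitivity (scal (r ^ 2 * / r ^ 2) (qim (qconj p ** fst v)) : quat).
    replace (r ^ 2 * / r ^ 2) with 1 by (field; exact Hr).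
    generalize (qim (qconj p ** fst v)); clear; qring.
  generalize (/ r ^ 2), (r ^ 2), (qim (qconj p ** fst v)); clear; qring.
change (qabs p) with r; rewrite E, mul_conj_mul, Ad_scal, conj_Ad, qmul_scal_l, mul_conj_scal.
rewrite <- radius_sqr by assumption; revert Hr.
generalize (etap_vec m v), (etam_vec m v), (U r), r; clear; intros P0 N0 k t Ht.
destruct P0 as [[[? ?] ?] ?], N0 as [[[? ?] ?] ?].
cbv -[Rplus Rmult Ropp Rminus Rinv Rdiv IZR]; qsplit; real_eq; field; exact Ht.
Qed.

(** The derivative of the section [a1] contributes [mc1], the sum of both frame components, hence
    the 1 in either coefficient. The terms in dp give equal multiples r^2 Z of both, and those in dq
    change only the eta^- part. *)
Lemma restriction_potential_Pid Z Y :
  conn (potential_Pid Z Y) (m, lambda_id (a1 m)) (v, dQ (fun m' => lambda_id (a1 m')) m v) =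
  plus (scal (1 + r ^ 2 * Z r) (etap_vec m v))
       (scal (1 + r ^ 2 * Z r + 2 * Y r) (etam_vec m v)).
Proof.
change (fun m' => lambda_id (a1 m')) with a1; change (lambda_id (a1 m)) with (a1 m).
unfold conn; cbn [fst snd]; rewrite dQ_a1, qmulA, qconj_mul_self, qmul1l by
  (try apply SU2_a1; assumption).
unfold potential_Pid; rewrite frame_snd, (frame_fst m v) by assumption.
change (qabs p) with r; rewrite !mul_conj_mul, qim_Ad, !Ad_scal, Ad_plus.
assert (Hr := radius_neq0 m Hm).
assert (E : forall x, qconj (a1 m) ** Ad p x ** a1 m = scal (r ^ 2) x).
  intros x; rewrite a1_frame.
  transitivity (scal (/ r * / r) (qconj p ** Ad p x ** p)).
    generalize (Ad p x), (/ r), p; clear; qring.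
  rewrite conj_Ad, qmul_scal_l, mul_conj_scal, <- radius_sqr by assumption.
  revert Hr; generalize x, r; clear; intros x t Ht; destruct x as [[[? ?] ?] ?].
  cbv -[Rplus Rmult Ropp Rminus Rinv Rdiv IZR]; qsplit; real_eq; field; exact Ht.
rewrite E, <- vec_sum by assumption.
destruct (vec_coord m v) as [-> ->]; revert Hr.
generalize (etap I1 m v), (etap I2 m v), (etap I3 m v), (etam I1 m v), (etam I2 m v),
 (etam I3 m v), (dt m v), (Z r), (Y r), r; clear; intros.
cbv -[Rplus Rmult Ropp Rminus Rinv Rdiv IZR]; qsplit; real_eq; field; exact Hr.
Qed.

End Restriction.

Lemma is_derive_sqr_mult f t : esmooth f ->
  is_derive (fun t => t ^ 2 * f t) t (2 * t * f t + t ^ 2 * (t * Dq f t)).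
Proof.
intros Hf; apply (is_derive_Rmult (fun t => t ^ 2)); [|apply is_derive_esmooth, Hf].
auto_derive; [exact I | ring].
Qed.

Lemma is_derive_R_unique (f : R -> R) x l l' : is_derive f x l -> is_derive f x l' -> l = l'.
Proof.
intros H H'; rewrite <- (is_derive_unique _ _ _ H); apply is_derive_unique, H'.
Qed.

Lemma even_positive f : esmooth f -> (forall t, 0 <= t -> 0 < f t) -> forall t, 0 < f t.
Proof.
intros [_ Ef] H t; destruct (Rle_dec 0 t); [auto|]; rewrite <- Ef; apply H; lra.
Qed.

Section Families.
Variables A1 B1 a b : R -> R.
Hypothesis a_smooth : esmooth a.
Hypothesis b_smooth : esmooth b.
Hypothesis a_pos : forall t, 0 < a t.
Hypothesis b_pos : forall t, 0 < b t.
Hypothesis a_0 : a 0 = 1 / 2.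
Hypothesis A1_a : forall t, 0 <= t -> A1 t = t * a t.
Hypothesis B1_b : forall t, 0 <= t -> B1 t = b t.

Lemma A1_positive t : 0 < t -> 0 < A1 t.
Proof. intros Ht; rewrite A1_a by lra; apply Rmult_lt_0_compat; auto. Qed.

Lemma B1_positive t : 0 < t -> 0 < B1 t.
Proof. intros Ht; rewrite B1_b by lra; auto. Qed.

Lemma family_P1 x1 : 0 <= x1 -> exists theta,
  smooth_connection theta /\
  restricts_to lambda_1 theta (theta_x1 A1 B1 x1) /\
  SU2cube_invariant lambda_1 theta /\
  G2_instanton (fun _ => A1) (fun _ => B1) theta.
Proof.
intros Hx; destruct (explicit_profile A1 B1 a b a_smooth b_smooth a_pos b_pos a_0 A1_a B1_b x1 Hx)
  as (U & SU & EU & DU).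
exists (conn (potential_P1 U)); split; [|split; [|split]].
- apply conn_smooth_connection;
    [intros; apply potential_P1_smooth, SU | apply potential_P1_linear | apply potential_P1_su2].
- intros m v Hm Hv; rewrite restriction_potential_P1 by assumption.
  unfold theta_x1, invariant_form; rewrite EU by (apply radius_pos, Hm).
  change (scal (radius m ^ 2 * U (radius m)) (etap_vec m v) =
    plus (scal (radius m ^ 2 * U (radius m)) (etap_vec m v)) (scal 0 (etam_vec m v))).
  generalize (etap_vec m v), (etam_vec m v), (radius m ^ 2 * U (radius m)); clear; qring.
- apply (conn_invariant _ _ snd is_linear_snd); auto.
  + intros [[h1 h2] c] Hg; apply Hg.
  + intros [[h1 h2] c] [[h1' h2'] c']; reflexivity.
  + intros; apply potential_P1_invariant; assumption.
- apply (G2_instanton_of_closed_curvature _ _ _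
    (curvature_closed (potential_P1 U) (fun m v => dpotential_P1 m v U))).
  + intros; apply curvature_potential_P1; assumption.
  + intros; apply curvature_closed_potential_P1_smooth, SU.
  + apply instanton_M0; [exact A1_positive | exact B1_positive|]; intros m Hm.
    assert (Hr := radius_pos m Hm); set (r := radius m) in *.
    exists (fun x => x), (r ^ 2 * U r), 0, (2 * r * U r + r ^ 2 * (r * Dq U r)), 0.
    split; [reflexivity|split; [reflexivity|split; [|split]]].
    (* The product rule and the equation of the profile give two expressions for the same
       derivative. *)
    * rewrite (is_derive_R_unique _ _ _ _ (is_derive_sqr_mult U r SU) (DU r Hr)).
      rewrite A1_a, B1_b by lra; assert (Ha := a_pos r); assert (Hb := b_pos r).
      unfold ab2; field; split; lra.
    * ring.
    * intros x y Hx' Hy; apply curvature_potential_P1_M0; assumption.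
Qed.

Lemma family_Pid y0 : - 1 <= b 0 * y0 <= 1 -> exists theta,
  smooth_connection theta /\
  (exists x y : R -> R,
     restricts_to lambda_id theta (theta_xy A1 B1 x y) /\
     filterlim y (at_right 0) (locally y0)) /\
  SU2cube_invariant lambda_id theta /\
  G2_instanton (fun _ => A1) (fun _ => B1) theta.
Proof.
intros Hy; destruct (nonflat_profiles a b a_smooth b_smooth a_pos b_pos a_0 _ Hy)
  as (z & v & Sz & Sv & v0 & Dw & Dv).
(* Chosen so that u = 1 - t^2 z equals 1 + t^2 Z and v equals u + 2 Y, the coefficients of the
   restricted connection. *)
set (Z := fun t => - z t).
set (Y := fun t => (v t - 1 - t ^ 2 * Z t) / 2).
assert (SZ : esmooth Z) by apply esmooth_opp, Sz.
assert (SY : esmooth Y).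
  apply esmooth_mult; [|apply esmooth_const].
  apply esmooth_minus; [apply esmooth_minus; [exact Sv | apply esmooth_const]|].
  apply esmooth_mult; [apply esmooth_sqr | exact SZ].
assert (EY : forall t, 1 + t ^ 2 * Z t + 2 * Y t = v t) by (intros t; unfold Y; field).
exists (conn (potential_Pid Z Y)); split; [|split; [|split]].
- apply conn_smooth_connection;
    [intros; apply potential_Pid_smooth; assumption | apply potential_Pid_linear | apply potential_Pid_su2].
- exists (fun t => (1 + t ^ 2 * Z t) / A1 t), (fun t => v t / B1 t); split.
  + intros m w Hm Hw; rewrite restriction_potential_Pid, EY by assumption.
    assert (HA := A1_positive _ (radius_pos m Hm)); assert (HB := B1_positive _ (radius_pos m Hm)).
    unfold theta_xy, invariant_form; set (r := radius m) in *.
    replace (A1 r * ((1 + r ^ 2 * Z r) / A1 r)) with (1 + r ^ 2 * Z r) by (field; lra).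
    replace (B1 r * (v r / B1 r)) with (v r) by (field; lra).
    reflexivity.
  + apply (filterlim_ext_loc (fun t => v t / b t)).
      exists posreal_one; intros t _ Ht; rewrite B1_b by lra; reflexivity.
    replace y0 with (v 0 / b 0) by (rewrite v0; field; apply Rgt_not_eq, b_pos).
    apply (filterlim_filter_le_1 (F := locally 0) _ (filter_le_within _)).
    apply (esmooth_continuous (fun t => v t / b t)), esmooth_div; try assumption.
    intros; apply Rgt_not_eq, b_pos.
- apply (conn_invariant _ _ (fun g : SU2cube_carrier => fst (fst g))).
  + smooth.
  + intros [[h1 h2] c] Hg; apply Hg.
  + reflexivity.
  + intros [[h1 h2] c] [[h1' h2'] c']; reflexivity.
  + reflexivity.
  + intros; apply potential_Pid_invariant; assumption.
- apply (G2_instanton_of_closed_curvature _ _ _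
    (curvature_closed (potential_Pid Z Y) (fun m v => dpotential_Pid m v Z Y))).
  + intros; apply curvature_potential_Pid; assumption.
  + intros; apply curvature_closed_potential_Pid_smooth; assumption.
  + apply instanton_M0; [exact A1_positive | exact B1_positive|]; intros m Hm.
    assert (Hr := radius_pos m Hm); set (r := radius m) in *.
    exists (fun x => scal (/ r ^ 2) (Ad (fst m) x)), (1 + r ^ 2 * Z r), (1 + r ^ 2 * Z r + 2 * Y r),
      (2 * r * Z r + r ^ 2 * (r * Dq Z r)),
      (2 * r * Z r + r ^ 2 * (r * Dq Z r) + 2 * (r * Dq Y r)).
    assert (DZ := is_derive_sqr_mult Z r SZ).
    assert (Ha := a_pos r); assert (Hb := b_pos r).
    split; [|split; [|split; [|split]]].
    * intros x y; rewrite <- Ad_plus; generalize (Ad (fst m) x), (Ad (fst m) y), (/ r ^ 2).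
      clear; qring.
    * intros k x; rewrite <- Ad_scal; generalize (Ad (fst m) x), (/ r ^ 2); clear; qring.
    * assert (DZ' : is_derive (fun t => t ^ 2 * Z t) r
        (- (- (1 - r ^ 2 * z r) * (r ^ 2 * z r) / (r * a r)
            + r * ab2 a b r * (1 - r ^ 2 * z r - v r ^ 2)))).
        apply (is_derive_ext (fun t => - (t ^ 2 * z t))).
          intros t; unfold Z; real_eq; ring.
        apply is_derive_Ropp, Dw, Hr.
      rewrite (is_derive_R_unique _ _ _ _ DZ DZ'), EY, A1_a, B1_b by lra.
      unfold Z, ab2; field; split; lra.
    * assert (DV : is_derive v r (2 * r * Z r + r ^ 2 * (r * Dq Z r) + 2 * (r * Dq Y r))).
        apply (is_derive_ext (fun t => 1 + t ^ 2 * Z t + 2 * Y t)); [exact EY|].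
        apply is_derive_Rplus.
          apply (is_derive_eq _ _ (0 + (2 * r * Z r + r ^ 2 * (r * Dq Z r)))); [|real_eq; ring].
          apply (is_derive_Rplus (fun _ => 1)); [|exact DZ].
          apply (is_derive_const (K := R_AbsRing) (V := R_NormedModule)).
        apply is_derive_scal, is_derive_esmooth, SY.
      rewrite (is_derive_R_unique _ _ _ _ DV (Dv r Hr)), EY, A1_a by lra.
      unfold Z; field; split; lra.
    * intros x y Hx' Hy'; apply curvature_potential_Pid_M0; assumption.
Qed.

End Families.

Theorem theorem1p1 (A1 B1 : R -> R) (b0 : R)
  (A1_smooth : smooth_halfline A1)
  (A1_pos : forall t, 0 < t -> 0 < A1 t)
  (A1_odd : odd_at_0 A1)
  (A1_der0 : is_right_derive A1 0 (1 / 2))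
  (b0_pos : 0 < b0)
  (B1_smooth : smooth_halfline B1)
  (B1_pos : forall t, 0 <= t -> 0 < B1 t)
  (B1_even : even_at_0 B1)
  (B1_0 : B1 0 = b0)
  (B1_ode : forall t, 0 < t ->
     is_derive (fun s => A1 s ^ 2 * B1 s ^ 2) t (A1 t ^ 3 + A1 t * B1 t ^ 2)) :
  exists theta1 theta2 : R -> PP -> PP -> quat,
    (forall x1, 0 <= x1 ->
       smooth_connection (theta1 x1) /\
       restricts_to lambda_1 (theta1 x1) (theta_x1 A1 B1 x1) /\
       SU2cube_invariant lambda_1 (theta1 x1) /\
       G2_instanton (fun _ => A1) (fun _ => B1) (theta1 x1)) /\
    (forall y0, - 1 / b0 <= y0 <= 1 / b0 ->
       smooth_connection (theta2 y0) /\
       (exists x y : R -> R,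
          restricts_to lambda_id (theta2 y0) (theta_xy A1 B1 x y) /\
          filterlim y (at_right 0) (locally y0)) /\
       SU2cube_invariant lambda_id (theta2 y0) /\
       G2_instanton (fun _ => A1) (fun _ => B1) (theta2 y0)).
Proof.
destruct (odd_extension A1 (1 / 2) A1_smooth A1_odd A1_der0) as (a & Sa & a0 & Ea).
destruct (even_extension B1 B1_smooth B1_even) as (b & Sb & Eb).
assert (Pa : forall t, 0 < a t).
  apply even_positive; [exact Sa|]; intros t [Ht| <-]; [|lra].
  apply (Rmult_lt_reg_l t); [exact Ht|]; rewrite Rmult_0_r, <- Ea by lra; auto.
assert (Pb : forall t, 0 < b t).
  apply even_positive; [exact Sb|]; intros t Ht; rewrite <- Eb by exact Ht; auto.
assert (Eb0 : b 0 = b0) by (rewrite <- Eb by lra; exact B1_0).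
(* Choice turns existence for each parameter into a family; outside the parameter range the
   condition is vacuous and a dummy value is taken. *)
destruct (functional_choice (fun x1 theta => 0 <= x1 ->
  smooth_connection theta /\ restricts_to lambda_1 theta (theta_x1 A1 B1 x1) /\
  SU2cube_invariant lambda_1 theta /\ G2_instanton (fun _ => A1) (fun _ => B1) theta))
  as [theta1 H1].
  intros x1; destruct (Rle_dec 0 x1) as [Hx|Hx].
    destruct (family_P1 A1 B1 a b Sa Sb Pa Pb a0 Ea Eb x1 Hx) as [theta H]; exists theta; auto.
  exists (fun _ _ => qone); intros; contradiction.
destruct (functional_choice (fun y0 theta => - 1 / b0 <= y0 <= 1 / b0 ->
  smooth_connection theta /\
  (exists x y : R -> R, restricts_to lambda_id theta (theta_xy A1 B1 x y) /\
     filterlim y (at_right 0) (locally y0)) /\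
  SU2cube_invariant lambda_id theta /\ G2_instanton (fun _ => A1) (fun _ => B1) theta))
  as [theta2 H2].
  intros y0; destruct (Rle_dec (Rabs (b0 * y0)) 1) as [Hy|Hy].
    apply Rabs_le_between in Hy; rewrite <- Eb0 in Hy.
    destruct (family_Pid A1 B1 a b Sa Sb Pa Pb a0 Ea Eb y0 Hy) as [theta H]; exists theta; auto.
  exists (fun _ _ => qone); intros [Hl Hu]; exfalso; apply Hy, Rabs_le.
  apply (Rmult_le_compat_l b0) in Hl; [|lra]; apply (Rmult_le_compat_l b0) in Hu; [|lra].
  replace (b0 * (- 1 / b0)) with (- (1)) in Hl by (field; lra).
  replace (b0 * (1 / b0)) with 1 in Hu by (field; lra); lra.
exists theta1, theta2; split; assumption.
Qed.
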